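(* Let $E$ be a real separable Banach space with open unit ball $B$, let $L:\mathbb{R}_+\times E\times E\to\mathbb{R}\cup\{+\infty\}$ and let $\Gamma:\mathbb{R}_+\times E\rightsquigarrow E$ be a multifunction. Assume: (a) $\mathcal{A}_{(t,\xi)}\neq\emptyset$ for every $(t,\xi)\in\mathbb{R}_+\times E$; (b) $L(\cdot,x,y)$ is measurable for every $(x,y)\in E\times E$; (c) there exist an integrable function $l_1:\mathbb{R}_+\to\mathbb{R}_+$ and a locally bounded, integrable function $l_2:\mathbb{R}_+\to\mathbb{R}_+$ such that $|L(t,0,0)|\le l_1(t)$ and $|L(t,x,y)-L(t,x',y')|\le l_1(t)\|x-x'\|+l_2(t)\|y-y'\|$ for every $t\in\mathbb{R}_+$ and every $(x,y),(x',y')\in E\times E$; (d) $\Gamma$ has nonempty closed values; (e) $\Gamma(\cdot,x)$ is lower semicontinuous for every $x\in E$; (f) there exists a locally integrable function $\gamma:\mathbb{R}_+\to\mathbb{R}_+$ such that $\Gamma(t,0)\subset\gamma(t)B$ and $\Gamma(t,x)\subset\Gamma(t,x')+\gamma(t)\|x-x'\|B$ for every $t\in\mathbb{R}_+$ and $x,x'\in E$; (g) $\int_0^\infty \exp\left(\int_0^s\gamma(\tau)d\tau\right)\left(1+\int_0^s\gamma(\tau)d\tau\right)\left(l_1(s)+l_2(s)\gamma(s)\right)ds<\infty$. Let $\xi\in E$ and let $x_0(\cdot)\in\mathcal{A}_{(0,\xi)}$ be an optimal trajectory for $(\mathrm{P}_0)$. Then: (i) for a.e. $t\in\mathbb{R}_+$,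 $V^-_x(t,x_0(t);\dot{x}_0(t)-v)\le L(t,x_0(t),v)-L(t,x_0(t),\dot{x}_0(t))$ for every $v\in\Gamma(t,x_0(t))$; (ii) $-\partial^-_xV(t,x_0(t))\subset\partial^\circ_yL(t,x_0(t),\dot{x}_0(t))+N_{\Gamma(t,x_0(t))}(\dot{x}_0(t))$ for a.e. $t\in\mathbb{R}_+$. Moreover, if (for a.e. $t\in\mathbb{R}_+$) $L(t,x_0(t),\cdot)$ is strictly differentiable at $\dot{x}_0(t)$, then $$-\partial^-_xV(t,x_0(t))\subset\nabla_yL(t,x_0(t),\dot{x}_0(t))+N_{\Gamma(t,x_0(t))}(\dot{x}_0(t))\quad\text{for a.e. }t\in\mathbb{R}_+.$$ Furthermore, if in addition (for a.e. $t\in\mathbb{R}_+$) $V(t,\cdot)$ is regular at $x_0(t)$ and $\partial^-_xV(t,x_0(t))$ is a singleton, then (for a.e. $t$) $V(t,\cdot)$ is Gateaux differentiable at $x_0(t)$ and $$-\nabla_xV(t,x_0(t))=\nabla_yL(t,x_0(t),\dot{x}_0(t))+q(t)\quad\text{for a.e. }t\in\mathbb{R}_+,$$ where $q:\mathbb{R}_+\to E^*$ is a Borel measurable selector, with respect to the weak$^*$ topology of $E^*$, of the multifunction $t\rightsquigarrow N_{\Gamma(t,x_0(t))}(\dot{x}_0(t))$.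
   Context: $\mathbb{R}_+=[0,\infty)$ carries Lebesgue measure and the Lebesgue $\sigma$-algebra; $E^*$ is the norm dual of $E$. For $t\ge0$, $W^{1,1}_{\mathrm{loc}}([t,\infty),E)$ is the set of locally Bochner integrable $x:[t,\infty)\to E$ whose strong derivative $\dot{x}(s)$ (norm limit of difference quotients) exists for a.e. $s$, with $\dot{x}(\cdot)$ locally Bochner integrable and $x(s)=x(t)+\int_t^s\dot{x}(\tau)d\tau$ for all $s\ge t$. Admissible trajectories: $\mathcal{A}_{(t,\xi)}=\{x(\cdot)\in W^{1,1}_{\mathrm{loc}}([t,\infty),E): \dot{x}(s)\in\Gamma(s,x(s))\text{ for a.e. }s\in[t,\infty),\ x(t)=\xi\}$. Integrals over $[t,\infty)$ of $L(s,x(s),\dot{x}(s))$ are improper: $\int_t^\infty=\lim_{T\to\infty}\int_t^T$ when the limit exists. The problem $(\mathrm{P}_t)$ is to minimize $\int_t^\infty L(s,x(s),\dot{x}(s))ds$ over $x(\cdot)\in\mathcal{A}_{(t,\xi)}$. The value function is $V(t,\xi)=\inf_{x(\cdot)\in\mathcal{A}_{(t,\xi)}}\int_t^\infty L(s,x(s),\dot{x}(s))ds$ (with value $+\infty$ if $\mathcal{A}_{(t,\xi)}=\emptyset$ or no integral is well defined). $x_0(\cdot)\in\mathcal{A}_{(0,\xi)}$ is optimal for $(\mathrm{P}_0)$ if $\int_0^\infty L(s,x_0(s),\dot{x}_0(s))ds=V(0,\xi)>-\infty$. A multifunction $G:\mathbb{R}_+\rightsquigarrow E$ is lower semicontinuous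 if $\{t: G(t)\cap O\neq\emptyset\}$ is open in $\mathbb{R}_+$ for every open $O\subset E$. For $\varphi:E\to\mathbb{R}\cup\{+\infty\}$ and $\bar{x}$ with $\varphi(\bar x)<\infty$: the lower directional derivative is $\varphi^-(\bar{x};v)=\liminf_{u\to v,\,\theta\downarrow0}\frac{\varphi(\bar{x}+\theta u)-\varphi(\bar{x})}{\theta}$, and the Dini–Hadamard subdifferential is $\partial^-\varphi(\bar{x})=\{x^*\in E^*:\langle x^*,v\rangle\le\varphi^-(\bar{x};v)\ \forall v\in E\}$. If $\varphi$ is Lipschitz near $\bar{x}$, the Clarke directional derivative is $\varphi^\circ(\bar{x};v)=\limsup_{x\to\bar{x},\,\theta\downarrow0}\frac{\varphi(x+\theta v)-\varphi(x)}{\theta}$ and the Clarke subdifferential is $\partial^\circ\varphi(\bar{x})=\{x^*\in E^*:\langle x^*,v\rangle\le\varphi^\circ(\bar{x};v)\ \forall v\in E\}$; $\varphi$ is regular at $\bar{x}$ if the one-sided directional derivative $\varphi'(\bar{x};v)=\lim_{\theta\downarrow0}\frac{\varphi(\bar{x}+\theta v)-\varphi(\bar{x})}{\theta}$ exists and equals $\varphi^\circ(\bar{x};v)$ for every $v\in E$. $\varphi$ is Gateaux differentiable at $\bar{x}$ with derivative $\nabla\varphi(\bar{x})\in E^*$ if $\lim_{\theta\to0}\frac{\varphi(\bar{x}+\theta v)-\varphi(\bar{x})}{\theta}=\langle\nabla\varphi(\bar{x}),v\rangle$ for all $v\in E$; it is strictly differentiable at $\bar{x}$ if there is $\nabla\varphi(\bar{x})\in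 E^*$ with $\lim_{x\to\bar{x},\,\theta\to0}\frac{\varphi(x+\theta v)-\varphi(x)}{\theta}=\langle\nabla\varphi(\bar{x}),v\rangle$, uniformly in $v$ in each compact subset of $E$. For nonempty $C\subset E$ with distance function $d_C(x)=\inf_{c\in C}\|x-c\|$ and $\bar{x}\in C$: the Clarke tangent cone is $T_C(\bar{x})=\{v\in E: d_C^\circ(\bar{x};v)=0\}$ and the Clarke normal cone is $N_C(\bar{x})=\{x^*\in E^*:\langle x^*,v\rangle\le0\ \forall v\in T_C(\bar{x})\}$. Subscripts denote partial objects: $V_x^-(t,x;v)$, $\partial^-_xV(t,x)$, $\nabla_xV(t,x)$ refer to $V(t,\cdot)$ at $x$; $\partial^\circ_yL(t,x,y)$, $\nabla_yL(t,x,y)$ refer to $L(t,x,\cdot)$ at $y$. A selector of a multifunction $\Phi$ is a function $q$ with $q(t)\in\Phi(t)$ for a.e. $t$. *)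

(* Defs.v *)
From HB Require Import structures.
From mathcomp Require Import all_boot all_order all_algebra.
From mathcomp Require Import all_classical all_reals all_analysis.
From mathcomp Require Import measurable_realfun.

Set Implicit Arguments.
Unset Strict Implicit.
Unset Printing Implicit Defensive.

Import Order.TTheory GRing.Theory Num.Theory.
Import numFieldNormedType.Exports.

Local Open Scope classical_set_scope.
Local Open Scope ring_scope.

(* The carrier of [completed_lebesgue_measure] is R, equipped with the Lebesgue
   (Caratheodory) sigma-algebra instead of the Borel one. *)
Notation Rleb R := (caratheodory_type ((wlength (@idfun R))^*)%mu).
Notation leb := (@completed_lebesgue_measure _).

Definition ae_from (R : realType) (t : R) (P : R -> Prop) : Prop :=
  \forall s \ae leb, t <= (s : R) -> P s.

Definition leb_measurable (R : realType) (A : set R) : Prop :=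
  measurable (A : set (Rleb R)).

Definition leb_measurable_fun (R : realType) (D : set R) (f : R -> \bar R) :
    Prop :=
  measurable_fun (D : set (Rleb R)) f.

Definition leb_integrable (R : realType) (D : set R) (f : R -> R) : Prop :=
  leb.-integrable D (fun s => (f s)%:E).

Definition leb_integral (R : realType) (D : set R) (f : R -> \bar R) : \bar R :=
  (\int[leb]_(s in D) f s)%E.

(* The library integral is also assigned to non-measurable functions and to
   indeterminate +oo - oo differences; both are excluded here. *)
Definition leb_integral_defined (R : realType) (D : set R) (f : R -> \bar R) :
    Prop :=
  leb_measurable_fun D f /\
  ((leb_integral D (f^\+)%E < +oo)%E \/ (leb_integral D (f^\-)%E < +oo)%E).

Definition is_improper_integral (R : realType) (t : R) (f : R -> \bar R)
    (l : \bar R) : Prop :=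
  (forall T, t <= T -> leb_integral_defined `[t, T] f) /\
  (fun T : R => leb_integral `[t, T] f) @ +oo%R --> l.

Section Bochner.
Context {R : realType} {E : completeNormedModType R}.
Implicit Types (D : set R) (f s : R -> E).

Definition bochner_simple D s : Prop :=
  finite_set (s @` D) /\
  forall e : E, leb_measurable (D `&` s @^-1` [set e]) /\
    (e != 0 -> (leb (D `&` s @^-1` [set e]) < +oo)%E).

Definition bochner_simple_integral D s : E :=
  \sum_(e \in s @` D) fine (leb (D `&` s @^-1` [set e])) *: e.

Definition is_bochner_integral D f (v : E) : Prop :=
  exists s_ : nat -> R -> E,
  [/\ forall n, bochner_simple D (s_ n),
      \forall t \ae leb, D t -> (fun n => s_ n t) @ \oo --> f t,
      (fun n => leb_integral D (fun t => `|f t - s_ n t|%:E)) @ \oo --> 0%E &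
      (fun n => bochner_simple_integral D (s_ n)) @ \oo --> v].

Definition bochner_integrable D f : Prop :=
  exists v, is_bochner_integral D f v.

Definition locally_bochner_integrable (t : R) f : Prop :=
  forall T, t <= T -> bochner_integrable `[t, T] f.

(* Functions on [t, +oo[ are represented by functions on R, whose values to the
   left of t play no role: at s > t the two-sided derivative only depends on x
   restricted to [t, +oo[, and s = t is a null set. *)
Definition W11loc (t : R) (x : R -> E) : Prop :=
  [/\ locally_bochner_integrable t x,
      ae_from t (fun s : R => derivable x s 1),
      locally_bochner_integrable t (derive1 x) &
      forall s : R, t <= s -> is_bochner_integral `[t, s] (derive1 x) (x s - x t)].

End Bochner.

Section Control.
Context {R : realType} {E : completeNormedModType R}.
Variables (L : R -> E -> E -> \bar R) (Gamma : R -> E -> set E).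

Definition admissible (t : R) (xi : E) (x : R -> E) : Prop :=
  [/\ W11loc t x, ae_from t (fun s => Gamma s (x s) (derive1 x s)) & x t = xi].

Definition is_cost (t : R) (x : R -> E) (l : \bar R) : Prop :=
  is_improper_integral t (fun s => L s (x s) (derive1 x s)) l.

(* [ereal_inf set0 = +oo] *)
Definition value (t : R) (xi : E) : \bar R :=
  ereal_inf [set l | exists2 x, admissible t xi x & is_cost t x l].

Definition optimal (xi : E) (x : R -> E) : Prop :=
  [/\ admissible 0 xi x, is_cost 0 x (value 0 xi) & (-oo < value 0 xi)%E].

End Control.

(* Lower semicontinuity on [0, +oo[, for the relative topology. *)
Definition lsc_multifunction (R : realType) (E : completeNormedModType R)
    (G : R -> set E) : Prop :=
  forall O : set E, open O ->
  exists2 U : set R, open U &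
    [set t | 0 <= t /\ G t `&` O !=set0] = U `&` `[0, +oo[.

Definition separable (T : topologicalType) : Prop :=
  exists2 A : set T, countable A & dense A.

Definition setplus (V : zmodType) (A B : set V) : set V :=
  [set a + b | a in A & b in B].

Definition setopp (V : zmodType) (A : set V) : set V := [set - a | a in A].

(* The set r B, with B the open unit ball. *)
Definition scaled_ball (R : realType) (E : completeNormedModType R) (r : R) :
    set E :=
  [set r *: b | b in ball (0 : E) 1].

Section Dual.
Context {R : realType} {E : completeNormedModType R}.

Definition is_dual : {pred E -> R^o} :=
  fun p => `[< linear p /\ continuous p >].

Lemma is_dual_zmod_closed : zmod_closed is_dual.
Proof.
split=> [|p q].
- apply/asboolP; split; last exact: cst_continuous.
  by move=> a u v /=; rewrite scaler0 addr0.
move=> /asboolP[lp cp] /asboolP[lq cq]; apply/asboolP; split.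
- move=> a u v.
  rewrite [LHS](_ : _ = p (a *: u + v) - q (a *: u + v))//.
  by rewrite lp lq scalerBr opprD addrACA.
- by move=> x; apply: cvgB; [exact: cp|exact: cq].
Qed.

HB.instance Definition _ :=
  GRing.isZmodClosed.Build (E -> R^o) is_dual is_dual_zmod_closed.

End Dual.

(* The dual E^* of E, i.e., the continuous linear functionals on E. *)
Record dual (R : realType) (E : completeNormedModType R) := Dual {
  dual_fun :> E -> R^o ;
  _ : dual_fun \in is_dual }.

HB.instance Definition _ (R : realType) (E : completeNormedModType R) :=
  [isSub for @dual_fun R E].
HB.instance Definition _ (R : realType) (E : completeNormedModType R) :=
  [Choice of dual E by <:].
HB.instance Definition _ (R : realType) (E : completeNormedModType R) :=
  [SubChoice_isSubZmodule of dual E by <:].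

(* The weak* topology is the initial topology of E^* -> R^E, for the topology of
   pointwise convergence on R^E. *)
Definition weak_star_open (R : realType) (E : completeNormedModType R) :
    set (set (dual E)) :=
  @open (initial_topology (@dual_fun R E : dual E -> {ptws E -> R^o})).

(* The Borel sigma-algebra of the weak* topology on the target, the Lebesgue
   sigma-algebra of [0, +oo[ on the source. *)
Definition weak_star_measurable (R : realType) (E : completeNormedModType R)
    (q : R -> dual E) : Prop :=
  forall U : set (dual E), <<s @weak_star_open R E >> U ->
  leb_measurable (`[0, +oo[ `&` q @^-1` U).

Section Nonsmooth.
Context {R : realType} {E : completeNormedModType R}.
Implicit Types (phi : E -> \bar R) (x v : E) (C : set E).

Definition dquot phi x v (theta : R) : \bar R :=
  ((phi (x + theta *: v)%R - phi x) * (theta^-1)%:E)%E.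

Definition lower_dd phi x v : \bar R :=
  limf_einf (fun z : E * R => dquot phi x z.1 z.2)
    (filter_prod (nbhs v) (0 : R)^'+).

Definition dini_hadamard_subdiff phi x : set (dual E) :=
  [set p : dual E | forall v, ((p v)%:E <= lower_dd phi x v)%E].

Definition clarke_dd phi x v : \bar R :=
  limf_esup (fun z : E * R => dquot phi z.1 v z.2)
    (filter_prod (nbhs x) (0 : R)^'+).

Definition clarke_subdiff phi x : set (dual E) :=
  [set p : dual E | forall v, ((p v)%:E <= clarke_dd phi x v)%E].

(* In particular phi is finite on a neighborhood of x, for +oo - oo = -oo. *)
Definition lipschitz_near phi x : Prop :=
  exists k : R, \forall yz \near (x, x),
    (`|phi yz.1 - phi yz.2| <= (k * `|yz.1 - yz.2|)%:E)%E.

Definition regular_at phi x : Prop :=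
  lipschitz_near phi x /\
  forall v, dquot phi x v @ (0 : R)^'+ --> clarke_dd phi x v.

Definition is_gateaux_derivative phi x (g : dual E) : Prop :=
  forall v, dquot phi x v @ (0 : R)^' --> (g v)%:E.

Definition is_strict_derivative phi x (g : dual E) : Prop :=
  forall K : set E, compact K -> forall eps : R, 0 < eps ->
  \forall z \near filter_prod (nbhs x) (0 : R)^',
    forall v, K v -> (`|dquot phi z.1 v z.2 - (g v)%:E| <= eps%:E)%E.

Definition strictly_differentiable phi x : Prop :=
  exists g, is_strict_derivative phi x g.

Definition dist_to C x : \bar R := ereal_inf [set `|x - c|%:E | c in C].

Definition clarke_tangent_cone C x : set E :=
  [set v | clarke_dd (dist_to C) x v = 0%E].

Definition clarke_normal_cone C x : set (dual E) :=
  [set p : dual E | forall v, clarke_tangent_cone C x v -> p v <= 0].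

End Nonsmooth.

(* Main.v *)
(* A trajectory that starts at x0(t) + h (x0'(t) - v) and, by Filippov's theorem,
   follows the slope v in Gamma(t, x0(t)) on [t, t + h] up to o(h) rejoins x0 at
   time t + h up to o(h). Dynamic programming, optimality of x0 and the Lipschitz
   continuity of V(t + h, .) then bound V(t, x0(t) + h (x0'(t) - v)) - V(t, x0(t)) by
   h (L(t, x0(t), v) - L(t, x0(t), x0'(t))) + o(h), which is (i).
   If p is in the Dini-Hadamard subdifferential, (i) says that x0'(t) minimizes
   L(t, x0(t), .) + p over Gamma(t, x0(t)). Exact penalization by a multiple of the
   distance to Gamma(t, x0(t)) removes the constraint, and the Hahn-Banach theorem
   splits - p below the sum of the two Clarke derivatives, which is (ii).
   For the last part, q = - grad V - grad L is an a.e. limit of difference quotients;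
   they are measurable since V(., b) is the difference of two monotone functions, and
   pointwise measurability on E suffices because every weak* open set is a countable
   union of sets described by evaluations along a dense sequence. *)
Require Import Defs.
From HB Require Import structures.
From mathcomp Require Import all_boot all_order all_algebra.
From mathcomp Require Import all_classical all_reals all_analysis.
From mathcomp Require Import measurable_realfun.
From mathcomp Require Import ring lra.
Import Order.TTheory GRing.Theory Num.Theory.
Import numFieldNormedType.Exports.
Local Open Scope classical_set_scope.
Local Open Scope ring_scope.
Set Implicit Arguments.
Unset Strict Implicit.
Unset Printing Implicit Defensive.

(** * The Hahn-Banach theorem *)

(** The exceptional null set in (i) must not depend on [v]. Hence only countably many facts are
    asked of [t]: [x0] is differentiable there, and [t] is a Lebesgue point of [l1], of [l2], of the
    cost along [x0] and of each [Lfin s (e_ i) (e_ j)]. That a constant slope [v] is nearly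
    admissible just after [t] comes from lower semicontinuity, at every [t]; local boundedness of
    [l2] turns a velocity error of integral o(h) into a cost error o(h). In a general Banach space
    absolutely continuous curves need not be differentiable, so a trajectory is carried as a pair
    [(x, f)]: [x] is a primitive of [f], tested on functionals, and the inclusion holds at all
    times. Vector integrals thus reduce to real ones. Filippov's construction uses approximate
    selections, at the price of a positive error function [eps]. It also yields a Lipschitz constant
    of [V t] uniform in [t]: translating a trajectory by [a - b] keeps its velocity, so its defect
    is at most [gamma s] times the norm of [a - b], and (g) makes the resulting cost difference
    integrable. *)

Section HahnBanach.
Context {R : realType} {V : lmodType R}.
Implicit Types (p : V -> R) (K : V -> R -> Prop).

Definition sublinear p : Prop :=
  (forall u v, p (u + v) <= p u + p v) /\
  (forall a u, 0 <= a -> p (a *: u) = a * p u).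

Lemma sublinear0 p : sublinear p -> p 0 = 0.
Proof. by move=> [_ h]; rewrite -(scale0r 0) h// mul0r. Qed.

Lemma sublinear_oppr_ge p v : sublinear p -> - p (- v) <= p v.
Proof.
move=> sp; have [+ _] := sp => /(_ v (- v)).
by rewrite subrr sublinear0// -lerBlDr sub0r.
Qed.

(** [K w c] encodes the constraint that the functional sought be at least [c] at [w]. *)
Definition convex_cone K : Prop :=
  [/\ K 0 0, forall u v a b, K u a -> K v b -> K (u + v) (a + b) &
      forall c u a, 0 <= c -> K u a -> K (c *: u) (c * a)].

(** Built so that a linear functional below it is below [p] and satisfies every constraint in [K]:
    at [- w], the constraint [(w, c)] bounds it by [p 0 - c], which is [- c]. *)
Definition cone_min p K v : R :=
  inf [set r | exists w c, K w c /\ r = p (v + w) - c].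

Section cone.
Variables (p : V -> R) (K : V -> R -> Prop).
Hypotheses (sp : sublinear p) (cK : convex_cone K).
Hypothesis Kp : forall w c, K w c -> c <= p w.

Let A v := [set r | exists w c, K w c /\ r = p (v + w) - c].

Let A0 v : A v (p v).
Proof. by exists 0, 0; split; [case: cK|rewrite addr0 subr0]. Qed.

Let Alb v r : A v r -> - p (- v) <= r.
Proof.
move=> [w [c [Kwc ->]]]; have [sp1 _] := sp.
have := sp1 (v + w) (- v); rewrite addrAC subrr add0r.
have := Kp Kwc; lra.
Qed.

Let Ahas v : has_inf (A v).
Proof. by split; [exists (p v); exact: A0|exists (- p (- v)) => r /Alb]. Qed.

Lemma cone_min_le w c v : K w c -> cone_min p K v <= p (v + w) - c.
Proof.
move=> Kwc; apply: ge_inf; first by have [] := Ahas v.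
by exists w, c.
Qed.

Lemma cone_min_ge v r : (forall w c, K w c -> r <= p (v + w) - c) ->
  r <= cone_min p K v.
Proof.
move=> h; apply: lb_le_inf; first by have [] := Ahas v.
by move=> _ [w [c [Kwc ->]]]; exact: h.
Qed.

Lemma sublinear_cone_min : sublinear (cone_min p K).
Proof.
have [K0 KD KZ] := cK; have [sp1 sp2] := sp.
have subadd u v : cone_min p K (u + v) <= cone_min p K u + cone_min p K v.
  rewrite -lerBlDr; apply: cone_min_ge => w c Kwc.
  rewrite lerBlDr -lerBlDl; apply: cone_min_ge => w' c' Kwc'.
  rewrite lerBlDl; apply: le_trans (cone_min_le _ (KD _ _ _ _ Kwc Kwc')) _.
  have := sp1 (u + w) (v + w'); rewrite addrACA; lra.
split=> // a u; rewrite le_eqVlt => /orP[/eqP<-|a0].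
  rewrite scale0r mul0r; apply/eqP; rewrite eq_le; apply/andP; split.
    by have := cone_min_le 0 K0; rewrite addr0 (sublinear0 sp) subr0.
  by apply: cone_min_ge => w c /Kp; rewrite add0r subr_ge0.
have half b v : 0 < b -> cone_min p K (b *: v) <= b * cone_min p K v.
  move=> b0; rewrite mulrC -ler_pdivrMr//; apply: cone_min_ge => w c Kwc.
  rewrite ler_pdivrMr//; apply: le_trans (cone_min_le _ (KZ _ _ _ (ltW b0) Kwc)) _.
  by rewrite -scalerDr (sp2 _ _ (ltW b0)) -mulrBr mulrC.
apply/eqP; rewrite eq_le half//=.
have ai : 0 < a^-1 by rewrite invr_gt0.
have := half _ (a *: u) ai; rewrite scalerA mulVf ?gt_eqF// scale1r.
by rewrite mulrC ler_pdivlMr// mulrC.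
Qed.

End cone.

(** Zorn's lemma gives a minimal sublinear [q] below [p]; a chain is bounded below by its pointwise
    infimum, finite because of [- p (- v)]. Minimality makes [q] odd: imposing the value [q v] at
    [v] through [cone_min] yields a sublinear functional below [q], hence [q] itself, so that
    [q (- v) <= - q v]. *)
Lemma sublinear_min p : sublinear p ->
  exists2 f : V -> R, linear f & forall v, f v <= p v.
Proof.
move=> sp.
pose T := {q : V -> R | sublinear q /\ forall v, q v <= p v}.
pose ord (q r : T) := `[< forall v, sval r v <= sval q v >].
have [|||C tC|[q [sq qp]] qmin] := @Zorn T ord.
- by move=> q; apply/asboolP.
- move=> q r s /asboolP h1 /asboolP h2; apply/asboolP => v.
  exact: le_trans (h2 v) (h1 v).
- move=> [q Pq] [r Pr] /asboolP h1 /asboolP h2; apply: eq_exist => /=.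
  by apply/funext => v; apply/eqP; rewrite eq_le h1 h2.
- have [[q0 Cq0]|nC] := pselect (exists q, C q); last first.
    by exists (exist _ p (conj sp (fun=> lexx _))) => s Cs; exfalso; apply: nC; exists s.
  pose A v := [set sval q v | q in C].
  have Alb v r : A v r -> - p (- v) <= r.
    move=> [[q [sq qp]] Cq <-] /=; apply: le_trans (sublinear_oppr_ge v sq).
    by rewrite lerN2.
  have Ai v : has_inf (A v).
    by split; [exists (sval q0 v), q0|exists (- p (- v)) => r /Alb].
  pose m v := inf (A v).
  have mle v q : C q -> m v <= sval q v.
    by move=> Cq; apply: ge_inf; [case: (Ai v)|exists q].
  have mge v r : (forall q, C q -> r <= sval q v) -> r <= m v.
    by move=> h; apply: lb_le_inf; [case: (Ai v)|move=> _ [q Cq <-]; exact: h].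
  have sm : sublinear m.
    split=> [u v|a u a0].
      rewrite -lerBlDr; apply: (mge) => q Cq; rewrite lerBlDr -lerBlDl.
      apply: (mge) => r Cr; rewrite lerBlDl.
      have [/asboolP qr|/asboolP rq] := tC _ _ Cq Cr.
        apply: le_trans (mle _ _ Cr) _.
        have [[+ _] _] := svalP r => /(_ u v) => h; apply: le_trans h _.
        by rewrite lerD2r.
      apply: le_trans (mle _ _ Cq) _.
      have [[+ _] _] := svalP q => /(_ u v) => h; apply: le_trans h _.
      by rewrite lerD2l.
    move: a0; rewrite le_eqVlt => /orP[/eqP<-|a0].
      rewrite scale0r mul0r; apply/eqP; rewrite eq_le; apply/andP; split.
        by have := mle 0 _ Cq0; have [/sublinear0 -> _] := svalP q0.
      by apply: (mge) => q Cq; have [/sublinear0 -> _] := svalP q.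
    apply/eqP; rewrite eq_le; apply/andP; split.
      rewrite mulrC -ler_pdivrMr//; apply: (mge) => q Cq; rewrite ler_pdivrMr//.
      apply: le_trans (mle _ _ Cq) _.
      by have [[_ h] _] := svalP q; rewrite (h _ _ (ltW a0)) mulrC.
    apply: (mge) => q Cq; have [[_ h] _] := svalP q; rewrite (h _ _ (ltW a0)).
    by rewrite ler_pM2l// mle.
  have mp v : m v <= p v.
    by apply: le_trans (mle v _ Cq0) _; have [_] := svalP q0; exact.
  by exists (exist _ m (conj sm mp)) => s Cs; apply/asboolP => v /=; exact: mle.
have odd v : q (- v) = - q v.
  apply/eqP; rewrite eq_le andbC; apply/andP; split.
    by have := sublinear_oppr_ge (- v) sq; rewrite opprK.
  pose K := fun w c => exists2 b, 0 <= b & w = b *: v /\ c = b * q v.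
  have cK : convex_cone K.
    split=> [|u w a b [a1 a10 [-> ->]] [b1 b10 [-> ->]]|c u a c0 [a1 a10 [-> ->]]].
    - by exists 0 => //; rewrite scale0r mul0r.
    - by exists (a1 + b1); rewrite ?addr_ge0// scalerDl mulrDl.
    - by exists (c * a1); rewrite ?mulr_ge0// scalerA mulrA.
  have Kq w c : K w c -> c <= q w by move=> [b b0 [-> ->]]; rewrite (proj2 sq).
  have K0 : K 0 0 by case: cK.
  have le1 u : cone_min q K u <= q u.
    by have := cone_min_le sq cK Kq u K0; rewrite addr0 subr0.
  have Pr : sublinear (cone_min q K) /\ forall u, cone_min q K u <= p u.
    split; first exact: sublinear_cone_min.
    by move=> u; exact: le_trans (le1 u) (qp u).
  have E : cone_min q K = q.
    by have /(congr1 sval) := qmin (exist _ _ Pr) (introT (asboolP _) le1).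
  have Kv : K v (q v) by exists 1; rewrite ?scale1r ?mul1r.
  have := cone_min_le sq cK Kq (- v) Kv.
  by rewrite E addNr (sublinear0 sq) sub0r.
have [sq1 sq2] := sq.
exists q => // a u v.
have addq x y : q (x + y) = q x + q y.
  apply/eqP; rewrite eq_le sq1/=.
  by have := sq1 (- x) (- y); rewrite -opprD !odd -opprD lerN2.
rewrite addq; congr (_ + _).
have [a0|a0] := leP 0 a; first exact: sq2.
by rewrite -[in LHS](opprK a) scaleNr odd sq2 ?oppr_ge0 ?ltW// mulNr opprK.
Qed.

Lemma Hahn_Banach_cone p K : sublinear p -> convex_cone K ->
  (forall w c, K w c -> c <= p w) ->
  exists f : V -> R, [/\ linear f, forall v, f v <= p v & forall w c, K w c -> c <= f w].
Proof.
move=> sp cK Kp; have [f lf fq] := sublinear_min (sublinear_cone_min sp cK Kp).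
have K0 : K 0 0 by case: cK.
exists f; split=> // [v|w c Kwc].
  apply: le_trans (fq v) _.
  by have := cone_min_le sp cK Kp v K0; rewrite addr0 subr0.
have := le_trans (fq (- w)) (cone_min_le sp cK Kp (- w) Kwc).
rewrite addNr (sublinear0 sp) sub0r.
have -> : f (- w) = - f w.
  have f0 : f 0 = 0.
    by have := lf (-1) 0 0; rewrite scaleN1r addNr scaleN1r addNr.
  by have := lf (-1) w 0; rewrite !addr0 f0 addr0 !scaleN1r.
by rewrite lerN2.
Qed.

Lemma Hahn_Banach_support p v0 : sublinear p ->
  exists f : V -> R, [/\ linear f, forall v, f v <= p v & f v0 = p v0].
Proof.
move=> sp.
pose K := fun w c => exists2 b, 0 <= b & w = b *: v0 /\ c = b * p v0.
have cK : convex_cone K.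
  split=> [|u w a b [a1 a10 [-> ->]] [b1 b10 [-> ->]]|c u a c0 [a1 a10 [-> ->]]].
  - by exists 0 => //; rewrite scale0r mul0r.
  - by exists (a1 + b1); rewrite ?addr_ge0// scalerDl mulrDl.
  - by exists (c * a1); rewrite ?mulr_ge0// scalerA mulrA.
have Kp w c : K w c -> c <= p w by move=> [b b0 [-> ->]]; case: sp => _ ->.
have [f [lf fp fK]] := Hahn_Banach_cone sp cK Kp.
exists f; split=> //; apply/eqP; rewrite eq_le fp/=.
by apply: fK; exists 1; rewrite ?scale1r ?mul1r.
Qed.

End HahnBanach.

(* Extends [l], seen on the diagonal of V x V, below [p + q]. *)
Lemma Hahn_Banach_split {R : realType} {V : lmodType R} (p q l : V -> R) :
  sublinear p -> sublinear q -> linear l -> (forall v, l v <= p v + q v) ->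
  exists f g : V -> R, [/\ linear f, linear g,
    forall v, f v <= p v, forall v, g v <= q v & forall v, l v = f v + g v].
Proof.
move=> [p1 p2] [q1 q2] ll lpq.
pose S (z : V * V) := p z.1 + q z.2.
have sS : sublinear S.
  split=> [u v|a u a0]; rewrite /S /=.
    by have := p1 u.1 v.1; have := q1 u.2 v.2; lra.
  by rewrite p2// q2// mulrDr.
have l0 : l 0 = 0.
  by have := ll (-1) 0 0; rewrite scaleN1r addNr scaleN1r addNr.
have lZ a v : l (a *: v) = a * l v by have := ll a v 0; rewrite !addr0 l0 addr0.
have lD u v : l (u + v) = l u + l v by have := ll 1 u v; rewrite !scale1r.
pose K := fun (w : V * V) (c : R) => exists2 v, w = (v, v) & c = l v.
have cK : convex_cone K.
  split=> [|u w a b [x -> ->] [y -> ->]|c u a c0 [x -> ->]].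
  - by exists 0.
  - by exists (x + y).
  - by exists (c *: x).
have [|F [lF FS FK]] := Hahn_Banach_cone sS cK.
  by move=> w c [v -> ->]; exact: lpq.
have F0 : F 0 = 0.
  by have := lF (-1) 0 0; rewrite scaleN1r addNr scaleN1r addNr.
have FN u : F (- u) = - F u.
  by have := lF (-1) u 0; rewrite !addr0 F0 addr0 !scaleN1r.
have lN u : l (- u) = - l u by rewrite -scaleN1r lZ mulN1r.
have p0 : p 0 = 0 by rewrite -(scale0r 0) p2// mul0r.
have q0 : q 0 = 0 by rewrite -(scale0r 0) q2// mul0r.
exists (fun v => F (v, 0)), (fun v => F (0, v)); split.
- move=> a u v; rewrite -lF; congr F; apply/pair_equal_spec; split=> //=.
  by rewrite scaler0 addr0.
- move=> a u v; rewrite -lF; congr F; apply/pair_equal_spec; split=> //=.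
  by rewrite scaler0 addr0.
- by move=> v; have := FS (v, 0); rewrite /S/= q0 addr0.
- by move=> v; have := FS (0, v); rewrite /S/= p0 add0r.
- move=> v; have -> : F (v, 0) + F (0, v) = F (v, v).
    have := lF 1 (v, 0) (0, v); rewrite !scale1r => <-.
    by congr F; apply/pair_equal_spec; split; rewrite /= ?addr0 ?add0r.
  apply/eqP; rewrite eq_le; apply/andP; split.
    by apply: FK; exists v.
  have : l (- v) <= F (- (v, v)) by apply: FK; exists (- v).
  by rewrite lN FN lerN2.
Qed.

(** * Integration over the Lebesgue sigma-algebra *)

Section RealLebesgue.
Context {R : realType}.
Implicit Types (D : set R) (f g : R -> R).

Definition lmf D f := measurable_fun (D : set (Rleb R)) f.
Definition lint D f : R := \int[leb]_(s in D) f s.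

Lemma borel_leb_measurable (A : set R) :
  measurable (A : set (measurableTypeR R)) -> leb_measurable A.
Proof. by move=> h; exact: sub_caratheodory. Qed.

Lemma leb_measurable_itv (i : interval R) : leb_measurable [set` i].
Proof. by apply: borel_leb_measurable; exact: measurable_itv. Qed.

Lemma borel_lmf D f : measurable (D : set (measurableTypeR R)) ->
  measurable_fun (D : set (measurableTypeR R)) f -> lmf D f.
Proof.
by move=> mD mf _ Y mY; apply: borel_leb_measurable; exact: mf.
Qed.

Lemma leb_lebesgueE (A : set R) : leb A = lebesgue_measure A. Proof. by []. Qed.

Lemma leb_itv (a b : R) : a <= b -> leb `[a, b] = (b - a)%:E.
Proof.
move=> ab; rewrite leb_lebesgueE lebesgue_measure_itv/= lte_fin.
move: ab; rewrite le_eqVlt => /orP[/eqP->|->//].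
by rewrite ltxx subrr.
Qed.

Lemma leb_set1 (a : R) : leb [set a] = 0%E.
Proof. by rewrite leb_lebesgueE lebesgue_measure_set1. Qed.

Lemma leb_ae_lebesgue (P : R -> Prop) :
  (\forall s \ae lebesgue_measure, P s) -> \forall s \ae leb, P s.
Proof.
move=> [A [mA A0 PA]]; exists A; split => //.
exact: borel_leb_measurable.
Qed.

Lemma leb_ae_neq (a : R) : \forall s \ae leb, s != a.
Proof.
exists [set a]; split => //.
- by apply: borel_leb_measurable; exact: measurable_set1.
- exact: leb_set1.
- by move=> x /= /negP; rewrite negbK => /eqP.
Qed.

Global Instance leb_ae_filter :
  Filter (nbhs (almost_everywhere (@completed_lebesgue_measure R))).
Proof. exact: ae_filter_ringOfSetsType. Qed.

(** Rests on the completeness of the Lebesgue measure; the Borel analogue fails. *)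
Lemma lmf_ae D f g : leb_measurable D ->
  (\forall s \ae leb, D s -> f s = g s) -> lmf D f -> lmf D g.
Proof.
move=> mD fg mf; apply/measurable_EFinP.
apply: (ae_measurable_fun completed_lebesgue_measure_is_complete
  (f := EFin \o f)).
  apply: filterS fg.
  by move=> s h /h /= ->.
exact/measurable_EFinP.
Qed.

Lemma lmf_ext D f g : (forall x, D x -> f x = g x) -> lmf D f -> lmf D g.
Proof.
by move=> fg; apply: eq_measurable_fun => x; rewrite inE => /fg.
Qed.

Lemma lmfS D D' f : leb_measurable D -> D' `<=` D -> lmf D f -> lmf D' f.
Proof. by move=> mD D'D mf; exact: (measurable_funS mD D'D mf). Qed.

Lemma li_lmf D f : leb_integrable D f -> lmf D f.
Proof. by move=> /integrableP[/measurable_EFinP]. Qed.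

Lemma li_ext D f g : leb_measurable D -> (forall x, D x -> f x = g x) ->
  leb_integrable D f -> leb_integrable D g.
Proof.
by move=> mD fg; apply: (eq_integrable mD) => x; rewrite inE => /fg ->.
Qed.

Lemma li_le D f g : leb_measurable D -> lmf D f ->
  (forall x, D x -> `|f x| <= g x) -> leb_integrable D g -> leb_integrable D f.
Proof.
move=> mD mf fg; apply: (le_integrable mD); first exact/measurable_EFinP.
by move=> x Dx /=; rewrite lee_fin (le_trans (fg _ Dx))// ler_norm.
Qed.

Lemma liS D D' f : leb_measurable D -> leb_measurable D' -> D' `<=` D ->
  leb_integrable D f -> leb_integrable D' f.
Proof. by move=> mD mD' DD' lf; exact: (integrableS mD mD' DD' lf). Qed.

Lemma liD D f g : leb_measurable D -> leb_integrable D f -> leb_integrable D g ->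
  leb_integrable D (fun x => f x + g x).
Proof. by move=> mD lf lg; have := integrableD mD lf lg. Qed.

Lemma liB D f g : leb_measurable D -> leb_integrable D f -> leb_integrable D g ->
  leb_integrable D (fun x => f x - g x).
Proof. by move=> mD lf lg; have := integrableB mD lf lg. Qed.

Lemma liZ D f c : leb_measurable D -> leb_integrable D f ->
  leb_integrable D (fun x => c * f x).
Proof. by move=> mD lf; have := integrableZl mD c lf. Qed.

Lemma li_norm D f : leb_integrable D f -> leb_integrable D (fun x => `|f x|).
Proof. by move=> lf; exact: integrable_norm lf. Qed.

Lemma li0 D : leb_measurable D -> leb_integrable D (fun=> 0).
Proof. by move=> mD; exact: (integrable0 leb D). Qed.

Lemma li_cst (a b c : R) : leb_integrable `[a, b] (fun=> c).
Proof.
apply: (@measurable_bounded_integrable _ _ _ leb (fun=> c)).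
- exact: leb_measurable_itv.
- have [ab|ba] := leP a b; first by rewrite [X in (X < _)%E](leb_itv ab) ltry.
  by rewrite set_itv_ge ?measure0// -leNgt bnd_simp.
- exact: measurable_cst.
- exact: bounded_cst.
Qed.

Lemma li_bounded (a b c : R) f : lmf `[a, b] f ->
  (forall x, a <= x <= b -> `|f x| <= c) -> leb_integrable `[a, b] f.
Proof.
move=> mf fc; apply: (li_le (g := fun=> c)) => //; last exact: li_cst.
  exact: leb_measurable_itv.
Qed.

Lemma lmf_norm D f : lmf D f -> lmf D (fun x => `|f x|).
Proof. by move=> mf; exact: measurableT_comp. Qed.

Lemma li_ae D f g : leb_measurable D ->
  (\forall s \ae leb, D s -> f s = g s) ->
  leb_integrable D f -> leb_integrable D g.
Proof.
move=> mD fg lf; have mf := li_lmf lf.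
have mg : lmf D g by exact: lmf_ae fg mf.
apply/integrableP; split; first exact/measurable_EFinP.
have mn h : lmf D h -> leb_measurable_fun D (fun s => `|(h s)%:E|%E).
  by move=> mh; apply/measurable_EFinP; exact: lmf_norm mh.
have ae : ae_eq leb D (fun s => `|(f s)%:E|%E) (fun s => `|(g s)%:E|%E).
  by move: fg; apply: filterS => s h Ds; rewrite h.
have /integrableP[_ lfoo] := lf.
exact: (eq_ind _ (fun x => (x < +oo)%E) lfoo _
  (ae_eq_integral _ _ mD (mn _ mf) (mn _ mg) ae)).
Qed.

Lemma li_sum D (F : nat -> R -> R) n : leb_measurable D ->
  (forall i, leb_integrable D (F i)) ->
  leb_integrable D (fun x => \sum_(i < n) F i x).
Proof.
move=> mD lF; elim: n => [|n IH].
  by apply: (li_ext mD _ (li0 mD)) => x _; rewrite big_ord0.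
by apply: (li_ext mD _ (liD mD IH (lF n))) => x _; rewrite big_ord_recr.
Qed.

Lemma lint_ext D f g : (forall x, D x -> f x = g x) -> lint D f = lint D g.
Proof. by move=> fg; apply: eq_Rintegral => x; rewrite inE => /fg. Qed.

Lemma lint_ae D f g : leb_measurable D ->
  (\forall s \ae leb, D s -> f s = g s) ->
  leb_integrable D f -> lint D f = lint D g.
Proof.
move=> mD fg lf; have mf := li_lmf lf.
have mg : lmf D g by exact: lmf_ae fg mf.
have m h : lmf D h -> leb_measurable_fun D (EFin \o h) by move/measurable_EFinP.
have ae : ae_eq leb D (EFin \o f) (EFin \o g).
  by move: fg; apply: filterS => s h Ds /=; rewrite h.
exact: (congr1 fine (ae_eq_integral _ _ mD (m _ mf) (m _ mg) ae)).
Qed.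

Lemma lintD D f g : leb_measurable D -> leb_integrable D f -> leb_integrable D g ->
  lint D (fun x => f x + g x) = lint D f + lint D g.
Proof. by move=> mD lf lg; exact: RintegralD. Qed.

Lemma lintB D f g : leb_measurable D -> leb_integrable D f -> leb_integrable D g ->
  lint D (fun x => f x - g x) = lint D f - lint D g.
Proof. by move=> mD lf lg; exact: RintegralB. Qed.

Lemma lintZ D f c : leb_measurable D -> leb_integrable D f ->
  lint D (fun x => c * f x) = c * lint D f.
Proof. by move=> mD lf; exact: RintegralZl. Qed.

Lemma lint_le D f g : leb_measurable D -> leb_integrable D f -> leb_integrable D g ->
  (forall x, D x -> f x <= g x) -> lint D f <= lint D g.
Proof. by move=> mD lf lg fg; exact: (le_Rintegral mD lf lg fg). Qed.

Lemma lint_ge0 D f : (forall x, D x -> 0 <= f x) -> 0 <= lint D f.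
Proof. by move=> h; exact: Rintegral_ge0. Qed.

Lemma lint_norm D f : leb_measurable D -> leb_integrable D f ->
  `|lint D f| <= lint D (fun x => `|f x|).
Proof. by move=> mD lf; exact: le_normr_Rintegral. Qed.

Lemma lint0 D : lint D (fun=> 0) = 0.
Proof. by rewrite /lint /Rintegral integral0. Qed.

Lemma lint_cst (a b c : R) : a <= b -> lint `[a, b] (fun=> c) = c * (b - a).
Proof.
move=> ab; rewrite /lint Rintegral_cst; last exact: leb_measurable_itv.
by rewrite [X in fine X](leb_itv ab).
Qed.

Lemma lintE D f : leb_integrable D f -> leb_measurable D ->
  leb_integral D (fun s => (f s)%:E) = (lint D f)%:E.
Proof.
by move=> lf mD; rewrite /lint /Rintegral fineK//; exact: integrable_fin_num.
Qed.

Lemma lint_set1 f (a : R) : lint [set a] f = 0.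
Proof.
have m1 : leb_measurable [set a].
  by apply: borel_leb_measurable; exact: measurable_set1.
have := @Rintegral_cst _ (Rleb R) R leb [set a] m1 (f a).
rewrite [X in _ * fine X](leb_set1 a) mulr0 => <-.
by apply: lint_ext => x ->.
Qed.

(** The shared point [b] is a null set, so both pieces may contain it. The right end is an arbitrary
    bound in order to treat bounded intervals and rays together. *)
Lemma lint_itv_split f (a b : R) (c : itv_bound R) : a <= b -> (BRight b <= c)%O ->
  leb_integrable [set` Interval (BLeft a) c] f ->
  lint [set` Interval (BLeft a) c] f =
  lint `[a, b] f + lint [set` Interval (BLeft b) c] f.
Proof.
move=> ab bc lf.
have mI (i : interval R) : leb_measurable [set` i] by exact: leb_measurable_itv.
have subI : [set` Interval (BRight b) c] `<=` [set` Interval (BLeft a) c].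
  by apply: subset_itvr; rewrite bnd_simp.
have subI' : [set` Interval (BLeft b) c] `<=` [set` Interval (BLeft a) c].
  by apply: subset_itvr; rewrite bnd_simp.
have eqI : [set` Interval (BLeft b) c] = [set b] `|` [set` Interval (BRight b) c].
  by rewrite (setU1itv _ bc).
have m1 : leb_measurable [set b].
  by apply: borel_leb_measurable; exact: measurable_set1.
have -> : lint [set` Interval (BLeft b) c] f = lint [set` Interval (BRight b) c] f.
  have lU : leb_integrable ([set b] `|` [set` Interval (BRight b) c]) f.
    by rewrite -eqI; apply: liS lf.
  have dis : [disjoint [set b] & [set` Interval (BRight b) c]]%classic.
    by apply/disj_setPS => x [/= ->]; rewrite itv_boundlr/= bnd_simp ltxx.
  rewrite eqI [LHS](Rintegral_setU m1 (mI _) lU dis).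
  by rewrite [X in X + _](lint_set1 f b) add0r.
have eqJ : [set` Interval (BLeft a) c] =
    `[a, b]%classic `|` [set` Interval (BRight b) c].
  by apply: itv_bndbnd_setU; rewrite ?bnd_simp.
have lU : leb_integrable (`[a, b] `|` [set` Interval (BRight b) c]) f.
  by rewrite -eqJ.
have dis : [disjoint `[a, b] & [set` Interval (BRight b) c]]%classic.
  apply/disj_setPS => x [/=]; rewrite in_itv/= => /andP[_ xb].
  by rewrite itv_boundlr/= bnd_simp ltNge xb.
by rewrite eqJ [LHS](Rintegral_setU (mI _) (mI _) lU dis).
Qed.

Lemma lint_Chasles f (a b c : R) : a <= b -> b <= c ->
  leb_integrable `[a, c] f ->
  lint `[a, c] f = lint `[a, b] f + lint `[b, c] f.
Proof. by move=> ab bc; apply: lint_itv_split; rewrite ?bnd_simp. Qed.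

Lemma lint_ray f (a b : R) : a <= b -> leb_integrable `[a, +oo[ f ->
  lint `[a, +oo[ f = lint `[a, b] f + lint `[b, +oo[ f.
Proof. by move=> ab; exact: lint_itv_split. Qed.

Lemma li_Chasles f (a b c : R) : a <= b -> b <= c ->
  leb_integrable `[a, b] f -> leb_integrable `[b, c] f -> leb_integrable `[a, c] f.
Proof.
move=> ab bc lab lbc.
have mI (i : interval R) : leb_measurable [set` i] by exact: leb_measurable_itv.
have E : `[a, c]%classic = `[a, b]%classic `|` `]b, c]%classic.
  by apply: itv_bndbnd_setU; rewrite bnd_simp.
have /integrableP[/= m1 i1] := lab.
have /integrableP[/= m2 i2] : leb_integrable `]b, c] f.
  by apply: liS lbc => //; apply: subset_itvr; rewrite bnd_simp.
have m12 : measurable_fun ((`[a, b]%classic : set (Rleb R)) `|` `]b, c]%classic)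
    (fun s => (f s)%:E).
  by apply/measurable_funU; [exact: mI|exact: mI|].
have dis : [disjoint `[a, b] & `]b, c]]%classic.
  apply/disj_setPS => x [/=]; rewrite in_itv/= => /andP[_ xb].
  by rewrite in_itv/= ltNge xb.
have mn : measurable_fun ((`[a, b]%classic : set (Rleb R)) `|` `]b, c]%classic)
    (fun s => `|(f s)%:E|%E) by exact: measurableT_comp.
apply/integrableP; rewrite E; split; first exact: m12.
have -> := ge0_integral_setU leb (mI _) (mI _) mn (fun x _ => abse_ge0 _) dis.
exact: lte_add_pinfty.
Qed.

End RealLebesgue.

(** * From the Borel to the Lebesgue sigma-algebra; Lebesgue points *)

Section Transfer.
Context {R : realType}.
Implicit Types (D : set R) (f g : R -> R).

(** Change of variables along the identity, a measurable map from the Lebesgue to the Borel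
    sigma-algebra. *)
Lemma ge0_integral_leb_lebesgue D (h : R -> \bar R) :
  measurable (D : set (measurableTypeR R)) ->
  measurable_fun (D : set (measurableTypeR R)) h -> (forall x, 0 <= h x)%E ->
  (\int[lebesgue_measure]_(x in D) h x = leb_integral D h)%E.
Proof.
move=> mD mh h0.
have mid : measurable_fun (setT : set (Rleb R)) (id : Rleb R -> measurableTypeR R).
  by move=> _ Y mY; rewrite setTI; exact: borel_leb_measurable.
have := ge0_integral_pushforward mid leb mD mh (fun x _ => h0 x).
rewrite /leb_integral => <-.
by apply: eq_measure_integral => A mA AD.
Qed.

Lemma borel_emf D (h : R -> \bar R) : measurable (D : set (measurableTypeR R)) ->
  measurable_fun (D : set (measurableTypeR R)) h -> leb_measurable_fun D h.
Proof.
by move=> mD mf _ Y mY; apply: borel_leb_measurable; exact: mf.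
Qed.

Lemma lmf_ray (t : R) f : (forall T, t <= T -> lmf `[t, T] f) -> lmf `[t, +oo[ f.
Proof.
move=> h; rewrite itv_bndy_bigcup_BRight.
apply/measurable_fun_bigcup => [n|n]; first exact: leb_measurable_itv.
by apply: h; rewrite lerDl.
Qed.

(** Each sublevel set of [f] at a rational level is Borel up to a null set. One Borel null set [M]
    contains these countably many null sets; [g] is [f] off [M] and 0 on [M]. It feeds
    [lebesgue_differentiation]. *)
Lemma borel_representative f : lmf setT f ->
  exists g (N : set (measurableTypeR R)),
    [/\ measurable_fun (setT : set (measurableTypeR R)) g,
        measurable N, lebesgue_measure N = 0%E & forall x, ~ N x -> f x = g x].
Proof.
move=> mf.
pose q n : rat := odflt 0 (unpickle n).
have cA n : exists B N, [/\ measurable (B : set (measurableTypeR R)),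
   lebesgue_measure.-negligible (N : set (measurableTypeR R)) & B `|` N = [set x | f x < ratr (q n)]].
  have : leb_measurable [set x | f x < ratr (q n)].
    have := mf measurableT _ (measurable_itv `]-oo, ratr (q n)[).
    by rewrite setTI; congr (measurable _); apply/seteqP; split=> x /=; rewrite in_itv/=.
  rewrite /leb_measurable -completed_caratheodory_measurable.
  by rewrite g_sigma_completed_algebra_genE => -[B mB [N nN <-]]; exists B, N.
have /choice[B cB] := cA; have /choice[N cN] := cB.
have : lebesgue_measure.-negligible (\bigcup_n N n : set (measurableTypeR R)).
  by apply: negligible_bigcup => n; have [] := cN n.
move=> [M [mM M0 NM]].
pose g x := f x * \1_(~` M) x.
exists g, M; split => //; last first.
  by move=> x Mx; rewrite /g indicE mem_set// mulr1.
move=> _; apply: (measurability _ (RGenInftyO.measurableE R)) => // _ [_ [r ->] <-].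
rewrite setTI.
(* On [M] the function [g] is 0, so [M] lies in this sublevel set exactly when some positive
   rational is below [r]. *)
have -> : g @^-1` `]-oo, r[ = \bigcup_(n in [set n | ratr (q n) < r])
    ((B n `\` M) `|` (if 0 < ratr (q n) :> R then M else set0)).
  apply/seteqP; split=> [x|x [n /= qr]] /=.
    rewrite in_itv/= => gr.
    have [s] := rat_in_itvoo gr; rewrite in_itv/= => /andP[gs sr].
    exists (pickle s) => /=; first by rewrite /q pickleK.
    rewrite /q pickleK /=.
    move: gs; rewrite /g indicE; have [Mx|Mx] := pselect (M x).
      rewrite (memNset (A := ~` M)); last by move=> /(_ Mx).
      by rewrite mulr0 => ->; right.
    rewrite mem_set//= mulr1 => fs; left; split => //.
    have [_ _ E] := cN (pickle s).
    have : (B (pickle s) `|` N (pickle s)) x by rewrite E /= /q pickleK.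
    by case=> // Nx; exfalso; apply: Mx; apply: NM; exists (pickle s).
  rewrite in_itv/= /g indicE; case=> [[Bx Mx]|].
    rewrite mem_set//= mulr1; apply: lt_trans qr.
    have [_ _ E] := cN n.
    have : [set x | f x < ratr (q n)] x by rewrite -E; left.
    by [].
  case: ifP => // q0 Mx; rewrite (memNset (A := ~` M)); last by move=> /(_ Mx).
  rewrite mulr0.
  exact: lt_trans qr.
apply: bigcup_measurable => n _; apply: measurableU.
  by apply: measurableD => //; have [] := cN n.
by case: ifP.
Qed.

(** Lebesgue's differentiation theorem for a Borel representative of [f] extended by 0 to the left
    of [t]. The symmetric interval serves both two-sided derivatives and right means. *)
Lemma leb_lebesgue_pt (t : R) f :
  (forall T, t <= T -> leb_integrable `[t, T] f) ->
  ae_from t (fun s => t < s /\ forall e, 0 < e -> \forall h \near 0^'+,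
    t <= s - h /\ lint `[s - h, s + h] (fun r => `|f r - f s|) <= e * h).
Proof.
move=> lf; pose f0 r := if t <= r then f r else 0.
have f0E r : t <= r -> f0 r = f r.
  by move=> tr; rewrite /f0 tr.
have mf0 : lmf setT f0.
  have -> : setT = `]-oo, t[%classic `|` `[t, +oo[%classic :> set R.
    by rewrite -itv_bndbnd_setU// set_itvNyy.
  apply/(measurable_funU _ (leb_measurable_itv _) (leb_measurable_itv _)); split.
    apply: (lmf_ext (f := fun=> 0)); last exact: measurable_cst.
    by move=> x /=; rewrite in_itv/= /f0 ltNge => /negbTE ->.
  apply: (lmf_ext (f := f)).
    by move=> x /=; rewrite in_itv/= andbT => /f0E.
  by apply: lmf_ray => T tT; exact/li_lmf/lf.
have [g [N [mg mN N0 fg]]] := borel_representative mf0.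
have gN : \forall s \ae leb, f0 s = g s.
  exists N; split => //; first exact: borel_leb_measurable.
  by move=> x /= h; apply: contrapT => /fg.
have lg : locally_integrable setT g.
  split => //; first exact: openT.
  move=> K _ cK.
  have [M [_ KM]] := compact_bounded cK.
  pose c := Num.max (Num.max t (- t)) (M + 1).
  have ct : t <= c by rewrite !le_max lexx.
  have ctN : - c <= t by rewrite lerNl !le_max lexx orbT.
  have Kc : K `<=` `[- c, c].
    move=> x Kx /=; rewrite in_itv/= -ler_norml.
    apply: (KM c) => //; rewrite lt_max ltrDl ltr01 orbT//.
  have mK : measurable (K : set (measurableTypeR R)).
    exact: compact_measurable.
  have mng : measurable_fun (setT : set (measurableTypeR R)) (fun x => `|g x|%:E).
    by apply/measurable_EFinP; exact: measurableT_comp.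
  pose I : set (measurableTypeR R) := `[- c, c]%classic.
  have mIb : measurable I by exact: measurable_itv.
  apply: (@le_lt_trans _ _ (\int[lebesgue_measure]_(x in I) `|g x|%:E)%E).
    apply: ge0_subset_integral => //.
    exact: measurable_funTS.
  rewrite ge0_integral_leb_lebesgue//; last first.
    exact: measurable_funTS.
  have mI : leb_measurable `[- c, c] by exact: leb_measurable_itv.
  have lf0 : leb_integrable `[- c, c] f0.
    have e0 : leb_integrable `[- c, t] f0.
      apply: (li_ae (f := fun=> 0)) => //; first exact: leb_measurable_itv.
        have := leb_ae_neq t; apply: filterS => s /eqP st /=.
        rewrite in_itv/= => /andP[_]; rewrite le_eqVlt => /orP[/eqP//|h].
        by rewrite /f0 leNgt h.
      exact: li_cst.
    apply: (li_Chasles ctN ct e0).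
    apply: li_ext (lf _ ct); first exact: leb_measurable_itv.
    by move=> x /=; rewrite in_itv/= => /andP[tx _]; rewrite f0E.
  have /li_norm lgi : leb_integrable `[- c, c] g.
    by apply: li_ae lf0 => //; apply: filterS gN.
  by rewrite lintE// ltry.
have := leb_ae_lebesgue (lebesgue_differentiation lg).
have fNs : \forall s \ae leb, ~ N s.
  exists N; split => //; first exact: borel_leb_measurable.
  by move=> x /= /contrapT.
have nt := leb_ae_neq t.
apply: filterS3 nt fNs => s st Ns ps ts.
have {st}ts : t < s by rewrite lt_neqAle eq_sym st.
split => // e e0.
(* Balls are open, so the closed interval of radius [h] is put in the ball of radius [2 * h], of
   measure [4 * h]; any bound up to [e / 4] on the mean over that ball would do. *)
have e4 : (0 < (e / 8)%:E)%E by rewrite lte_fin divr_gt0.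
have H : \forall h \near 0^'+, (davg g s h < (e / 8)%:E)%E.
  move/fine_cvgP : ps => [ps1 /cvgrPdist_lt/(_ (e / 8))].
  rewrite divr_gt0// => /(_ isT) ps2; near=> h.
  have : `|0 - fine (davg g s h)| < e / 8 by near: h.
  rewrite sub0r normrN => /(le_lt_trans (ler_norm _)).
  have fd : davg g s h \is a fin_num by near: h.
  by rewrite -[X in (X < _)%E]fineK// lte_fin.
have {}H : \forall h \near 0^'+, (davg g s (2 * h) < (e / 8)%:E)%E.
  have [r /= r0 Hr] := H; exists (r / 2) => /=; first by rewrite divr_gt0.
  move=> h /=; rewrite sub0r normrN => hr h0; apply: Hr; last by rewrite mulr_gt0.
  by rewrite /= sub0r normrN normrM ger0_norm// mulrC -ltr_pdivlMr.
near=> h.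
have h0 : 0 < h by near: h; exact: nbhs_right_gt.
have hst : h < s - t.
  by near: h; apply: nbhs_right_lt; rewrite subr_gt0.
have th : t <= s - h by rewrite lerBrDr -lerBrDl ltW.
split => //.
have : (davg g s (2 * h) < (e / 8)%:E)%E by near: h.
have h20 : 0 < 2 * h by rewrite mulr_gt0.
rewrite /davg /iavg /= (lebesgue_measure_ball s (ltW h20)).
rewrite inver gt_eqF; last by rewrite mulrn_wgt0.
have mgs : measurable_fun (setT : set (measurableTypeR R))
    (fun r => `|(g r - g s)%:E|%E).
  by apply/measurable_EFinP; apply: measurableT_comp => //; exact: measurable_funB.
rewrite ge0_integral_leb_lebesgue//=; first last.
  exact: measurable_funTS.
  exact: measurable_ball.
have mI : leb_measurable `[s - h, s + h] by exact: leb_measurable_itv.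
have ssh : s - h <= s + h by rewrite lerD2l; lra.
have lfs : leb_integrable `[s - h, s + h] f.
  apply: liS (lf (s + h) _) => //; first exact: leb_measurable_itv.
    by apply: subset_itvr; rewrite bnd_simp.
  exact: le_trans ssh.
have {}lfs : leb_integrable `[s - h, s + h] (fun r => `|f r - f s|).
  by apply: li_norm; apply: liB => //; exact: li_cst.
have aefg : \forall r \ae leb, `[s - h, s + h]%classic r -> `|f r - f s| = `|g r - g s|.
  apply: filterS gN => r fgr; rewrite /= in_itv/= => /andP[hr _].
  by rewrite -fgr -fg// (f0E _ (le_trans th hr)) (f0E _ (ltW ts)).
rewrite (lint_ae mI aefg lfs) -lee_fin -lintE//; last exact: li_ae lfs.
move=> H'.
have mB : leb_measurable (ball s (2 * h)).
  by apply: borel_leb_measurable; exact: measurable_ball.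
pose J := leb_integral (ball s (2 * h)) (fun r => (`|g r - g s|)%:E).
have {}H' : (((2 * h) *+ 2)^-1%:E * J < (e / 8)%:E)%E by [].
apply: (@le_trans _ _ J).
  have sub : `[s - h, s + h]%classic `<=` ball s (2 * h).
    move=> r /=; rewrite in_itv/= => /andP[h1 h2].
    rewrite -ball_normE/= distrC ltr_norml; apply/andP; split; lra.
  have mg0 : leb_measurable_fun (ball s (2 * h)) (fun r => `|g r - g s|%:E).
    by apply: borel_emf; [exact: measurable_ball|exact: measurable_funTS].
  apply: (ge0_subset_integral leb mI mB mg0 _ sub) => r _.
  by rewrite lee_fin.
have h4 : 0 < ((2 * h) *+ 2)^-1 by rewrite invr_gt0 mulrn_wgt0.
rewrite -(@lee_pmul2l _ (((2 * h) *+ 2)^-1)%:E)//.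
apply: (le_trans (ltW H')); rewrite -EFinM lee_fin.
rewrite [leRHS](_ : _ = e / 4); first lra.
by field; rewrite gt_eqF.
Unshelve. all: by end_near. Qed.

End Transfer.

(** * Dominated convergence, absolute continuity and tails of real integrals *)

Section LebesgueEstimates.
Context {R : realType}.
Implicit Types (D : set R) (f g : R -> R).

Lemma lint_dominated D (F : nat -> R -> R) f g : leb_measurable D ->
  (forall n, lmf D (F n)) -> (forall x, D x -> F n x @[n --> \oo] --> f x) ->
  leb_integrable D g -> (forall n x, D x -> `|F n x| <= g x) ->
  [/\ leb_integrable D f, lint D (fun x => `|F n x - f x|) @[n --> \oo] --> (0 : R) &
      lint D (F n) @[n --> \oo] --> lint D f].
Proof.
move=> mD mF Ff lg Fg.
have mf : lmf D f by exact: measurable_fun_cvg mF Ff.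
have [||||lf c1 c2] := @dominated_convergence _ _ R leb D mD
  (fun n x => (F n x)%:E) (fun x => (f x)%:E) (fun x => (g x)%:E) _ _ _ lg.
- by move=> n; apply/measurable_EFinP; exact: mF.
- exact/measurable_EFinP.
- by apply: aeW => x Dx; apply: cvg_EFin; [exact: nearW|exact: Ff].
- by apply: aeW => x n Dx; rewrite lee_fin; exact: Fg.
split => //; first exact: (fine_cvg c1).
by apply: fine_cvg; rewrite -lintE.
Qed.

Lemma lmf_cst D (c : R) : lmf D (fun=> c).
Proof. exact: measurable_cst. Qed.

Lemma lmfD D f g : lmf D f -> lmf D g -> lmf D (fun x => f x + g x).
Proof. by move=> mf mg; exact: measurable_funD. Qed.

Lemma lmfB D f g : lmf D f -> lmf D g -> lmf D (fun x => f x - g x).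
Proof. by move=> mf mg; exact: measurable_funB. Qed.

Lemma lmfM D f g : lmf D f -> lmf D g -> lmf D (fun x => f x * g x).
Proof. by move=> mf mg; exact: measurable_funM. Qed.

Lemma lmf_comp D (h : R -> R) f : measurable_fun setT h -> lmf D f ->
  lmf D (fun x => h (f x)).
Proof. by move=> mh mf; exact: (measurableT_comp mh mf). Qed.

Lemma lmf_nondecreasing (t : R) (i : itv_bound R) f :
  {in `[t, +oo[ &, {homo f : x y / x <= y}} ->
  lmf [set` Interval (BLeft t) i] f.
Proof.
move=> hf; apply: (lmf_ext (f := fun s => f (Num.max t s))).
  by move=> x /=; rewrite itv_boundlr/= bnd_simp => /andP[/max_idPr ->].
apply: borel_lmf; first exact: measurable_itv.
apply: nondecreasing_measurable; first exact: measurable_itv.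
move=> x y xy; apply: hf.
- by rewrite in_itv/= andbT le_max lexx.
- by rewrite in_itv/= andbT le_max lexx.
- by rewrite ge_max !le_max lexx/= xy orbT.
Qed.

Lemma lint_subset D D' f : leb_measurable D -> leb_measurable D' ->
  D' `<=` D -> (forall x, D x -> 0 <= f x) -> leb_integrable D f ->
  lint D' f <= lint D f.
Proof.
move=> mD mD' D'D f0 lf; rewrite -lee_fin -!lintE//; last exact: liS lf.
have mf : measurable_fun (D : set (Rleb R)) (fun r => (f r)%:E).
  exact/measurable_EFinP/li_lmf.
exact: (@ge0_subset_integral _ _ R leb _ _ mD' mD _ mf f0 D'D).
Qed.

(** Truncation at height [n]: the excess [F n] has small integral for large [n] by dominated
    convergence, and the truncated part contributes at most [n] times the length of the interval. *)
Lemma lint_abs_continuous (a b : R) f e : leb_integrable `[a, b] f -> 0 < e ->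
  exists2 d, 0 < d & forall s s', a <= s -> s <= s' -> s' <= b -> s' - s < d ->
    lint `[s, s'] (fun r => `|f r|) < e.
Proof.
move=> lf e0; have mI (i : interval R) := leb_measurable_itv i.
pose F n r := `|f r| - Num.min `|f r| n%:R.
have mF n : lmf `[a, b] (F n).
  have ma : lmf `[a, b] (fun r => `|f r|) by exact/li_lmf/li_norm.
  by apply: lmfB => //; exact: measurable_minr.
have F0 n r : 0 <= F n r by rewrite subr_ge0 ge_min lexx.
have Fle n r : `|F n r| <= `|f r|.
  by rewrite ger0_norm// gerBl le_min normr_ge0 ler0n.
have [||lz _ Fz] := lint_dominated (mI `[a, b]) mF (f := fun=> 0) _ (li_norm lf).
- move=> x _; apply: cvg_near_cst; near=> n.
  rewrite /F min_l ?subrr//; near: n.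
  exists (Num.bound `|f x|) => // n /= hn.
  apply: (@le_trans _ _ (Num.bound `|f x|)%:R); last by rewrite ler_nat.
  by exact/ltW/archi_boundP.
- by move=> n x _; exact: Fle.
move: Fz; rewrite lint0 => /cvgrPdist_lt/(_ (e / 2)).
rewrite divr_gt0// => /(_ isT)[N _ /(_ N (leqnn _))/=].
rewrite sub0r normrN => /(le_lt_trans (ler_norm _)) FN.
exists (e / 2 / (N%:R + 1)); first by rewrite !divr_gt0// ltr_wpDl.
move=> s s' as_ ss' s'b ssd.
have sub : `[s, s']%classic `<=` `[a, b]%classic by apply: subset_itvScc; rewrite bnd_simp.
have lfs : leb_integrable `[s, s'] (fun r => `|f r|).
  by apply: liS (li_norm lf).
have lFN : leb_integrable `[a, b] (F N).
  by apply: li_le (li_norm lf) => // x _; exact: Fle.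
have lFNs : leb_integrable `[s, s'] (F N) by apply: liS lFN.
apply: (@le_lt_trans _ _ (lint `[s, s'] (fun r => F N r + N%:R))).
  apply: lint_le => //; first by apply: liD => //; exact: li_cst.
  by move=> x _; rewrite -lerBlDl opprB addrCA subrr addr0 ge_min lexx orbT.
rewrite lintD//; last exact: li_cst.
rewrite lint_cst// [ltRHS]splitr ltr_leD//.
  by apply: le_lt_trans FN; apply: lint_subset.
rewrite (@le_trans _ _ ((N%:R + 1) * (s' - s)))//.
  by rewrite ler_wpM2r ?subr_ge0// lerDl.
by rewrite mulrC -ler_pdivlMr ?ltW// ltr_wpDl.
Unshelve. all: by end_near. Qed.

Section ray.
Variables (t : R) (f : R -> R).
Hypothesis lf : forall T, t <= T -> leb_integrable `[t, T] f.

Lemma loc_li_sub a b : t <= a -> leb_integrable `[a, b] f.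
Proof.
move=> ta; have [ab|ba] := leP a b.
  apply: liS (lf (le_trans ta ab)); try exact: leb_measurable_itv.
  by apply: subset_itvr; rewrite bnd_simp.
have m (i : interval R) := leb_measurable_itv i.
apply: liS (lf (lexx t)) => //.
by rewrite set_itv_ge ?sub0set// -leNgt bnd_simp.
Qed.

Lemma lint_ge0_le a b c d : (forall r, t <= r -> 0 <= f r) ->
  t <= c -> c <= a -> b <= d -> lint `[a, b] f <= lint `[c, d] f.
Proof.
move=> f0 tc ca bd; have m (i : interval R) := leb_measurable_itv i.
apply: lint_subset => //; first by apply: subset_itvScc; rewrite bnd_simp.
  by move=> x /=; rewrite in_itv/= => /andP[cx _]; apply: f0; exact: le_trans cx.
exact: loc_li_sub.
Qed.

End ray.

Lemma lint_ray_tail (t : R) f e : leb_integrable `[t, +oo[ f -> 0 < e ->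
  exists2 T0, t <= T0 & forall T, T0 <= T -> lint `[T, +oo[ (fun r => `|f r|) < e.
Proof.
move=> lf e0; have m (i : interval R) := leb_measurable_itv i.
pose F (n : nat) r := if r < n%:R then 0 else `|f r|.
have mF n : lmf `[t, +oo[ (F n).
  apply: measurable_fun_if; first exact: m.
  - apply: (@measurable_fun_ltr _ (Rleb R) R _ id (fun=> n%:R)); last exact: lmf_cst.
    by apply: (borel_lmf (f := id)); [exact: measurable_itv|exact: measurable_id].
  - exact: lmf_cst.
  - apply: measurable_funS (lmf_norm (li_lmf lf)); first exact: m.
    exact: subIsetl.
have Fle n r : `|F n r| <= `|f r|.
  by rewrite /F; case: ifP => _; rewrite ?normr0 ?normr_id.
have [||lz _ Fz] := lint_dominated (m `[t, +oo[) mF (f := fun=> 0) _ (li_norm lf).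
- move=> x _; apply: cvg_near_cst; near=> n.
  rewrite /F ifT//; near: n.
  exists (Num.bound `|x|) => // n /= hn.
  by apply: (lt_le_trans (le_lt_trans (ler_norm x) (archi_boundP (normr_ge0 x)))); rewrite ler_nat.
- by move=> n x _; exact: Fle.
move: Fz; rewrite lint0 => /cvgrPdist_lt/(_ _ e0)[N _ /(_ N (leqnn _))/=].
rewrite sub0r normrN => /(le_lt_trans (ler_norm _)) FN.
exists (Num.max t N%:R); first by rewrite le_max lexx.
move=> T; rewrite ge_max => /andP[tT NT].
have sub : `[T, +oo[%classic `<=` `[t, +oo[%classic by apply: subset_itvr; rewrite bnd_simp.
apply: le_lt_trans FN.
have -> : lint `[T, +oo[ (fun r => `|f r|) = lint `[T, +oo[ (F N).
  apply: lint_ext => x /=; rewrite in_itv/= andbT => Tx.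
  by rewrite /F ltNge (le_trans NT Tx).
apply: lint_subset => //.
  by move=> x _; rewrite /F; case: ifP.
by apply: li_le (li_norm lf) => // x _; exact: Fle.
Unshelve. all: by end_near. Qed.

Lemma lint_ray_cvg (t : R) f : leb_integrable `[t, +oo[ f ->
  lint `[t, T] f @[T --> +oo] --> lint `[t, +oo[ f.
Proof.
move=> lf; apply/cvgrPdist_lt => e e0.
have m (i : interval R) := leb_measurable_itv i.
have [T0 tT0 h] := lint_ray_tail lf e0.
near=> T; have tT : T0 <= T by near: T; apply: nbhs_pinfty_ge; exact: num_real.
rewrite (lint_ray (le_trans tT0 tT) lf) addrAC subrr add0r.
apply: le_lt_trans (h _ tT); apply: lint_norm => //.
apply: liS lf => //; apply: subset_itvr; rewrite bnd_simp.
exact: le_trans tT0 tT.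
Unshelve. all: by end_near. Qed.

(** The density of the exponential law of rate 1. Multiples [e * w] serve as positive error
    functions of small total mass on an infinite horizon. *)
Lemma integrable_weight : exists w : R -> R,
  [/\ leb_integrable `[0, +oo[ w, forall s, 0 <= s -> 0 < w s <= 1 &
      forall a b, 0 <= a -> lint `[a, b] w <= 1].
Proof.
have m (i : interval R) := leb_measurable_itv i.
pose w : R -> R := exponential_pdf 1.
have w0 s : 0 <= w s by exact: exponential_pdf_ge0.
have mw : measurable_fun (setT : set (measurableTypeR R)) w.
  exact: measurable_exponential_pdf.
have iw : leb_integral setT (fun s => (w s)%:E) = 1%E.
  rewrite -ge0_integral_leb_lebesgue//.
  - by rewrite -[RHS](@integral_exponential_pdf R 1)//.
  - exact/measurable_EFinP.
have mT : leb_measurable (setT : set R) by exact: measurableT.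
have lw : leb_integrable setT w.
  apply/integrableP; split.
    exact/measurable_EFinP/(borel_lmf _ mw).
  under eq_integral do rewrite /= ger0_norm//.
  by rewrite [X in (X < _)%E]iw ltry.
have lw1 : lint setT w = 1.
  by apply/eqP; rewrite -eqe -lintE// iw.
exists w; split.
- by apply: liS lw.
- move=> s s0; rewrite /w exponential_pdfE// mul1r mulN1r expR_gt0/=.
  by rewrite -[leRHS]expR0 ler_expR oppr_le0.
- by move=> a b a0; rewrite -lw1; apply: lint_subset.
Qed.

(** * Exponential estimates and Gronwall's inequality *)

Section exponential.
Variables (t : R) (gamma : R -> R).
Hypothesis gamma0 : forall s, t <= s -> 0 <= gamma s.
Hypothesis lgamma : forall T, t <= T -> leb_integrable `[t, T] gamma.

Let G s := lint `[t, s] gamma.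

Lemma lint_homo : {in `[t, +oo[ &, {homo G : x y / x <= y}}.
Proof.
by move=> x y _ _ xy; apply: lint_ge0_le => //.
Qed.

Lemma li_gamma_homo (Z : R -> R) : {in `[t, +oo[ &, {homo Z : x y / x <= y}} ->
  (forall s, t <= s -> 0 <= Z s) ->
  forall T, t <= T -> leb_integrable `[t, T] (fun s => gamma s * Z s).
Proof.
move=> hZ Z0 T tT.
have m (i : interval R) := leb_measurable_itv i.
apply: (li_le (g := fun s => Z T * gamma s)) => //.
- by apply: lmfM; [exact/li_lmf/lgamma|exact: lmf_nondecreasing].
- move=> x /=; rewrite in_itv/= => /andP[tx xT].
  rewrite ger0_norm ?mulr_ge0 ?gamma0 ?Z0// mulrC ler_wpM2r ?gamma0//.
  by apply: hZ; rewrite // in_itv/= ?tx ?tT.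
- by apply: liZ => //; exact: lgamma.
Qed.

Lemma expR_lint_homo : {in `[t, +oo[ &, {homo (fun s => expR (G s)) : x y / x <= y}}.
Proof. by move=> x y tx ty xy; rewrite ler_expR lint_homo. Qed.

(* Compare both sides on a subdivision fine enough for [G] to vary by less than
   [d] on each piece, where they agree up to a factor [expR d]. *)
Lemma lint_expR_le T : t <= T ->
  1 + lint `[t, T] (fun s => gamma s * expR (G s)) <= expR (G T).
Proof.
move=> tT.
have m (i : interval R) := leb_measurable_itv i.
have lgG : forall T, t <= T -> leb_integrable `[t, T] (fun s => gamma s * expR (G s)).
  by apply: li_gamma_homo; [exact: expR_lint_homo|move=> s _; exact: expR_ge0].
have GC a b : t <= a -> a <= b -> G b = G a + lint `[a, b] gamma.
  by move=> ta ab; apply: lint_Chasles => //; apply: lgamma; exact: le_trans ab.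
have key d : 0 < d -> lint `[t, T] (fun s => gamma s * expR (G s)) <=
    expR d * (expR (G T) - 1).
  move=> d0; have [h h0 hh] := lint_abs_continuous (lgamma tT) d0.
  have step a b : t <= a -> a <= b -> b <= T -> b - a < h ->
      lint `[a, b] (fun s => gamma s * expR (G s)) <=
      expR d * (expR (G b) - expR (G a)).
    move=> ta ab bT bah.
    have lab := loc_li_sub lgamma b ta.
    have tb := le_trans ta ab.
    have Gd : lint `[a, b] gamma < d.
      apply: le_lt_trans (hh _ _ ta ab bT bah).
      by apply: lint_le => //; [exact: li_norm|move=> x _; exact: ler_norm].
    have D0 : 0 <= lint `[a, b] gamma.
      by apply: lint_ge0 => x /=; rewrite in_itv/= => /andP[ax _]; rewrite gamma0// (le_trans ta).
    apply: (@le_trans _ _ (expR (G b) * lint `[a, b] gamma)).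
      rewrite -lintZ//; apply: lint_le => //.
      - exact: (loc_li_sub lgG b ta).
      - exact: liZ.
      - move=> x /=; rewrite in_itv/= => /andP[ax xb].
        have tx := le_trans ta ax.
        rewrite [leRHS]mulrC; apply: ler_wpM2l; first exact: gamma0.
        by apply: expR_lint_homo xb; rewrite in_itv/= andbT.
    rewrite (GC _ _ ta ab) expRD -[X in _ * (_ - X)]mulr1 -mulrBr.
    rewrite [leRHS]mulrCA -mulrA ler_pM2l ?expR_gt0//.
    set D := lint _ _ in Gd D0 *.
    apply: (@le_trans _ _ (expR d * D)).
      by rewrite ler_wpM2r// ler_expR ltW.
    rewrite ler_pM2l ?expR_gt0//.
    by have := expR_ge1Dx D; lra.
  have ind n a b : t <= a -> a <= b -> b <= T -> b - a < n%:R * h ->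
      lint `[a, b] (fun s => gamma s * expR (G s)) <=
      expR d * (expR (G b) - expR (G a)).
    elim: n a b => [|n IH] a b ta ab bT; first by rewrite mul0r ltNge subr_ge0 ab.
    move=> bah; have [|hba] := ltP (b - a) h; first exact: step.
    have [/(IH _ _ ta ab bT)//|hn] := ltP (b - a) (n%:R * h).
    (* The cut point is the midpoint of [b - n%:R * h] and [a + h]. As [b - a] lies between
       [n%:R * h] and [n.+1%:R * h], it is in the interval and leaves a first piece shorter than [h]
       and a rest shorter than [n%:R * h]. *)
    have [ac' cb' cah bcn] : [/\ a <= b - n%:R * h + (a + h - (b - n%:R * h)) / 2,
       b - n%:R * h + (a + h - (b - n%:R * h)) / 2 <= b,
       b - n%:R * h + (a + h - (b - n%:R * h)) / 2 - a < h &
       b - (b - n%:R * h + (a + h - (b - n%:R * h)) / 2) < n%:R * h].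
      move: bah; rewrite -natr1 mulrDl mul1r => bah.
      have n0 : 0 <= n%:R * h by rewrite mulr_ge0 ?ler0n// ltW.
      by split; lra.
    move: ac' cb' cah bcn; set c' := b - _ + _ => ac' cb' cah bcn.
    rewrite (lint_Chasles ac' cb'); last exact: (loc_li_sub lgG _ ta).
    have h1 := step _ _ ta ac' (le_trans cb' bT) cah.
    have h2 := IH _ _ (le_trans ta ac') cb' bT bcn.
    by apply: le_trans (lerD h1 h2) _; rewrite -mulrDr addrC subrKA addrC.
  have [n] : exists n : nat, T - t < n%:R * h.
    exists (Num.bound ((T - t) / h)); rewrite -ltr_pdivrMr//.
    by rewrite archi_boundP// divr_ge0 ?subr_ge0// ltW.
  move=> /(ind n t T (lexx _) tT (lexx _)).
  suff -> : expR (G t) = 1 by [].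
  by rewrite /G set_itv1 lint_set1 expR0.
set I := lint _ _ in key *.
have E1 : 0 <= expR (G T) - 1.
  rewrite subr_ge0 -[leLHS]expR0 ler_expR; apply: lint_ge0.
  by move=> x /=; rewrite in_itv/= => /andP[/gamma0].
suff : I <= expR (G T) - 1 by lra.
have : (fun d => expR d * (expR (G T) - 1)) @ 0^'+ --> expR 0 * (expR (G T) - 1).
  apply: cvgMl; apply: cvg_at_right_filter; exact: continuous_expR.
rewrite expR0 mul1r => hc.
apply: (limr_ge_near hc) || apply: (cvgr_to_ge hc).
by near=> d; apply: key; near: d; exact: nbhs_right_gt.
Unshelve. all: by end_near. Qed.

(** Let [sup S] be the supremum of [w s * expR (- G s)]. Were it larger than [A], inserting
    [w s <= sup S * expR (G s)] in the integral inequality and applying [lint_expR_le] would put all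
    these values below [sup S - c] with [c] positive. *)
Lemma Gronwall (A : R) (w : R -> R) (T : R) : t <= T ->
  (forall s, t <= s <= T -> 0 <= w s) ->
  (exists M, forall s, t <= s <= T -> w s <= M) ->
  leb_integrable `[t, T] (fun s => gamma s * w s) ->
  (forall s, t <= s <= T -> w s <= A + lint `[t, s] (fun r => gamma r * w r)) ->
  forall s, t <= s <= T -> w s <= A * expR (G s).
Proof.
move=> tT w0 [M wM] lgw wle.
have m (i : interval R) := leb_measurable_itv i.
have lgG : forall T, t <= T -> leb_integrable `[t, T] (fun s => gamma s * expR (G s)).
  by apply: li_gamma_homo; [exact: expR_lint_homo|move=> s _; exact: expR_ge0].
pose S := [set w s * expR (- G s) | s in `[t, T]].
have G0 s : 0 <= G s.
  by apply: lint_ge0 => x /=; rewrite in_itv/= => /andP[/gamma0].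
have St : S (w t * expR (- G t)).
  by exists t => //=; rewrite in_itv/= lexx.
have hS : has_sup S.
  split; first by exists (w t * expR (- G t)).
  exists M => _ [s /= + <-]; rewrite in_itv/= => sT.
  apply: le_trans (wM _ sT); rewrite ler_piMr ?w0//.
  by rewrite -[leRHS]expR0 ler_expR oppr_le0.
have le_sup s : t <= s <= T -> w s <= sup S * expR (G s).
  move=> sT; rewrite -ler_pdivrMr ?expR_gt0// -expRN.
  by apply: ub_le_sup; [case: hS|exists s => //=; rewrite in_itv].
have SA : sup S <= A.
  rewrite leNgt; apply/negP => AS.
  pose c := (sup S - A) * expR (- G T).
  have c0 : 0 < c by rewrite mulr_gt0 ?expR_gt0// subr_gt0.
  suff : sup S <= sup S - c by rewrite leNgt ltrBlDr ltrDl c0.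
  apply: ge_sup; first by case: hS.
  move=> _ [s /= + <-]; rewrite in_itv/= => /andP[ts sT].
  have sTT : t <= s <= T by rewrite ts.
  have h1 : lint `[t, s] (fun r => gamma r * w r) <=
      sup S * lint `[t, s] (fun r => gamma r * expR (G r)).
    rewrite -lintZ//; last exact: lgG.
    apply: lint_le => //.
    - by apply: liS lgw => //; apply: subset_itvl; rewrite bnd_simp.
    - by apply: liZ => //; exact: lgG.
    - move=> x /=; rewrite in_itv/= => /andP[tx xs].
      rewrite mulrCA ler_wpM2l ?gamma0//; apply: le_sup.
      by rewrite tx (le_trans xs).
  have S0 : 0 <= sup S.
    apply: le_trans (ub_le_sup (proj2 hS) St).
    by rewrite mulr_ge0 ?expR_ge0// w0// lexx.
  have h2 := ler_wpM2l S0 (lint_expR_le ts).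
  have h3 : w s <= A - sup S + sup S * expR (G s).
    have := wle _ sTT; rewrite mulrDr mulr1 in h2; lra.
  have := ler_wpM2r (expR_ge0 (- G s)) h3.
  rewrite mulrDl -(mulrA (sup S)) -expRD subrr expR0 mulr1 => /le_trans; apply.
  have cle : c <= (sup S - A) * expR (- G s).
    apply: ler_wpM2l; first by rewrite subr_ge0 ltW.
    by rewrite ler_expR lerN2; apply: lint_homo sT; rewrite in_itv/= andbT.
  by rewrite -(opprB (sup S)) mulNr addrC lerD2l lerN2.
move=> s sT; apply: le_trans (le_sup _ sT) _.
by rewrite ler_wpM2r// expR_ge0.
Qed.

End exponential.
End LebesgueEstimates.
#[global] Opaque lint.

Existing Class separable.

(** * Strong measurability and Bochner integrals *)

Section DualSpace.
Context {R : realType} {E : completeNormedModType R}.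
Implicit Types (p : dual E) (u v : E).

Lemma dual_linear p : linear p.
Proof. by case: p => f /= /asboolP[]. Qed.

Lemma dual_continuous p : continuous p.
Proof. by case: p => f /= /asboolP[]. Qed.

Lemma dualD p u v : p (u + v) = p u + p v :> R.
Proof. by have := dual_linear p 1 u v; rewrite !scale1r. Qed.

Lemma dual0 p : p 0 = 0 :> R.
Proof.
have h := dualD p 0 0; rewrite addr0 in h.
by apply: (@addrI _ (p 0)); rewrite -h addr0.
Qed.

Lemma dualZ p (a : R) u : p (a *: u) = a * p u :> R.
Proof. by have := dual_linear p a u 0; rewrite dual0 !addr0. Qed.

Lemma dualN p u : p (- u) = - p u :> R.
Proof. by rewrite -scaleN1r dualZ mulN1r. Qed.

Lemma dualB p u v : p (u - v) = p u - p v :> R.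
Proof. by rewrite dualD dualN. Qed.

Lemma dual_bounded p : exists2 C : R, 0 < C & forall v, `|p v| <= C * `|v|.
Proof.
have /cvgrPdist_lt/(_ 1 ltr01) := @dual_continuous p 0.
rewrite dual0 => /nbhs_ballP[r /= r0 h].
exists (2 / r); first by rewrite divr_gt0.
move=> v; have [->|v0] := eqVneq v 0; first by rewrite dual0 !normr0 mulr0.
have nv : 0 < `|v| by rewrite normr_gt0.
pose c := r / 2 / `|v|.
have c0 : 0 < c by rewrite !divr_gt0.
have /h : ball (0 : E) r (c *: v).
  rewrite -ball_normE/= sub0r normrN normrZ gtr0_norm// /c divfK ?gt_eqF//.
  by rewrite ltr_pdivrMr// ltr_pMr// ltr1n.
rewrite /= sub0r normrN dualZ normrM (gtr0_norm c0) => /ltW.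
rewrite mulrC -ler_pdivlMr// div1r /c => /le_trans; apply.
by rewrite -[leRHS](_ : (r / 2 / `|v|)^-1 = _)//; field; rewrite !gt_eqF.
Qed.

(** The one-sided bound also applies to [- v], hence bounds the absolute value. In this way
    functionals found below a sublinear one become elements of the dual. *)
Lemma linear_dual (f : E -> R) (C : R) : linear (f : E -> R^o) ->
  (forall v, f v <= C * `|v|) -> exists p : dual E, forall v, p v = f v.
Proof.
move=> lf fC.
have fB u v : f (u - v) = f u - f v.
  by rewrite addrC -scaleN1r lf scaleN1r addrC.
have f0 : f 0 = 0 by have := fB 0 0; rewrite !subrr.
have fN v : f (- v) = - f v by have := fB 0 v; rewrite sub0r f0 sub0r.
have absf v : `|f v| <= C * `|v|.
  by rewrite ler_norml fC andbT lerNl -fN -(normrN v) fC.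
have cf : continuous (f : E -> R^o).
  move=> x; apply/cvgrPdist_lt => e e0.
  have C1 : 0 < `|C| + 1 by rewrite ltr_wpDl.
  near=> y; rewrite -fB; apply: (le_lt_trans (absf _)).
  apply: (@le_lt_trans _ _ ((`|C| + 1) * `|x - y|)).
    by rewrite ler_wpM2r// (le_trans (ler_norm _))// lerDl.
  rewrite mulrC -ltr_pdivlMr//; near: y.
  by apply: cvgr_dist_lt; [exact: cvg_id|rewrite divr_gt0].
have fd : (f : E -> R^o) \in is_dual by apply/asboolP; split.
by exists (Dual fd).
Unshelve. all: by end_near. Qed.

Lemma dual_eq (p q : dual E) : (forall v, p v = q v :> R) -> p = q.
Proof. by move=> pq; apply/val_inj/funext. Qed.

Lemma sublinear_normr : sublinear (fun v : E => `|v|).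
Proof.
by split=> [u v|a u a0]; [exact: ler_normD|rewrite normrZ ger0_norm].
Qed.

Lemma dual_norming v :
  exists p : dual E, (forall u, `|p u : R| <= `|u|) /\ p v = `|v| :> R.
Proof.
have [f [lf fle fv]] := Hahn_Banach_support v sublinear_normr.
have [|p pf] := @linear_dual f 1 lf; first by move=> u; rewrite mul1r.
exists p; split; last by rewrite pf fv.
by move=> u; rewrite ler_norml pf fle andbT lerNl -pf -dualN pf -(normrN u).
Qed.

Lemma dual_separates u v : (forall p, p u = p v :> R) -> u = v.
Proof.
move=> h; have [p [_ puv]] := dual_norming (u - v).
apply/eqP; rewrite -subr_eq0 -normr_eq0 -puv dualB h subrr//.
Qed.

End DualSpace.

Section Separable.
Context {R : realType} {E : completeNormedModType R}.

Lemma separable_seq : separable E ->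
  exists e_ : nat -> E, forall v (r : R), 0 < r -> exists n, `|v - e_ n| < r.
Proof.
move=> [A /countable_injP[f finj] dA].
exists (fun n => xget 0 [set x | A x /\ f x = n]) => v r r0.
have [||x [vx Ax]] := dA (ball v r).
- by exists v; exact: ballxx.
- exact: ball_open.
exists (f x); case: xgetP => [y _ [Ay fy]|/(_ x) []]; last by split.
have -> : y = x by apply: finj; rewrite ?inE.
by move: vx; rewrite -ball_normE.
Qed.

End Separable.

Lemma lmf_cvg {R : realType} (D : set R) (F : nat -> R -> R) (f : R -> R) :
  (forall n, lmf D (F n)) -> (forall s, D s -> F n s @[n --> \oo] --> f s) ->
  lmf D f.
Proof. by move=> mF Ff; exact: measurable_fun_cvg mF Ff. Qed.

(** * Strongly measurable functions *)

Section StronglyMeasurable.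
Context {R : realType} {E : completeNormedModType R}.
Context {sepE : separable E}.
Implicit Types (D : set R) (f g : R -> E).

(* Strong measurability, when E is separable. *)
Definition smeas D f := forall e, lmf D (fun s => `|f s - e|).

(** Making the cover disjoint picks the first index whose set contains [s], a measurable function of
    [s]. This replaces measurable selection wherever a dense sequence is available. *)
Lemma first_index (A : nat -> set R) D : (forall n, leb_measurable (A n)) ->
  (forall s, D s -> exists n, A n s) ->
  exists i : R -> nat, (forall s, D s -> A (i s) s) /\
    (forall n, exists2 B, leb_measurable B & forall s, D s -> (i s = n <-> B s)).
Proof.
move=> mA DA.
have /choice[i hi] : forall s, exists n, D s -> seqDU A n s.
  move=> s; have [Ds|nD] := pselect (D s); last by exists 0%N.
  have : (\bigcup_n A n) s by have [n] := DA _ Ds; exists n.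
  by rewrite seqDU_bigcup_eq => -[n _ h]; exists n.
exists i; split=> [s /hi[]//|n]; exists (seqDU A n).
  rewrite /leb_measurable /seqDU; apply: measurableD; first exact: mA.
  by apply: (@bigsetU_measurable _ (Rleb R)) => k _; exact: mA.
move=> s Ds; split=> [<-|h]; first exact: hi.
have /trivIsetP/(_ (i s) n I I) := @trivIset_seqDU _ A.
have [//|_ /(_ isT) h'] := eqVneq (i s) n.
by have : set0 s by rewrite -h'; split; [exact: hi|].
Qed.

Lemma lmf_glue D (i : R -> nat) (H : nat -> R -> R) : leb_measurable D ->
  (forall n, exists2 B, leb_measurable B & forall s, D s -> (i s = n <-> B s)) ->
  (forall n, lmf D (H n)) -> lmf D (fun s => H (i s) s).
Proof.
move=> mD hi mH.
pose F n := D `&` [set s | i s = n].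
have FE n : exists2 B, leb_measurable B & F n = D `&` B.
  have [B mB h] := hi n; exists B => //.
  by apply/seteqP; split=> s [Ds] /=; [move/(h _ Ds)|move/(h _ Ds)].
have mF n : leb_measurable (F n).
  by have [B mB ->] := FE n; exact: measurableI.
have DF : D = \bigcup_n F n.
  by apply/seteqP; split=> [s Ds|s [n _ []//]]; exists (i s).
rewrite /lmf DF; apply/measurable_fun_bigcup => [n|n]; first exact: mF.
apply: (lmf_ext (f := H n)); first by move=> s [_ /= ->].
by apply: lmfS (mH n) => // s [].
Qed.

Lemma leb_measurable_lt D (f : R -> R) (c : R) : leb_measurable D -> lmf D f ->
  leb_measurable (D `&` [set s | f s < c]).
Proof.
move=> mD mf; have := mf mD _ (measurable_itv `]-oo, c[).
by congr (measurable _); apply/seteqP; split=> x /=; rewrite in_itv.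
Qed.

(** [y s] is replaced by a point [e_ (i s)] of the dense sequence within [k.+1%:R^-1], with [i] from
    [first_index]; the composite is then measurable piece by piece, and continuity of [F s] passes
    to the limit in [k]. *)
Lemma Caratheodory D (F : R -> E -> R) (y : R -> E) : leb_measurable D ->
  (forall e, lmf D (F ^~ e)) -> (forall s, D s -> continuous (F s)) ->
  smeas D y -> lmf D (fun s => F s (y s)).
Proof.
move=> mD mF cF my; have [e_ de] := separable_seq sepE.
have H k : exists i : R -> nat,
    (forall s, D s -> `|y s - e_ (i s)| < k.+1%:R^-1) /\
    lmf D (fun s => F s (e_ (i s))).
  have [||i [h1 h2]] := @first_index
      (fun n => D `&` [set s | `|y s - e_ n| < k.+1%:R^-1]) D.
  - by move=> n; apply: leb_measurable_lt => //; exact: my.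
  - by move=> s Ds; have [|n hn] := de (y s) k.+1%:R^-1; [|exists n].
  exists i; split; first by move=> s Ds; have [] := h1 _ Ds.
  exact: (@lmf_glue D i (fun n s => F s (e_ n))).
have /choice[i hi] := H.
have mh k : lmf D (fun s => F s (e_ (i k s))) by have [] := hi k.
apply: (lmf_cvg mh) => s Ds.
apply: (@continuous_cvg _ _ _ _ _ (fun k => e_ (i k s)) (F s)); first exact: cF.
apply/cvgrPdist_lt => e e0; near=> k.
have [h _] := hi k; apply: lt_trans (h _ Ds) _.
by near: k; exact: near_infty_natSinv_lt (PosNum e0).
Unshelve. all: by end_near. Qed.

Lemma smeas_ext D f g : (forall s, D s -> f s = g s) -> smeas D f -> smeas D g.
Proof. by move=> fg mf e; apply: lmf_ext (mf e) => s /fg ->. Qed.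

Lemma smeas_ae D f g : leb_measurable D -> (\forall s \ae leb, D s -> f s = g s) ->
  smeas D f -> smeas D g.
Proof.
move=> mD fg mf e; apply: lmf_ae (mf e) => //.
by apply: filterS fg => s h /h ->.
Qed.

Lemma smeasS D D' f : leb_measurable D -> D' `<=` D -> smeas D f -> smeas D' f.
Proof. by move=> mD D'D mf e; exact: lmfS (mf e). Qed.

Lemma smeas_cst D (c : E) : smeas D (fun=> c).
Proof. by move=> e; exact: lmf_cst. Qed.

Lemma continuous_distl (c : E) : continuous (fun e : E => `|e - c|).
Proof.
move=> e; apply: cvg_norm; apply: cvgB; [exact: cvg_id|exact: cvg_cst].
Qed.

Lemma continuous_distr (c : E) : continuous (fun e : E => `|c - e|).
Proof.
move=> e; apply: cvg_norm; apply: cvgB; [exact: cvg_cst|exact: cvg_id].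
Qed.

Lemma smeas_norm D f : smeas D f -> lmf D (fun s => `|f s|).
Proof. by move=> /(_ 0); apply: lmf_ext => s _; rewrite subr0. Qed.

(** The norm of [f s - e - v] is measurable in [s] and continuous in [v], so [Caratheodory] allows
    [g s] for [v]. *)
Lemma smeasB D f g : leb_measurable D -> smeas D f -> smeas D g ->
  smeas D (fun s => f s - g s).
Proof.
move=> mD mf mg e.
apply: (lmf_ext (f := fun s => `|(f s - e) - g s|)).
  by move=> s _; rewrite addrAC.
apply: (@Caratheodory D (fun s v => `|(f s - e) - v|)) => //.
- by move=> v; apply: lmf_ext (mf (e + v)) => s _; rewrite opprD addrA.
- by move=> s _; exact: continuous_distr.
Qed.

Lemma smeasD D f g : leb_measurable D -> smeas D f -> smeas D g ->
  smeas D (fun s => f s + g s).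
Proof.
move=> mD mf mg; have mNg := smeasB mD (@smeas_cst D 0) mg.
by apply: smeas_ext (smeasB mD mf mNg) => s _; rewrite sub0r opprK.
Qed.

Lemma smeas_comp D (h : E -> R) f : leb_measurable D -> continuous h ->
  smeas D f -> lmf D (fun s => h (f s)).
Proof.
move=> mD ch; apply: (@Caratheodory D (fun=> h)) => // e; exact: lmf_cst.
Qed.

Lemma smeas_cvg D (F : nat -> R -> E) f : (forall n, smeas D (F n)) ->
  (forall s, D s -> F n s @[n --> \oo] --> f s) -> smeas D f.
Proof.
move=> mF Ff e; apply: (lmf_cvg (F := fun n s => `|F n s - e|)).
  by move=> n; exact: mF.
move=> s Ds; apply: (@continuous_cvg _ _ _ _ _ (F ^~ s) (fun v => `|v - e|)); last exact: Ff.
exact: continuous_distl.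
Qed.

Lemma smeas_cvg_ae D (F : nat -> R -> E) f : leb_measurable D ->
  (forall n, smeas D (F n)) ->
  (\forall s \ae leb, D s -> F n s @[n --> \oo] --> f s) -> smeas D f.
Proof.
move=> mD mF Ff; pose P s := D s -> F n s @[n --> \oo] --> f s.
apply: (smeas_ae (f := fun s => if `[< P s >] then f s else 0)) => //.
  by apply: filterS Ff => s Ps _; rewrite asboolT.
apply: (smeas_cvg (F := fun n s => if `[< P s >] then F n s else 0)).
  move=> n; apply: smeas_ae (mF n) => //.
  by apply: filterS Ff => s Ps _; rewrite asboolT.
by move=> s Ds; case: asboolP => [/(_ Ds)//|_]; exact: cvg_cst.
Qed.

End StronglyMeasurable.

Lemma li_intro {R : realType} (D : set R) (f : R -> R) : lmf D f ->
  (leb_integral D (fun s => `|f s|%:E) < +oo)%E -> leb_integrable D f.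
Proof.
move=> mf fin.
have mE : measurable_fun (D : set (Rleb R)) (fun s => (f s)%:E) by exact/measurable_EFinP.
by apply/integrableP; split; [exact: mE|exact: fin].
Qed.

(** * Bochner integrals through functionals *)

Section Bochner.
Context {R : realType} {E : completeNormedModType R}.
Context {sepE : separable E}.
Implicit Types (D : set R) (f g : R -> E) (p : dual E).

Lemma dual_comp_lmf D f p : leb_measurable D -> smeas D f ->
  lmf D (fun r => p (f r)).
Proof. by move=> mD mf; apply: smeas_comp => //; exact: dual_continuous. Qed.

Lemma dual_comp_li D f p : leb_measurable D -> smeas D f ->
  leb_integrable D (fun r => `|f r|) -> leb_integrable D (fun r => p (f r)).
Proof.
move=> mD mf lf; have [C C0 hC] := dual_bounded p.
apply: (li_le (g := fun r => C * `|f r|)) => //; first exact: dual_comp_lmf.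
exact: liZ.
Qed.

Lemma lint_indic D (B : set R) : leb_measurable D -> leb_measurable B -> B `<=` D ->
  (leb B < +oo)%E -> leb_integrable D (\1_B : R -> R) /\ lint D \1_B = fine (leb B).
Proof.
move=> mD mB BD Bfin.
have iB : leb_integral D (fun s => (\1_B s)%:E) = leb B.
  by rewrite [LHS](integral_indic leb mD mB) setIidl.
have lB : leb_integrable D (\1_B : R -> R).
  apply/integrableP; split.
    by apply/measurable_EFinP; exact: (@measurable_indic _ (Rleb R)).
  apply: le_lt_trans Bfin; rewrite -iB le_eqVlt; apply/orP; left; apply/eqP.
  by apply: eq_integral => x _; rewrite gee0_abs// lee_fin.
by split => //; rewrite -iB lintE.
Qed.

Lemma smeas_simple D (s : R -> E) : leb_measurable D -> bochner_simple D s -> smeas D s.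
Proof.
move=> mD [fs hs] e _ Y mY.
have -> : D `&` (fun r => `|s r - e|) @^-1` Y =
    \bigcup_(c in s @` D `&` [set c | Y `|c - e|]) (D `&` s @^-1` [set c]).
  apply/seteqP; split=> [r [Dr Yr]|r [c [_ Yc] [Dr /= sr]]].
    by exists (s r) => //; split => //; exists r.
  by split => //=; rewrite sr.
apply: (@fin_bigcup_measurable _ (Rleb R)).
  by apply: finite_setIl.
by move=> c _; have [] := hs c.
Qed.

(** [h 0 = 0] discards the level set of 0, the only one that may have infinite measure. It is used
    with [h] the norm and with [h] a functional. *)
Lemma lint_simple D (s : R -> E) (h : E -> R) : leb_measurable D -> bochner_simple D s ->
  h 0 = 0 ->
  leb_integrable D (fun r => h (s r)) /\
  lint D (fun r => h (s r)) =
  \sum_(e <- finmap.enum_fset (fset_set (s @` D))) fine (leb (D `&` s @^-1` [set e])) * h e.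
Proof.
move=> mD [fs hs] h0.
have key (l : seq E) :
   leb_integrable D (fun r => \sum_(e <- l) h e * \1_(D `&` s @^-1` [set e]) r) /\
   lint D (fun r => \sum_(e <- l) h e * \1_(D `&` s @^-1` [set e]) r) =
   \sum_(e <- l) fine (leb (D `&` s @^-1` [set e])) * h e.
  elim: l => [|e l [IH1 IH2]].
    split; first by apply: (li_ext mD _ (li0 mD)) => x _; rewrite big_nil.
    by rewrite big_nil -[RHS](lint0 D); apply: lint_ext => x _; rewrite big_nil.
  have [le le'] : leb_integrable D (fun r => h e * \1_(D `&` s @^-1` [set e]) r) /\
      lint D (fun r => h e * \1_(D `&` s @^-1` [set e]) r) =
      fine (leb (D `&` s @^-1` [set e])) * h e.
    have [->|e0] := eqVneq e 0.
      rewrite h0 mulr0; split.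
        by apply: (li_ext mD _ (li0 mD)) => x _; rewrite mul0r.
      by rewrite -[RHS](lint0 D); apply: lint_ext => x _; rewrite mul0r.
    have [m1 /(_ e0) m2] := hs e.
    have [l1 l2] := lint_indic mD m1 (@subIsetl _ _ _) m2.
    by split; [exact: liZ|rewrite lintZ// l2 mulrC].
  split.
    by apply: (li_ext mD _ (liD mD le IH1)) => x _; rewrite big_cons.
  rewrite big_cons -IH2 -le' -lintD//.
  by apply: lint_ext => x _; rewrite big_cons.
have [k1 k2] := key (finmap.enum_fset (fset_set (s @` D))).
have hE r : D r ->
    \sum_(e <- finmap.enum_fset (fset_set (s @` D))) h e * \1_(D `&` s @^-1` [set e]) r = h (s r).
  move=> Dr; rewrite (bigD1_seq (s r))/=.
  - rewrite indicE mem_set// mulr1 big1 ?addr0// => e es.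
    by rewrite indicE memNset ?mulr0// => -[_ /= /esym/eqP]; apply/negP.
  - by rewrite in_fset_set// inE; exists r.
  - exact: finmap.fset_uniq.
split; first exact: (li_ext mD hE k1).
by rewrite -k2; apply: lint_ext => r Dr; rewrite hE.
Qed.

Lemma dual_simple_integral D (s : R -> E) p : leb_measurable D -> bochner_simple D s ->
  p (bochner_simple_integral D s) = lint D (fun r => p (s r)).
Proof.
move=> mD ss; have [_ ->] := lint_simple mD ss (dual0 p).
rewrite /bochner_simple_integral fsbig_finite; last by case: ss.
rewrite (big_morph (p : E -> R) (dualD p) (dual0 p)).
by apply: eq_bigr => e _; rewrite dualZ.
Qed.

(** On a set of finite measure this agrees with the Bochner integral ([bochner_weak_integral],
    [weak_bochner_integral]). Additivity and norm bounds become statements about real integrals. *)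
Definition weak_integral D f (v : E) : Prop :=
  [/\ smeas D f, leb_integrable D (fun r => `|f r|) &
      forall p, p v = lint D (fun r => p (f r)) :> R].

Lemma weak_integral_norm D f v : leb_measurable D -> weak_integral D f v ->
  `|v| <= lint D (fun r => `|f r|).
Proof.
move=> mD [mf lf hv]; have [p [pn <-]] := dual_norming v.
rewrite hv; apply: lint_le => //; first exact: dual_comp_li.
by move=> x _; apply: le_trans (pn (f x)); exact: ler_norm.
Qed.

Lemma weak_integral_unique D f v v' :
  weak_integral D f v -> weak_integral D f v' -> v = v'.
Proof.
by move=> [_ _ h] [_ _ h']; apply: dual_separates => p; rewrite h h'.
Qed.

Lemma weak_integral_ae D f g v : leb_measurable D ->
  (\forall s \ae leb, D s -> f s = g s) -> weak_integral D f v -> weak_integral D g v.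
Proof.
move=> mD fg [mf lf hv]; split.
- exact: smeas_ae mf.
- by apply: li_ae lf => //; apply: filterS fg => s h /h ->.
- move=> p; rewrite hv; apply: lint_ae => //; last exact: dual_comp_li.
  by apply: filterS fg => s h /h ->.
Qed.

(** Functionals commute with integrals of simple functions ([dual_simple_integral]), and both sides
    pass to the limit along the approximating sequence. *)
Lemma bochner_weak_integral D f v : leb_measurable D ->
  is_bochner_integral D f v -> weak_integral D f v.
Proof.
move=> mD [s_ [ss sf sI sv]].
have ms n : smeas D (s_ n) by exact: smeas_simple.
have mf : smeas D f by exact: smeas_cvg_ae sf.
have mfs n : lmf D (fun t => `|f t - s_ n t|) by apply: smeas_norm; exact: smeasB.
have lsn n : leb_integrable D (fun t => `|s_ n t|).
  by have [] := lint_simple (h := fun e => `|e|) mD (ss n) (normr0 _).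
have lfs : \forall n \near \oo, leb_integrable D (fun t => `|f t - s_ n t|).
  move/fine_cvgP : sI => [+ _]; apply: filterS => n fin.
  apply: li_intro => //; rewrite (_ : (fun _ => _) = fun t => `|f t - s_ n t|%:E).
    by rewrite ltey_eq fin.
  by apply/funext => t; rewrite normr_id.
have lf : leb_integrable D (fun t => `|f t|).
  have [N _ /(_ N (leqnn _)) lN] := lfs.
  apply: (li_le _ _ _ (liD mD lN (lsn N))) => //; first exact: smeas_norm.
  by move=> x _; rewrite normr_id -[in leLHS](subrK (s_ N x) (f x)) ler_normD.
split => // p.
have c1 : p (bochner_simple_integral D (s_ n)) @[n --> \oo] --> (p v : R).
  by apply: continuous_cvg => //; exact: dual_continuous.
suff c2 : p (bochner_simple_integral D (s_ n)) @[n --> \oo] --> lint D (fun t => p (f t)).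
  exact: (cvg_unique _ c1 c2).
have [C C0 hC] := dual_bounded p.
have c0 : C * lint D (fun t => `|f t - s_ n t|) @[n --> \oo] --> (0 : R).
  have c0 : lint D (fun t => `|f t - s_ n t|) @[n --> \oo] --> (0 : R).
    apply: cvg_trans (fine_cvg sI); apply: near_eq_cvg.
    by apply: filterS lfs => n ln; rewrite /= lintE.
  by have := cvgM (cvg_cst C) c0; rewrite mulr0; exact.
apply/cvgrPdist_lt => e e0.
move/cvgrPdist_lt : c0 => /(_ _ e0) c0; near=> n.
rewrite dual_simple_integral//.
have ln : leb_integrable D (fun t => `|f t - s_ n t|) by near: n.
have lpf := dual_comp_li p mD mf lf.
have lps := dual_comp_li p mD (ms n) (lsn n).
rewrite -lintB//.
have hn : `|0 - C * lint D (fun t => `|f t - s_ n t|)| < e by near: n.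
apply: le_lt_trans hn; rewrite sub0r normrN.
apply: le_trans (ler_norm _); rewrite -lintZ//.
apply: (le_trans (lint_norm mD (liB mD lpf lps))).
apply: lint_le => //.
- exact/li_norm/liB.
- exact: liZ.
- by move=> x _; rewrite -dualB hC.
Unshelve. all: by end_near. Qed.

(** A closest point to [f r] among 0 and the first [n] terms of [e_]. Starting from 0 keeps the
    error below the norm of [f r], the dominating function. *)
Fixpoint nearest_simple (e_ : nat -> E) f n r : E :=
  if n is n'.+1 then
    if `|f r - e_ n'| < `|f r - nearest_simple e_ f n' r| then e_ n'
    else nearest_simple e_ f n' r
  else 0.

(** The functions [nearest_simple] are simple as [D] has finite measure, and converge to [f] in mean
    by dominated convergence. Their integrals form a Cauchy sequence: a norming functional bounds
    the distance of two of them by the sum of the mean distances to [f]. *)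
Lemma bochner_integral_exists D f : leb_measurable D -> (leb D < +oo)%E ->
  smeas D f -> leb_integrable D (fun r => `|f r|) ->
  exists v, is_bochner_integral D f v.
Proof.
move=> mD Dfin mf lf; have [e_ de] := separable_seq sepE.
pose s_ n r := nearest_simple e_ f n r.
have ms n : smeas D (s_ n).
  elim: n => [|n IH]; first exact: smeas_cst.
  have mb : measurable_fun (D : set (Rleb R)) (fun r => `|f r - e_ n| < `|f r - s_ n r|).
    apply: (@measurable_fun_ltr _ (Rleb R)); first exact: mf.
    by apply: smeas_norm; exact: smeasB.
  move=> e; apply: (lmf_ext (f := fun r => if `|f r - e_ n| < `|f r - s_ n r|
      then `|e_ n - e| else `|s_ n r - e|)).
    by move=> r _; rewrite /s_ /=; case: ifP.
  apply: measurable_fun_if; first exact: mD.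
  - exact: mb.
  - exact: lmf_cst.
  - by apply: lmfS (IH e) => // r [].
have fins n : finite_set (s_ n @` D).
  elim: n => [|n IH].
    by apply: (@sub_finite_set _ _ [set 0]) => // _ [r _ <-].
  apply: (@sub_finite_set _ _ ([set e_ n] `|` s_ n @` D)); last by rewrite finite_setU.
  move=> _ [r Dr <-]; rewrite /s_ /=; case: ifP => _; [by left|right].
  by exists r.
have ss n : bochner_simple D (s_ n).
  split => // e.
  have mD' : leb_measurable (D `&` s_ n @^-1` [set e]).
    have := ms n e mD _ (measurable_set1 0).
    congr (measurable _); apply/seteqP; split=> r [Dr /= h]; split => //=.
      by apply/eqP; rewrite -subr_eq0 -normr_eq0 h.
    by rewrite h subrr normr0.
  split => // _; apply: le_lt_trans Dfin.
  by apply: le_measure; rewrite ?inE//; exact: subIsetl.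
have dS n r : `|f r - s_ n.+1 r| <= `|f r - s_ n r|.
  by rewrite {1}/s_ /=; case: ifPn => // /ltW.
have dn m n r : (m <= n)%N -> `|f r - s_ n r| <= `|f r - s_ m r|.
  move=> /subnK <-; elim: (n - m)%N => [//|k IH].
  by rewrite addSn; exact: le_trans (dS _ _) IH.
have d0 n r : `|f r - s_ n r| <= `|f r|.
  by have := @dn 0%N n r (leq0n _); rewrite /s_ /= subr0.
have de' n r : `|f r - s_ n.+1 r| <= `|f r - e_ n|.
  by rewrite {1}/s_ /=; case: ifPn => //; rewrite -leNgt.
have sf r : s_ n r @[n --> \oo] --> f r.
  apply/cvgrPdist_lt => e /(de (f r))[N hN]; exists N.+1 => // n /= Nn.
  exact: le_lt_trans (dn _ _ _ Nn) (le_lt_trans (de' _ _) hN).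
have mfs n : lmf D (fun t => `|f t - s_ n t|) by apply: smeas_norm; exact: smeasB.
have [||_ _ cI] := lint_dominated mD mfs (f := fun=> 0) _ lf.
- move=> r _; apply/norm_cvg0P; have /cvgrPdist_lt := sf r => h.
  apply/cvgrPdist_lt => e e0; apply: filterS (h _ e0) => n.
  by rewrite sub0r normrN.
- by move=> n r _; rewrite normr_id d0.
rewrite lint0 in cI.
have lfs n : leb_integrable D (fun t => `|f t - s_ n t|).
  by apply: li_le lf => // x _; rewrite normr_id d0.
have lsn n : leb_integrable D (fun t => `|s_ n t|).
  by have [] := lint_simple (h := fun e => `|e|) mD (ss n) (normr0 _).
have cvgv : cvgn (fun n => bochner_simple_integral D (s_ n)).
  apply: cauchy_cvg; apply/cauchy_ballP => e e0.
  have e20 : 0 < e / 2 by rewrite divr_gt0.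
  move/cvgrPdist_lt : cI => /(_ _ e20)[N _ hN].
  pose A := [set bochner_simple_integral D (s_ n) | n in [set n | (N <= n)%N]].
  exists (A, A); first by split; exists N => // n Nn; exists n.
  move=> [_ _] [/= [n /hN/= hn <-] [m /hN/= hm <-]].
  rewrite /= -ball_normE/=.
  have [p [pn <-]] := dual_norming
    (bochner_simple_integral D (s_ n) - bochner_simple_integral D (s_ m)).
  rewrite dualB !dual_simple_integral//.
  have lpn := dual_comp_li p mD (ms n) (lsn n).
  have lpm := dual_comp_li p mD (ms m) (lsn m).
  rewrite -lintB//.
  apply: (@le_lt_trans _ _ (lint D (fun t => `|f t - s_ n t| + `|f t - s_ m t|))).
    apply: lint_le => //; [exact: liB|exact: liD|].
    move=> x _; rewrite -dualB; apply: le_trans (ler_norm _) _.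
    apply: le_trans (pn _) _; rewrite (distrC (f x)).
    exact: ler_distD.
  rewrite lintD// [ltRHS]splitr; apply: ltrD.
    by apply: le_lt_trans hn; rewrite sub0r normrN ler_norm.
  by apply: le_lt_trans hm; rewrite sub0r normrN ler_norm.
exists (limn (fun n => bochner_simple_integral D (s_ n))); exists s_; split => //.
- by apply: aeW => t _; exact: sf.
- apply: cvg_EFin.
    by apply: nearW => n; rewrite lintE.
  by apply: cvg_trans cI; apply: near_eq_cvg; apply: nearW => n; rewrite /= lintE.
Qed.

Lemma weak_bochner_integral D f v : leb_measurable D -> (leb D < +oo)%E ->
  weak_integral D f v -> is_bochner_integral D f v.
Proof.
move=> mD Dfin wv; have [mf lf _] := wv.
have [v' bv'] := bochner_integral_exists mD Dfin mf lf.
by rewrite (weak_integral_unique wv (bochner_weak_integral mD bv')).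
Qed.

End Bochner.

(** * Primitives of Bochner integrable functions *)

Section Primitive.
Context {R : realType} {E : completeNormedModType R}.
Context {sepE : separable E}.
Implicit Types (t : R) (x f g : R -> E) (p : dual E).

(** The density [f] is a datum of its own, with a value at every time, so that inclusions can be
    imposed everywhere; it agrees with [derive1 x] off a null set ([primitive_derivable]). *)
Definition primitive t x f : Prop :=
  [/\ smeas `[t, +oo[ f,
      forall T, t <= T -> leb_integrable `[t, T] (fun r => `|f r|) &
      forall s, t <= s -> forall p,
        p (x s - x t) = lint `[t, s] (fun r => p (f r)) :> R].

Let mI (i : interval R) := leb_measurable_itv i.

Lemma leb_itv_lty (a b : R) : (leb `[a, b] < +oo)%E.
Proof.
have [ab|ba] := leP a b; first by rewrite leb_itv// ltry.
by rewrite set_itv_ge ?measure0// -leNgt bnd_simp.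
Qed.

Lemma smeas_itv t f : (forall T, t <= T -> smeas `[t, T] f) -> smeas `[t, +oo[ f.
Proof. by move=> h e; apply: lmf_ray => T /h. Qed.

Lemma W11loc_primitive t x : W11loc t x -> primitive t x (derive1 x).
Proof.
move=> [_ _ ld hx].
have h s : t <= s -> weak_integral `[t, s] (derive1 x) (x s - x t).
  by move=> ts; apply: bochner_weak_integral => //; exact: hx.
split.
- by apply: smeas_itv => T /h[].
- by move=> T /h[].
- by move=> s /h[].
Qed.

Section primitive_theory.
Variables (t : R) (x f : R -> E).
Hypothesis xf : primitive t x f.

Lemma primitive_smeas a b : t <= a -> smeas `[a, b] f.
Proof.
move=> ta; have [mf _ _] := xf; apply: smeasS mf => //.
by apply: subset_itv; rewrite bnd_simp.
Qed.

Lemma primitive_li a b : t <= a -> leb_integrable `[a, b] (fun r => `|f r|).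
Proof. by move=> ta; have [_ lf _] := xf; exact: (loc_li_sub lf). Qed.

Lemma primitive_weak_integral a b : t <= a -> a <= b ->
  weak_integral `[a, b] f (x b - x a).
Proof.
move=> ta ab; split; [exact: primitive_smeas|exact: primitive_li|move=> p].
have [_ _ hx] := xf; have tb := le_trans ta ab.
have -> : x b - x a = (x b - x t) - (x a - x t) by rewrite opprB subrKA.
rewrite dualB (hx _ tb) (hx _ ta) (lint_Chasles ta ab).
  by rewrite addrAC subrr add0r.
by apply: dual_comp_li => //; [exact: primitive_smeas|exact: primitive_li].
Qed.

Lemma primitive_dist a b : t <= a -> a <= b ->
  `|x b - x a| <= lint `[a, b] (fun r => `|f r|).
Proof.
by move=> ta ab; apply: weak_integral_norm => //; exact: primitive_weak_integral.
Qed.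

Lemma primitive_smeas_self : smeas `[t, +oo[ x.
Proof.
(* Composing with [Num.max t] extends [x] constantly to the left of [t]; absolute continuity of the
   integral makes the extension continuous on the whole line, hence Borel. *)
move=> e; pose u s : R := `|x (Num.max t s) - e|.
have cu : continuous u.
  move=> s; apply/cvgrPdist_lt => d d0.
  pose T := Num.max t s + 1.
  have lf := primitive_li T (lexx t).
  have [h h0 hh] := lint_abs_continuous lf d0.
  near=> r.
  have rs : `|s - r| < h.
    by near: r; apply: cvgr_dist_lt; [exact: cvg_id|].
  have rs1 : `|s - r| < 1.
    by near: r; apply: cvgr_dist_lt; [exact: cvg_id|].
  apply: (@le_lt_trans _ _ `|x (Num.max t s) - x (Num.max t r)|).
    rewrite /u; apply: le_trans (ler_dist_dist _ _) _.
    by rewrite opprB addrA subrK.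
  have key a b : t <= a -> a <= b -> b <= T -> b - a < h -> `|x b - x a| < d.
    move=> ta ab bT bah; apply: le_lt_trans (primitive_dist ta ab) _.
    have := hh _ _ ta ab bT bah; congr (_ < _).
    by apply: lint_ext => y _; rewrite normr_id.
  have mm (a b : R) : a <= b -> Num.max t b - Num.max t a <= b - a.
    by move=> ab; rewrite /Num.max; case: ifP; case: ifP; lra.
  have tm (a : R) : t <= Num.max t a by rewrite le_max lexx.
  move: rs rs1; rewrite !ltr_norml => /andP[h1 h2] /andP[h3 h4].
  have [sr|rs] := leP s r.
    rewrite distrC; apply: key => //.
    - by rewrite ge_max le_max lexx/= le_max sr orbT.
    - by rewrite ge_max /T ler_wpDr//=; apply: le_trans (_ : s + 1 <= _); [lra|rewrite lerD2r le_max lexx orbT].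
    - by apply: le_lt_trans (mm _ _ sr) _; lra.
  have {}rs := ltW rs.
  apply: key => //.
  - by rewrite ge_max le_max lexx/= le_max rs orbT.
  - by rewrite /T lerDl.
  - by apply: le_lt_trans (mm _ _ rs) _; lra.
apply: (lmf_ext (f := u)).
  by move=> s /=; rewrite in_itv/= andbT => ts; rewrite /u max_r.
apply: borel_lmf; first exact: measurable_itv.
exact: measurable_funTS (continuous_measurable_fun cu).
Unshelve. all: by end_near. Qed.

Lemma primitive_bounded T s : t <= s -> s <= T ->
  `|x s| <= `|x t| + lint `[t, T] (fun r => `|f r|).
Proof.
move=> ts sT; rewrite -[in leLHS](subrK (x t) (x s)) addrC.
apply: le_trans (ler_normD _ _) _; rewrite lerD2l.
apply: le_trans (primitive_dist (lexx t) ts) _.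
by apply: (lint_ge0_le (t := t)) => // r tr; exact: primitive_li.
Qed.

(** Vector Lebesgue points from real ones: [s] is a common Lebesgue point of the distances from [f]
    to all points of a dense sequence, and a point [e_ n] close to [f s] controls the mean of the
    norm of [f r - f s]. *)
Lemma primitive_W11_derive : ae_from t (fun s =>
  h^-1 *: (x (h + s) - x s) @[h --> 0^'] --> f s).
Proof.
have [e_ de] := separable_seq sepE.
have [mf lf _] := xf.
have lfe n T : t <= T -> leb_integrable `[t, T] (fun r => `|f r - e_ n|).
  move=> tT; apply: (li_le _ _ _ (liD _ (lf _ tT) (li_cst t T `|e_ n|))) => //.
    exact: (@primitive_smeas t T (lexx t) (e_ n)).
  by move=> r _; rewrite normr_id ler_normB.
have A := ae_foralln (fun n => leb_lebesgue_pt (lfe n)).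
rewrite /ae_from; apply: filterS A => s hs ts.
have {}ts : t < s by have [] := hs 0%N ts.
apply/cvgrPdist_le => e e0.
have [n hn] := de (f s) (e / 8) (divr_gt0 e0 (ltr0n _ 8)).
have [_ /(_ (e / 8) (divr_gt0 e0 (ltr0n _ 8))) H] := hs n (ltW ts).
have {}H : \forall h \near (0 : R)^'+,
    t <= s - h /\ lint `[s - h, s + h] (fun r => `|f r - f s|) <= e * h.
  near=> h; have h0 : 0 < h by near: h; exact: nbhs_right_gt.
  have [th hh] : t <= s - h /\ lint `[s - h, s + h]
      (fun r => `|(`|f r - e_ n| - `|f s - e_ n|)|) <= e / 8 * h by near: h.
  split => //.
  have ssh : s - h <= s + h by rewrite lerD2l; lra.
  have l1 : leb_integrable `[s - h, s + h] (fun r => `|f r - e_ n|).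
    exact: (loc_li_sub (lfe n)).
  have l2 : leb_integrable `[s - h, s + h] (fun r => `|(`|f r - e_ n| - `|f s - e_ n|)|).
    by apply: li_norm; apply: liB => //; exact: li_cst.
  have l3 : leb_integrable `[s - h, s + h] (fun r => `|f r - f s|).
    apply: (li_le _ _ _ (liD _ (primitive_li (s + h) th) (li_cst _ _ `|f s|))) => //.
      exact: (@primitive_smeas _ _ th (f s)).
    by move=> r _; rewrite normr_id ler_normB.
  (* Passing through [e_ n] costs twice the distance from [f s] to [e_ n], at most [e / 4]; over the
     length [2 * h] this is [e * h / 2], which leaves room for the mean oscillation [e / 8 * h]. *)
  apply: (@le_trans _ _ (lint `[s - h, s + h]
      (fun r => `|(`|f r - e_ n| - `|f s - e_ n|)| + e / 4))).
    apply: lint_le => //; first by apply: liD => //; exact: li_cst.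
    move=> r _; apply: le_trans (ler_distD (e_ n) _ _) _.
    rewrite [X in _ + X <= _]distrC.
    have := ler_norm (`|f r - e_ n| - `|f s - e_ n|).
    move: hn; move: `|f s - e_ n| `|f r - e_ n| => a b; move: `|b - a| => c; lra.
  rewrite lintD//; last exact: li_cst.
  rewrite lint_cst//; move: hh; set J := lint _ _ => hh.
  have -> : s + h - (s - h) = 2 * h by ring.
  by have := mulr_gt0 e0 h0; lra.
have H' : \forall h \near (0 : R)^', t <= s - `|h| /\
    lint `[s - `|h|, s + `|h|] (fun r => `|f r - f s|) <= e * `|h|.
  move: H; rewrite !near_withinE !near_nbhs => /nbhs_ballP[r /= r0 Hr].
  apply/nbhs_ballP; exists r => //= h; rewrite -ball_normE/= sub0r normrN => hr h0.
  apply: Hr; last by rewrite normr_gt0.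
  by rewrite -ball_normE/= sub0r normrN normr_id.
near=> h.
have h0 : h != 0 by near: h; exact: nbhs_dnbhs_neq.
have [th hh] : t <= s - `|h| /\
    lint `[s - `|h|, s + `|h|] (fun r => `|f r - f s|) <= e * `|h| by near: h.
have key a b : s - `|h| <= a -> a <= b -> b <= s + `|h| ->
    `|x b - x a - (b - a) *: f s| <= e * `|h|.
  move=> ha ab bh; have ta := le_trans th ha.
  have l3 c d : t <= c -> leb_integrable `[c, d] (fun r => `|f r - f s|).
    move=> tc.
    apply: (li_le _ _ _ (liD _ (primitive_li d tc) (li_cst _ _ `|f s|))) => //.
      exact: (@primitive_smeas _ _ tc (f s)).
    by move=> r _; rewrite normr_id ler_normB.
  apply: le_trans hh; apply: (@le_trans _ _ (lint `[a, b] (fun r => `|f r - f s|))).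
    have [m1 i1 hp] := primitive_weak_integral ta ab.
    apply: weak_integral_norm => //; split.
    - by apply: smeasB => //; exact: smeas_cst.
    - exact: l3.
    - move=> p; rewrite dualB hp dualZ.
      rewrite (_ : (b - a) * p (f s) = lint `[a, b] (fun=> p (f s))); last first.
        by rewrite lint_cst// mulrC.
      rewrite -lintB//; [|exact: dual_comp_li|exact: li_cst].
      by apply: lint_ext => r _; rewrite dualB.
  apply: lint_subset => //; first by apply: subset_itv; rewrite bnd_simp.
  exact: l3.
rewrite -[X in X - _](scale1r (f s)) -(mulVf h0) -scalerA -scalerBr normrZ normfV.
rewrite mulrC ler_pdivrMr ?normr_gt0//.
have [hpos|hneg] := leP 0 h.
  have := key s (h + s); rewrite addrK distrC; apply.
  - by rewrite gerDl oppr_le0.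
  - by rewrite lerDr.
  - by rewrite addrC lerD2l ler_norm.
have shE : s - (h + s) = - h by ring.
have := key (h + s) s.
rewrite shE scaleNr opprK [X in `|X| <= e * _]addrC -(opprB (x (h + s))); apply.
- by rewrite ltr0_norm// opprK addrC.
- by rewrite gerDr ltW.
- by rewrite lerDl.
Unshelve. all: by end_near. Qed.

Lemma primitive_derivable : ae_from t (fun s => derivable x s 1 /\ derive1 x s = f s).
Proof.
have A := primitive_W11_derive; rewrite /ae_from in A *.
apply: filterS A => s h ts; have {h ts} hc := h ts; split.
  apply/cvg_ex; exists (f s).
  rewrite (_ : (fun h => _) = fun h => h^-1 *: (x (h + s) - x s))//.
  by apply/funext => h; rewrite /= [h *: _]mulr1.
exact: cvg_lim hc.
Qed.

End primitive_theory.
End Primitive.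

Section PrimitiveConstructions.
Context {R : realType} {E : completeNormedModType R}.
Context {sepE : separable E}.
Implicit Types (t : R) (x f g : R -> E) (p : dual E).

Let mI (i : interval R) := leb_measurable_itv i.

Lemma primitive_shift t t' x f : t <= t' -> primitive t x f -> primitive t' x f.
Proof.
move=> tt' xf; split.
- have [mf _ _] := xf; apply: smeasS mf => //.
  by apply: subset_itvr; rewrite bnd_simp.
- by move=> T _; exact: (primitive_li xf).
- by move=> s ts p; have [_ _] := primitive_weak_integral (sepE := sepE) xf tt' ts.
Qed.

Lemma primitive_translate t x f (w : E) :
  primitive t x f -> primitive t (fun s => x s + w) f.
Proof. by move=> [mf lf hx]; split => // s ts p; rewrite opprD addrACA subrr addr0 hx. Qed.

Lemma primitive_ae t x f g : ae_from t (fun s => f s = g s) ->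
  primitive t x f -> primitive t x g.
Proof.
move=> fg xf; have [mf lf hx] := xf.
have fgD (i : itv_bound R) : \forall s \ae leb,
    [set` Interval (BLeft t) i]%classic s -> f s = g s.
  rewrite /ae_from in fg; apply: filterS fg => s h /=.
  by rewrite itv_boundlr/= bnd_simp => /andP[/h].
have wg s : t <= s -> weak_integral `[t, s] g (x s - x t).
  move=> ts; have := primitive_weak_integral (sepE := sepE) xf (lexx t) ts.
  exact: (weak_integral_ae (mI _) (fgD (BRight s))).
split.
- exact: (smeas_ae (mI _) (fgD _) mf).
- by move=> T /wg[].
- by move=> s /wg[].
Qed.

Lemma primitive_exists t f (a : E) : smeas `[t, +oo[ f ->
  (forall T, t <= T -> leb_integrable `[t, T] (fun r => `|f r|)) ->
  exists x, primitive t x f /\ x t = a.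
Proof.
move=> mf lf.
have mf' T : smeas `[t, T] f.
  by apply: smeasS mf => //; apply: subset_itvl; rewrite bnd_simp.
have /choice[v hv] : forall s, exists v, t <= s -> weak_integral `[t, s] f v.
  move=> s; have [ts|_] := leP t s; last by exists 0.
  have [v hv] := bochner_integral_exists (sepE := sepE) (mI `[t, s]) (leb_itv_lty t s) (mf' s) (lf _ ts).
  by exists v => _; apply: bochner_weak_integral hv.
have vt : v t = 0.
  apply: dual_separates => p; have [_ _ ->] := hv t (lexx t).
  by rewrite set_itv1 lint_set1 dual0.
exists (fun s => a + v s); split; last by rewrite vt addr0.
split => // s ts p; rewrite vt addr0 addrAC subrr add0r.
by have [_ _] := hv s ts.
Qed.

Lemma smeas_bounded_li a b x f : smeas `[a, b] f ->
  (exists M, forall s, a <= s <= b -> `|f s| <= M) ->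
  leb_integrable `[a, b] (fun r => `|f r|).
Proof.
move=> mf [M hM]; apply: (li_bounded (c := M)).
  exact: smeas_norm.
by move=> s /hM; rewrite normr_id.
Qed.

Lemma primitive_W11loc t x f : primitive t x f -> W11loc t x.
Proof.
move=> xf.
have fe : ae_from t (fun s => f s = derive1 x s).
  have A := primitive_derivable (sepE := sepE) xf; rewrite /ae_from in A *.
  by apply: filterS A => s h /h[].
have xd := primitive_ae fe xf.
split.
- move=> T tT; apply: (bochner_integral_exists (mI _) (leb_itv_lty t T)).
    apply: smeasS (primitive_smeas_self xf) => //.
    by apply: subset_itvl; rewrite bnd_simp.
  apply: (smeas_bounded_li x).
    apply: smeasS (primitive_smeas_self xf) => //.
    by apply: subset_itvl; rewrite bnd_simp.
  exists (`|x t| + lint `[t, T] (fun r => `|f r|)) => s /andP[ts sT].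
  exact: (primitive_bounded xf).
- have A := primitive_derivable (sepE := sepE) xf; rewrite /ae_from in A *.
  by apply: filterS A => s h /h[].
- move=> T tT; apply: (bochner_integral_exists (mI _) (leb_itv_lty t T)).
    exact: (@primitive_smeas _ _ _ _ _ xd _ _ (lexx t)).
  exact: (primitive_li xd).
- move=> s ts; apply: weak_bochner_integral => //; first exact: leb_itv_lty.
  exact: primitive_weak_integral xd _ _ (lexx t) ts.
Qed.

Lemma primitive_affine t (a v : E) : primitive t (fun s => a + (s - t) *: v) (fun=> v).
Proof.
split; first exact: smeas_cst.
  by move=> T _; exact: li_cst.
move=> s ts p; rewrite lint_cst// subrr scale0r addr0 addrAC subrr add0r.
by rewrite dualZ mulrC.
Qed.

Lemma primitive_concat t t' x f z g : t <= t' -> primitive t x f ->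
  primitive t' z g -> z t' = x t' ->
  primitive t (fun s => if s < t' then x s else z s)
    (fun s => if s < t' then f s else g s).
Proof.
move=> tt' xf zg zx.
pose X s := if s < t' then x s else z s; pose F s := if s < t' then f s else g s.
have ae1 b : b <= t' -> \forall s \ae leb, `[t, b]%classic s -> f s = F s.
  move=> bt'; have A := leb_ae_neq t'; apply: filterS A => s st'.
  rewrite /= in_itv/= /F => /andP[_ sb].
  by rewrite lt_neqAle st' (le_trans sb).
have e2 (i : itv_bound R) s : [set` Interval (BLeft t') i] s -> g s = F s.
  by rewrite /= itv_boundlr/= bnd_simp /F => /andP[t's _]; rewrite ltNge t's.
have XE s : s <= t' -> X s = x s.
  by rewrite /X le_eqVlt => /orP[/eqP->|->//]; rewrite ltxx.
have w1 s : t <= s -> s <= t' -> weak_integral `[t, s] F (X s - X t).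
  move=> ts st'; rewrite !XE//; apply: (weak_integral_ae (mI _) (ae1 _ st')).
  exact: (primitive_weak_integral xf (lexx t) ts).
have w2 s : t' <= s -> weak_integral `[t, s] F (X s - X t).
  move=> t's; have [m1 l1 h1] := w1 t' tt' (lexx t').
  have [m2 l2 h2] : weak_integral `[t', s] F (z s - z t').
    apply: (weak_integral_ae (f := g) (mI _)); first by apply: aeW => r; exact: (e2 (BRight s)).
    exact: (primitive_weak_integral zg (lexx t') t's).
  have lF : leb_integrable `[t, s] (fun r => `|F r|) by exact: li_Chasles l1 l2.
  have mF : smeas `[t, s] F.
    move=> e; rewrite /lmf; have -> : `[t, s]%classic = `[t, t']%classic `|` `[t', s]%classic.
      apply/seteqP; split=> r /=; rewrite !in_itv/=.
        by case: (leP r t') => h /andP[-> ->]; [left|right; rewrite ltW].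
      case=> /andP[h3 h4]; apply/andP; split=> //; first exact: le_trans t's.
      exact: le_trans h3.
    by apply/measurable_funU; [exact: mI|exact: mI|split; [exact: m1|exact: m2]].
  split => // p; rewrite (lint_Chasles tt' t's); last exact: dual_comp_li.
  rewrite -h1 -h2 -dualD (XE _ (lexx t')) zx; congr (p _).
  by rewrite {1}/X ltNge t's /= [RHS]addrC subrKA.
have w s : t <= s -> weak_integral `[t, s] F (X s - X t).
  by move=> ts; have [/w1|/ltW/w2] := leP s t'; [exact|].
split.
- by apply: smeas_itv => s /w[].
- by move=> s /w[].
- by move=> s /w[].
Qed.

Lemma primitive_dist2 t x f y g : primitive t x f -> primitive t y g ->
  forall a b, t <= a -> a <= b ->
  leb_integrable `[a, b] (fun r => `|f r - g r|) /\
  `|(x b - y b) - (x a - y a)| <= lint `[a, b] (fun r => `|f r - g r|).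
Proof.
move=> xf yg a b ta ab.
have [m1 l1 h1] := primitive_weak_integral (sepE := sepE) xf ta ab.
have [m2 l2 h2] := primitive_weak_integral (sepE := sepE) yg ta ab.
have mfg : smeas `[a, b] (fun r => f r - g r) by exact: smeasB.
have lfg : leb_integrable `[a, b] (fun r => `|f r - g r|).
  apply: (li_le _ _ _ (liD _ l1 l2)) => //; first exact: smeas_norm.
  by move=> r _; rewrite normr_id ler_normB.
split => //; apply: weak_integral_norm => //; split => // p.
have -> : x b - y b - (x a - y a) = (x b - x a) - (y b - y a).
  by rewrite !opprB addrACA [in RHS]addrACA (addrC (- y b)).
rewrite dualB h1 h2 -lintB//; try exact: dual_comp_li.
by apply: lint_ext => r _; rewrite dualB.
Qed.

Lemma primitive_dist_le t x f y g (S : R -> R) : primitive t x f -> primitive t y g ->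
  x t = y t -> (forall T, t <= T -> leb_integrable `[t, T] S) ->
  (forall r, t <= r -> `|f r - g r| <= S r) ->
  forall s, t <= s -> `|x s - y s| <= lint `[t, s] S.
Proof.
move=> xf yg xy lS fgS s ts.
have [l1] := primitive_dist2 xf yg (lexx t) ts.
rewrite xy subrr subr0 => /le_trans; apply; apply: lint_le => //; first exact: lS.
by move=> r /=; rewrite in_itv/= => /andP[/fgS].
Qed.

End PrimitiveConstructions.

(** * The distance to a nonempty set, as a real number *)

Section Distance.
Context {R : realType} {E : completeNormedModType R}.
Implicit Types (C : set E) (v : E).

Definition dist C v : R := inf [set `|v - c| | c in C].

Section nonempty.
Variable C : set E.
Hypothesis C0 : C !=set0.

Let has_infC v : has_inf [set `|v - c| | c in C].
Proof.
have [c Cc] := C0; split; first by exists `|v - c|, c.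
by exists 0 => _ [? _ <-].
Qed.

Lemma dist_ge0 v : 0 <= dist C v.
Proof. by apply: lb_le_inf; [case: (has_infC v)|move=> _ [? _ <-]]. Qed.

Lemma dist_le v c : C c -> dist C v <= `|v - c|.
Proof. by move=> Cc; apply: ge_inf; [case: (has_infC v)|exists c]. Qed.

Lemma dist_lt v r : dist C v < r -> exists2 c, C c & `|v - c| < r.
Proof. by move=> /(inf_lt (proj1 (has_infC v)))[_ [c Cc <-]] h; exists c. Qed.

Lemma dist_ge v r : (forall c, C c -> r <= `|v - c|) -> r <= dist C v.
Proof. by move=> h; apply: lb_le_inf; [case: (has_infC v)|move=> _ [c /h]h' <-]. Qed.

Lemma dist_lipschitz v w : dist C v <= `|v - w| + dist C w.
Proof.
rewrite -lerBlDl; apply: dist_ge => c Cc; rewrite lerBlDl.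
by apply: le_trans (dist_le _ Cc) _; exact: ler_distD.
Qed.

Lemma dist_continuous : continuous (dist C).
Proof.
move=> v; apply/cvgrPdist_lt => e e0; near=> w.
apply: (@le_lt_trans _ _ `|v - w|).
  rewrite ler_norml; have := dist_lipschitz v w; have := dist_lipschitz w v.
  by rewrite distrC; move: `|v - w| => a h1 h2; apply/andP; split; lra.
by near: w; apply: cvgr_dist_lt; [exact: cvg_id|].
Unshelve. all: by end_near. Qed.

Lemma dist_eq0 v : closed C -> dist C v <= 0 -> C v.
Proof.
move=> cC d0; apply: cC => A /nbhs_ballP[r /= r0 hA].
have [c Cc vc] := dist_lt (le_lt_trans d0 r0).
by exists c; split => //; apply: hA; rewrite -ball_normE.
Qed.

Lemma dist_self v : C v -> dist C v = 0.
Proof.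
by move=> Cv; apply/eqP; rewrite eq_le dist_ge0 andbT (le_trans (dist_le _ Cv))// subrr normr0.
Qed.

Lemma dist_toE v : dist_to C v = (dist C v)%:E.
Proof.
rewrite /dist_to /dist -ereal_inf_EFin.
- by rewrite image_comp.
- by case: (has_infC v).
- by case: (has_infC v).
Qed.

End nonempty.
End Distance.

(** * Differential inclusions and Filippov's theorem *)

Record regular_inclusion (R : realType) (E : completeNormedModType R)
    (Gamma : R -> E -> set E) (gamma : R -> R) : Prop := RegularInclusion {
  inclusion_nonempty : forall (t : R) x, 0 <= t -> Gamma t x !=set0 ;
  inclusion_closed : forall (t : R) x, 0 <= t -> closed (Gamma t x) ;
  inclusion_lsc : forall x, lsc_multifunction (fun t => Gamma t x) ;
  inclusion_bound_ge0 : forall t : R, 0 <= t -> 0 <= gamma t ;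
  inclusion_bound_integrable :
    forall T : R, 0 <= T -> leb_integrable `[0, T] gamma ;
  inclusion_bound0 : forall t : R, 0 <= t -> Gamma t 0 `<=` scaled_ball (gamma t) ;
  inclusion_lipschitz : forall (t : R) x x', 0 <= t ->
    Gamma t x `<=` setplus (Gamma t x') (scaled_ball (gamma t * `|x - x'|)) }.

Section Inclusion.
Context {R : realType} {E : completeNormedModType R} {sepE : separable E}.
Variables (Gamma : R -> E -> set E) (gamma : R -> R).
Hypothesis HG : regular_inclusion Gamma gamma.

Let Gamma_nonempty := inclusion_nonempty HG.
Let Gamma_closed := inclusion_closed HG.
Let Gamma_lsc := inclusion_lsc HG.
Let gamma_ge0 := inclusion_bound_ge0 HG.
Let gamma_locally_integrable := inclusion_bound_integrable HG.
Let Gamma_bound0 := @inclusion_bound0 _ _ _ _ HG.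
Let Gamma_lipschitz := @inclusion_lipschitz _ _ _ _ HG.

Let mI (i : interval R) := leb_measurable_itv i.

Lemma scaled_ball_norm (r : R) (v : E) : 0 <= r -> scaled_ball r v -> `|v| <= r.
Proof.
move=> r0 [b + <-]; rewrite -ball_normE/= sub0r normrN => /ltW b1.
by rewrite normrZ ger0_norm// -[leRHS]mulr1 ler_wpM2l.
Qed.

Lemma Gamma_dist_lipschitz s v x x' : 0 <= s ->
  dist (Gamma s x) v <= dist (Gamma s x') v + gamma s * `|x - x'|.
Proof.
move=> s0; rewrite -lerBlDr; apply: dist_ge => [|c Gc]; first exact: Gamma_nonempty.
have [a Ga [b bb ab]] := @Gamma_lipschitz s x' x s0 c Gc.
have g0 : 0 <= gamma s * `|x' - x| by rewrite mulr_ge0// gamma_ge0.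
have := scaled_ball_norm g0 bb; rewrite (distrC x' x) => bn; rewrite lerBlDr.
apply: le_trans (dist_le (Gamma_nonempty _ s0) _ Ga) _.
apply: le_trans (ler_distD c _ _) _.
by rewrite lerD2l -ab addrAC subrr add0r.
Qed.

Lemma Gamma_growth s x v : 0 <= s -> Gamma s x v -> `|v| <= gamma s * (1 + `|x|).
Proof.
move=> s0 Gv; have [a Ga [b bb <-]] := @Gamma_lipschitz s x 0 s0 v Gv.
have := scaled_ball_norm (gamma_ge0 s0) (Gamma_bound0 s0 Ga).
have g0 : 0 <= gamma s * `|x - 0| by rewrite mulr_ge0// gamma_ge0.
have := scaled_ball_norm g0 bb; rewrite subr0 mulrDr mulr1 => h1 h2.
apply: le_trans (ler_normD _ _) _; exact: lerD.
Qed.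

Lemma Gamma_dist_growth s x v : 0 <= s ->
  dist (Gamma s x) v <= `|v| + gamma s * (1 + `|x|).
Proof.
move=> s0; have [c Gc] := Gamma_nonempty x s0.
apply: le_trans (dist_le (Gamma_nonempty _ s0) _ Gc) _.
apply: le_trans (ler_normB _ _) _; rewrite lerD2l; exact: Gamma_growth.
Qed.

Lemma Gamma_dist_continuous s v : 0 <= s -> continuous (fun x => dist (Gamma s x) v).
Proof.
move=> s0 x; apply/cvgrPdist_lt => e e0.
have g1 : 0 < gamma s + 1 by rewrite ltr_wpDl// gamma_ge0.
near=> w.
apply: (@le_lt_trans _ _ (gamma s * `|x - w|)).
  rewrite ler_norml; have := Gamma_dist_lipschitz v x w s0.
  have := Gamma_dist_lipschitz v w x s0.
  rewrite (distrC w); move: (gamma s * _) (dist _ _) (dist _ _) => a b c h1 h2.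
  by apply/andP; split; lra.
apply: (@le_lt_trans _ _ ((gamma s + 1) * `|x - w|)).
  by rewrite ler_wpM2r// lerDl.
rewrite mulrC -ltr_pdivlMr//.
by near: w; apply: cvgr_dist_lt; [exact: cvg_id|exact: divr_gt0].
Unshelve. all: by end_near. Qed.

(** The distance is below [r] exactly when [Gamma s x] meets the open ball of radius [r] at [v];
    lower semicontinuity makes the set of such [s] relatively open. *)
Lemma lmf_dist_cst x v : lmf `[0, +oo[ (fun s => dist (Gamma s x) v).
Proof.
move=> mD; apply: (measurability _ (RGenInftyO.measurableE R)) => // _ [_ [r ->] <-].
have [U oU hU] := Gamma_lsc x (ball_open v r).
have -> : `[0, +oo[%classic `&` (fun s => dist (Gamma s x) v) @^-1` `]-oo, r[%classic =
    U `&` `[0, +oo[%classic.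
  rewrite -hU; apply/seteqP; split=> s /=; rewrite !in_itv/= ?andbT.
    move=> [s0 /(dist_lt (Gamma_nonempty _ s0))[c Gc vc]]; split => //.
    by exists c; split => //; rewrite -ball_normE.
  move=> [s0 [c [Gc vc]]]; split => //.
  apply: le_lt_trans (dist_le (Gamma_nonempty _ s0) _ Gc) _.
  by move: vc; rewrite -ball_normE.
apply: measurableI; last exact: mI.
by apply: borel_leb_measurable; exact: open_measurable.
Qed.

Lemma lmf_dist (t : R) (y f : R -> E) : 0 <= t ->
  smeas `[t, +oo[ y -> smeas `[t, +oo[ f ->
  lmf `[t, +oo[ (fun s => dist (Gamma s (y s)) (f s)).
Proof.
move=> t0 my mf; have ge0 s : `[t, +oo[%classic s -> 0 <= s.
  by rewrite /= in_itv/= andbT; exact: le_trans.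
apply: (@Caratheodory _ _ _ _ (fun s v => dist (Gamma s (y s)) v)) => //.
  move=> v; apply: (@Caratheodory _ _ _ _ (fun s x => dist (Gamma s x) v)) => //.
    move=> x; apply: lmfS (lmf_dist_cst x v) => //.
    by apply: subset_itvr; rewrite bnd_simp.
  by move=> s /ge0; exact: Gamma_dist_continuous.
by move=> s /ge0 s0; apply: dist_continuous; exact: Gamma_nonempty.
Qed.

Lemma gamma_li (t : R) T : 0 <= t -> leb_integrable `[t, T] gamma.
Proof. by move=> t0; exact: (loc_li_sub gamma_locally_integrable). Qed.

Lemma li_mul_bounded (a b : R) (f h : R -> R) : leb_integrable `[a, b] f ->
  lmf `[a, b] h -> (exists M, forall s, a <= s <= b -> `|h s| <= M) ->
  leb_integrable `[a, b] (fun s => f s * h s).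
Proof.
move=> lf mh [M hM].
apply: (li_le (g := fun s => M * `|f s|)) => //.
- by apply: lmfM => //; exact: li_lmf.
- move=> x /= xab; rewrite normrM mulrC ler_wpM2r//; apply: hM.
  by move: xab; rewrite in_itv.
- by apply: liZ => //; exact: li_norm.
Qed.

Lemma gamma_primitive_li (t T : R) (x f : R -> E) : 0 <= t -> primitive t x f ->
  leb_integrable `[t, T] (fun s => gamma s * (1 + `|x s|)).
Proof.
move=> t0 xf; apply: li_mul_bounded; first exact: gamma_li.
- apply: lmfD; first exact: lmf_cst.
  apply: smeas_norm; apply: smeasS (primitive_smeas_self xf) => //.
  by apply: subset_itvl; rewrite bnd_simp.
- exists (1 + (`|x t| + lint `[t, T] (fun r => `|f r|))) => s /andP[ts sT].
  by rewrite ger0_norm ?addr_ge0// lerD2l; exact: primitive_bounded sT.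
Qed.

Definition trajectory (t : R) (x f : R -> E) : Prop :=
  primitive t x f /\ forall s, t <= s -> Gamma s (x s) (f s).

Section step.
Variables (t : R) (a : E) (eps : R -> R).
Hypothesis t0 : 0 <= t.
Hypothesis meps : lmf `[t, +oo[ eps.
Hypothesis eps0 : forall s, t <= s -> 0 < eps s.
Hypothesis leps : forall T, t <= T -> leb_integrable `[t, T] eps.

(* Countably many values suffice for an approximate selection, so no measurable
   selection theorem is needed. *)
Lemma approximate_selection (x f : R -> E) : primitive t x f ->
  exists y g, [/\ primitive t y g, y t = a &
    forall s, t <= s -> dist (Gamma s (x s)) (g s) <= eps s /\
      `|g s - f s| <= dist (Gamma s (x s)) (f s) + eps s].
Proof.
move=> xf; have [mf lf _] := xf; have [e_ de] := separable_seq sepE.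
have mx := primitive_smeas_self (sepE := sepE) xf.
pose D : set R := `[t, +oo[%classic.
have mD : leb_measurable D by exact: mI.
have Dt s : D s -> t <= s by rewrite /D/= in_itv/= andbT.
have mDg := lmf_dist t0 mx mf.
pose A n := (D `&` [set s | dist (Gamma s (x s)) (e_ n) - eps s < 0]) `&`
  (D `&` [set s | `|f s - e_ n| - (dist (Gamma s (x s)) (f s) + eps s) < 0]).
have [||i [h1 h2]] := @first_index _ A D.
- move=> n; apply: (@measurableI _ (Rleb R)).
    apply: leb_measurable_lt => //; apply: lmfB => //.
    by apply: lmf_dist => //; exact: smeas_cst.
  apply: leb_measurable_lt => //; apply: lmfB; first exact: mf.
  exact: lmfD.
- move=> s Ds; have ts := Dt _ Ds; have s0 := le_trans t0 ts.
  have e20 : 0 < eps s / 2 by rewrite divr_gt0// eps0.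
  have [|c Gc fc] := @dist_lt _ _ _ (Gamma_nonempty (x s) s0) (f s)
    (dist (Gamma s (x s)) (f s) + eps s / 2); first by rewrite ltrDl.
  have [n hn] := de c _ e20; exists n; split; split => //=; rewrite subr_lt0.
    apply: le_lt_trans (dist_le (Gamma_nonempty _ s0) _ Gc) _.
    by rewrite distrC; apply: lt_le_trans hn _; rewrite ger_pMr ?invf_le1// ?eps0// ler1n.
  apply: le_lt_trans (ler_distD c _ _) _.
  by move: fc hn; move: (eps s) (dist _ _) => u v; lra.
pose g s := e_ (i s).
have gG s : t <= s -> dist (Gamma s (x s)) (g s) <= eps s /\
    `|g s - f s| <= dist (Gamma s (x s)) (f s) + eps s.
  move=> ts; have [[_ /=]] : A (i s) s by apply: h1; rewrite /D/= in_itv/= ts.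
  rewrite subr_lt0 => /ltW u1 [_ /=]; rewrite subr_lt0 => /ltW u2; split => //.
  by rewrite distrC.
have mg : smeas D g.
  move=> e; apply: (@lmf_glue _ _ i (fun n _ => `|e_ n - e|)) => //.
  by move=> n; exact: lmf_cst.
have lg T : t <= T -> leb_integrable `[t, T] (fun r => `|g r|).
  move=> tT; have sT : `[t, T]%classic `<=` D by apply: subset_itvl; rewrite bnd_simp.
  apply: (li_le _ _ _ (liD _ (liD _ (liD _ (lf _ tT) (lf _ tT))
    (gamma_primitive_li T t0 xf)) (leps tT))) => //.
    by apply: smeas_norm; exact: smeasS mg.
  move=> s /=; rewrite in_itv/= normr_id => /andP[ts _].
  have [_ h] := gG _ ts; have s0 := le_trans t0 ts.
  rewrite -[in leLHS](subrK (f s) (g s)).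
  apply: le_trans (ler_normD _ _) _.
  have := Gamma_dist_growth (x s) (f s) s0.
  move: h; move: (dist _ _) `|g s - f s| `|f s| (gamma s * _) (eps s) => u1 u2 u3 u4 u5; lra.
have [y [yg ya]] := primitive_exists a mg lg.
by exists y, g.
Qed.

End step.

(** Successive approximation: each new velocity is an approximate selection of [Gamma] along the
    previous iterate. The inequality on [S] makes it a supersolution of the resulting recursion, so
    the velocity changes sum to at most [S]. Velocities then converge pointwise, trajectories
    converge by domination, and closedness of the values of [Gamma] gives the inclusion in the
    limit. *)
Theorem Filippov (t : R) (y g : R -> E) (S eps : R -> R) : 0 <= t ->
  primitive t y g ->
  lmf `[t, +oo[ eps -> (forall s, t <= s -> 0 < eps s) ->
  (forall T, t <= T -> leb_integrable `[t, T] eps) ->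
  (forall T, t <= T -> leb_integrable `[t, T] S) ->
  (forall s, t <= s -> 0 <= S s) ->
  (forall s, t <= s ->
     dist (Gamma s (y s)) (g s) + eps s + gamma s * lint `[t, s] S <= S s) ->
  exists x f, [/\ trajectory t x f, x t = y t &
    forall s, t <= s -> `|f s - g s| <= S s].
Proof.
move=> t0 yg meps eps0 leps lS S0 hS.
(* Passing from iterate [n.+1] to the next one costs [en n], since the current velocity is only
   nearly in [Gamma], and [en n.+1] for the new selection. The factor [2 ^+ n.+3] keeps the sum of
   all these errors below [eps]. *)
pose en n (s : R) := (2 ^+ n.+3)^-1 * eps s.
have en0 n s : t <= s -> 0 < en n s.
  by move=> /eps0 e0; rewrite mulr_gt0// invr_gt0 exprn_gt0.
pose P n (z z' : (R -> E) * (R -> E)) := [/\ primitive t z'.1 z'.2, z'.1 t = y t &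
    forall s, t <= s -> dist (Gamma s (z.1 s)) (z'.2 s) <= en n s /\
      `|z'.2 s - z.2 s| <= dist (Gamma s (z.1 s)) (z.2 s) + en n s].
have /choice[F hF] : forall nz : nat * ((R -> E) * (R -> E)), exists z',
    primitive t nz.2.1 nz.2.2 -> P nz.1 nz.2 z'.
  move=> [n [x f]]; have [xf|nxf] := pselect (primitive t x f); last first.
    by exists (x, f) => /nxf.
  have [||T|x' [f' [h1 h2 h3]]] := approximate_selection (y t) t0 (eps := en n) _ _ _ xf.
  - by apply: lmfM => //; exact: lmf_cst.
  - by move=> s; exact: en0.
  - by move=> /leps ?; apply: liZ.
  by exists (x', f').
pose Z := fix Z n := if n is n'.+1 then F (n', Z n') else (y, g).
have Zp n : primitive t (Z n).1 (Z n).2 /\ (Z n).1 t = y t.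
  by elim: n => [//|n [IH _]]; have [] := hF (n, Z n) IH.
have ZP n : P n (Z n) (Z n.+1) by have [IH _] := Zp n; exact: hF (n, Z n) IH.
pose x_ n := (Z n).1; pose f_ n := (Z n).2.
have xf n : primitive t (x_ n) (f_ n) by have [] := Zp n.
have x_t n : x_ n t = y t by have [] := Zp n.
have {ZP}near_sel n s : t <= s -> dist (Gamma s (x_ n s)) (f_ n.+1 s) <= en n s.
  by move=> ts; have [_ _ /(_ s ts)[]] := ZP n.
have incr n s : t <= s -> `|f_ n.+1 s - f_ n s| <= dist (Gamma s (x_ n s)) (f_ n s) + en n s.
  by move=> ts; have [_ _ /(_ s ts)[]] := hF (n, Z n) (xf n).
pose a n s := `|f_ n.+1 s - f_ n s|.
have la n T : t <= T -> leb_integrable `[t, T] (a n).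
  by move=> tT; have [] := primitive_dist2 (xf n.+1) (xf n) (lexx t) tT.
have xa n s : t <= s -> `|x_ n.+1 s - x_ n s| <= lint `[t, s] (a n).
  have xx : x_ n.+1 t = x_ n t by rewrite !x_t.
  by apply: (primitive_dist_le (xf n.+1) (xf n) xx) => [T|r _]; [exact: la|].
pose A n s := \sum_(k < n) a k s.
have lA n T : t <= T -> leb_integrable `[t, T] (A n).
  by move=> tT; apply: (@li_sum _ _ a) => // k; exact: la.
(* Up to selection errors, the defect of iterate [n.+1] comes only from the displacement of the
   state, which costs [gamma s] times the integral of the last velocity change; summing gives a
   recursion for [A]. *)
have keyA n s : t <= s -> A n.+1 s <= dist (Gamma s (y s)) (g s) +
    (1 - (2 ^+ n.+1)^-1) * eps s + gamma s * lint `[t, s] (A n).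
  move=> ts; have s0 := le_trans t0 ts; have e0 := eps0 _ ts.
  elim: n => [|n IH].
    rewrite /A big_ord1.
    rewrite (_ : lint _ _ = 0); last first.
      by rewrite -[RHS](lint0 `[t, s]); apply: lint_ext => r _; rewrite big_ord0.
    rewrite mulr0 addr0; apply: le_trans (incr 0%N s ts) _.
    rewrite lerD2l /en (ler_wpM2r (ltW e0))//.
    by rewrite expr1 !exprS expr0; lra.
  rewrite /A big_ord_recr/= -/(A n.+1 s).
  have h1 := incr n.+1 s ts.
  have h2 := Gamma_dist_lipschitz (f_ n.+1 s) (x_ n.+1 s) (x_ n s) s0.
  have h3 := near_sel n s ts.
  have h4 := ler_wpM2l (gamma_ge0 s0) (xa n s ts).
  have -> : lint `[t, s] (fun s => \sum_(k < n.+1) a k s) =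
      lint `[t, s] (A n) + lint `[t, s] (a n).
    rewrite -lintD//; [|exact: lA|exact: la].
    by apply: lint_ext => r _; rewrite big_ord_recr.
  rewrite -/(a n.+1 s) in h1; rewrite mulrDr.
  have h5 : en n s + en n.+1 s <=
      ((1 - (2 ^+ n.+2)^-1) - (1 - (2 ^+ n.+1)^-1)) * eps s.
    rewrite /en -mulrDl; apply: (ler_wpM2r (ltW e0)); rewrite !exprS !invfM.
    have : 0 <= (2 ^+ n)^-1 :> R by rewrite invr_ge0 exprn_ge0.
    by move: (2 ^+ n)^-1 => u; lra.
  rewrite mulrBl in h5.
  set D1 := dist (Gamma s (x_ n.+1 s)) (f_ n.+1 s) in h1 h2.
  set D2 := dist (Gamma s (x_ n s)) (f_ n.+1 s) in h2 h3.
  set G1 := gamma s * `|x_ n.+1 s - x_ n s| in h2 h4.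
  set G2 := gamma s * lint `[t, s] (a n) in h4 *.
  set G3 := gamma s * lint `[t, s] (A n) in IH *.
  set D0 := dist (Gamma s (y s)) (g s) in IH *.
  set c1 := (1 - (2 ^+ n.+1)^-1) * eps s in IH h5.
  set c2 := (1 - (2 ^+ n.+2)^-1) * eps s in h5 *.
  move: IH h1 h2 h3 h4 h5; move: D1 D2 G1 G2 G3 D0 c1 c2.
  by move: (A n.+1 s) (a n.+1 s) (en n s) (en n.+1 s) => *; lra.
(* By induction [A n] may be replaced by [S] on the right of [keyA], which the supersolution
   inequality then bounds by [S s]. *)
have AS n s : t <= s -> A n s <= S s.
  elim: n s => [|n IH] s ts; have s0 := le_trans t0 ts.
    by rewrite /A big_ord0 S0.
  apply: le_trans (keyA n s ts) _; apply: le_trans (hS _ ts); apply: lerD.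
    rewrite lerD2l ler_piMl ?(ltW (eps0 _ ts))// gerBl invr_ge0 exprn_ge0//.
  apply: ler_wpM2l; first exact: gamma_ge0.
  apply: lint_le => //; [exact: lA|exact: lS|].
  by move=> r /=; rewrite in_itv/= => /andP[/IH].
have fnE n s : f_ n s = g s + series (fun k => f_ k.+1 s - f_ k s) n.
  elim: n => [|n IH]; first by rewrite /series/= big_geq// addr0.
  by rewrite seriesS addrCA -IH subrK.
have distg n s : t <= s -> `|f_ n s - g s| <= S s.
  move=> ts; rewrite fnE addrAC subrr add0r; apply: le_trans (AS n s ts).
  by rewrite /series/= big_mkord; exact: ler_norm_sum.
have cvf s : t <= s -> cvgn (fun n => f_ n s).
  move=> ts; have : cvgn (series (fun k => f_ k.+1 s - f_ k s)).
    apply: normed_cvg.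
    have -> : [normed series (fun k => f_ k.+1 s - f_ k s)] = fun n => A n s.
      by apply/funext => n; rewrite /A -(big_mkord xpredT (a ^~ s)).
    apply: nondecreasing_is_cvgn.
      by apply/nondecreasing_seqP => n; rewrite /A [leRHS]big_ord_recr/= lerDl /a.
    by exists (S s) => _ [n _ <-]; exact: AS.
  move=> /cvg_ex[l hl]; apply/cvg_ex; exists (g s + l).
  under eq_fun do rewrite fnE.
  by apply: cvgD => //; exact: cvg_cst.
pose f s := limn (fun n => f_ n s).
have fl s : t <= s -> f_ n s @[n --> \oo] --> f s by exact: cvf.
have fg s : t <= s -> `|f s - g s| <= S s.
  move=> ts; have c : `|f_ n s - g s| @[n --> \oo] --> `|f s - g s|.
    by apply: cvg_norm; apply: cvgB; [exact: fl|exact: cvg_cst].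
  by apply: (limr_le_near c) || apply: (cvgr_to_le c); apply: nearW => n; exact: distg.
have Dt s : `[t, +oo[%classic s -> t <= s by rewrite /= in_itv/= andbT.
have mf : smeas `[t, +oo[ f.
  apply: (@smeas_cvg _ _ _ f_) => [n|s /Dt]; last exact: fl.
  by have [] := xf n.
have lf T : t <= T -> leb_integrable `[t, T] (fun r => `|f r|).
  move=> tT; apply: (li_le _ _ _ (liD _ (primitive_li yg T (lexx t)) (lS _ tT))) => //.
    by apply: smeas_norm; apply: smeasS mf => //; apply: subset_itvl; rewrite bnd_simp.
  move=> s /=; rewrite in_itv/= normr_id => /andP[ts _].
  by rewrite -[in leLHS](subrK (g s) (f s)) addrC (le_trans (ler_normD _ _))// lerD2l fg.
have [x [xf0 xt]] := primitive_exists (y t) mf lf.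
have cx s : t <= s -> `|x_ n s - x s| @[n --> \oo] --> (0 : R).
  move=> ts; have sub : `[t, s]%classic `<=` `[t, +oo[%classic.
    by apply: subset_itvl; rewrite bnd_simp.
  have [||||_ _ c] := @lint_dominated _ `[t, s] (fun n r => `|f_ n r - f r|)
    (fun=> 0) (fun r => 2 * S r) (mI _).
  - move=> n; apply: smeas_norm; apply: smeasB => //.
      exact: (@primitive_smeas _ _ _ _ _ (xf n) _ _ (lexx t)).
    exact: smeasS mf.
  - move=> r /sub/Dt tr; apply/norm_cvg0P.
    rewrite -[X in _ --> X](subrr (f r)); apply: cvgB; [exact: fl|exact: cvg_cst].
  - by apply: liZ => //; exact: lS.
  - move=> n r /sub/Dt tr; rewrite normr_id; apply: le_trans (ler_distD (g r) _ _) _.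
    by have := distg n r tr; have := fg r tr; rewrite (distrC (g r)); lra.
  rewrite lint0 in c; apply: squeeze_cvgr c; last exact: cvg_cst.
  apply: nearW => n; rewrite normr_ge0/=.
  have [_] := primitive_dist2 (xf n) xf0 (lexx t) ts.
  by rewrite x_t xt subrr subr0.
exists x, f; split => //; split => // s ts; have s0 := le_trans t0 ts.
apply: dist_eq0; [exact: Gamma_nonempty|exact: Gamma_closed|].
apply/ler_addgt0Pl => e e0; rewrite addr0.
have e3 : 0 < e / 3 by rewrite divr_gt0.
have g1 : 0 < gamma s + 1 by rewrite ltr_wpDl// gamma_ge0.
have c1 : \forall n \near \oo, `|f s - f_ n.+1 s| < e / 3.
  have [N _ hN] : \forall n \near \oo, `|f s - f_ n s| < e / 3.
    by have /cvgrPdist_lt := fl s ts; apply.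
  by exists N => // n Nn; apply: hN => /=; exact: leqW.
have c2 : \forall n \near \oo, `|x_ n s - x s| < e / 3 / (gamma s + 1).
  have /cvgrPdist_lt/(_ _ (divr_gt0 e3 g1)) := cx s ts; apply: filterS => n.
  by rewrite sub0r normrN normr_id.
have c3 : \forall n \near \oo, en n s < e / 3.
  have e1 : 0 < e / 3 / eps s by rewrite divr_gt0// eps0.
  near=> n; have hn : n.+1%:R^-1 < e / 3 / eps s.
    by near: n; exact: near_infty_natSinv_lt (PosNum e1).
  apply: (@le_lt_trans _ _ (n.+1%:R^-1 * eps s)); last by rewrite -ltr_pdivlMr// eps0.
  rewrite /en ler_wpM2r ?(ltW (eps0 _ ts))// lef_pV2 ?posrE ?exprn_gt0 ?ltr0n//.
  by rewrite -natrX ler_nat; apply: leq_trans (ltnW (ltn_expl n.+3 (ltnSn 1))); rewrite ltnW.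
near \oo => n.
apply: le_trans (dist_lipschitz (Gamma_nonempty _ s0) _ (f_ n.+1 s)) _.
have h1 : `|f s - f_ n.+1 s| < e / 3 by near: n.
have h2 : `|x_ n s - x s| < e / 3 / (gamma s + 1) by near: n.
have h3 : en n s < e / 3 by near: n.
have h4 := Gamma_dist_lipschitz (f_ n.+1 s) (x s) (x_ n s) s0.
have h5 := near_sel n s ts.
have h6 : gamma s * `|x s - x_ n s| <= e / 3.
  rewrite distrC; move: h2; rewrite ltr_pdivlMr// mulrC => /ltW; apply: le_trans.
  by rewrite ler_wpM2r// lerDl.
move: h1 h3 h4 h5 h6; move: (dist _ _) (dist _ _) `|_| (gamma s * _) (en n s).
by move=> *; lra.
Unshelve. all: by end_near. Qed.

End Inclusion.

(** * Tracking, growth and concatenation of trajectories *)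

Section Trajectories.
Context {R : realType} {E : completeNormedModType R} {sepE : separable E}.
Variables (Gamma : R -> E -> set E) (gamma : R -> R).
Hypothesis HG : regular_inclusion Gamma gamma.

Let mI (i : interval R) := leb_measurable_itv i.
Let gamma_ge0 := inclusion_bound_ge0 HG.

Lemma gamma_lint_ge0 (t s : R) : 0 <= t -> 0 <= lint `[t, s] gamma.
Proof.
move=> t0; apply: lint_ge0 => x /=; rewrite in_itv/= => /andP[tx _].
by apply: gamma_ge0; exact: le_trans tx.
Qed.

Lemma gamma_lint_le (t s : R) : 0 <= t -> lint `[t, s] gamma <= lint `[0, s] gamma.
Proof.
move=> t0; apply: (@lint_ge0_le _ 0) => //.
exact: inclusion_bound_integrable HG.
Qed.

(** [Filippov] with the explicit supersolution [r s + gamma s * Z s]. Its integral is at most [Z s]: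
    since the integral of [r] is nondecreasing it can be pulled out, and what remains is
    [lint_expR_le]. *)
Lemma tracking (t : R) (y g : R -> E) (r eps : R -> R) : 0 <= t ->
  primitive t y g ->
  lmf `[t, +oo[ eps -> (forall s, t <= s -> 0 < eps s) ->
  (forall T, t <= T -> leb_integrable `[t, T] eps) ->
  (forall T, t <= T -> leb_integrable `[t, T] r) ->
  (forall s, t <= s -> dist (Gamma s (y s)) (g s) + eps s <= r s) ->
  let Z s := expR (lint `[t, s] gamma) * lint `[t, s] r in
  exists x f, [/\ trajectory Gamma t x f, x t = y t,
    forall s, t <= s -> `|f s - g s| <= r s + gamma s * Z s,
    forall s, t <= s -> leb_integrable `[t, s] (fun q => `|f q - g q|) &
    forall s, t <= s -> lint `[t, s] (fun q => `|f q - g q|) <= Z s /\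
      `|x s - y s| <= Z s].
Proof.
move=> t0 yg meps eps0 leps lr hr Z.
have r0 s : t <= s -> 0 <= r s.
  move=> ts; apply: le_trans (hr s ts); rewrite addr_ge0 ?(ltW (eps0 _ ts))//.
  by apply: dist_ge0; apply: (inclusion_nonempty HG); exact: le_trans ts.
have g0 s : t <= s -> 0 <= gamma s by move=> ts; apply: gamma_ge0; exact: le_trans ts.
have lg T : t <= T -> leb_integrable `[t, T] gamma.
  by move=> _; exact: (gamma_li HG).
have Z0 s : t <= s -> 0 <= Z s.
  move=> ts; rewrite mulr_ge0 ?expR_ge0//; apply: lint_ge0 => q /=.
  by rewrite in_itv/= => /andP[/r0].
have hZ : {in `[t, +oo[ &, {homo Z : x y / x <= y}}.
  move=> a b ta tb ab; apply: ler_pM.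
  - exact: expR_ge0.
  - by apply: lint_ge0 => q /=; rewrite in_itv/= => /andP[/r0].
  - exact: (expR_lint_homo g0 lg ta tb ab).
  - exact: (lint_homo r0 lr ta tb ab).
have lgZ := li_gamma_homo g0 lg hZ Z0.
pose S s := r s + gamma s * Z s.
have lS T : t <= T -> leb_integrable `[t, T] S.
  by move=> tT; apply: liD => //; [exact: lr|exact: lgZ].
have SZ s : t <= s -> lint `[t, s] S <= Z s.
  move=> ts; rewrite (lintD (mI _) (lr _ ts) (lgZ _ ts)).
  have lge : leb_integrable `[t, s] (fun q => gamma q * expR (lint `[t, q] gamma)).
    by apply: (li_gamma_homo g0 lg (expR_lint_homo g0 lg)) => [q _|]; [exact: expR_ge0|].
  have P0 : 0 <= lint `[t, s] r.
    by apply: lint_ge0 => q /=; rewrite in_itv/= => /andP[/r0].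
  apply: (@le_trans _ _ (lint `[t, s] r + lint `[t, s] r *
      lint `[t, s] (fun q => gamma q * expR (lint `[t, q] gamma)))).
    rewrite lerD2l -(lintZ _ (mI _) lge).
    apply: (lint_le (mI _) (lgZ _ ts) (liZ _ (mI _) lge)).
    move=> q /=; rewrite in_itv/= => /andP[tq qs].
    rewrite /Z mulrA mulrC; apply: ler_wpM2r.
      by rewrite mulr_ge0 ?expR_ge0 ?g0.
    by apply: (lint_homo r0 lr _ _ qs); rewrite in_itv/= ?tq ?ts.
  rewrite -[X in X + _]mulr1 -mulrDr /Z mulrC.
  exact: ler_wpM2r P0 _ _ (lint_expR_le g0 lg ts).
have [x [f [tx xt fg]]] : exists x f, [/\ trajectory Gamma t x f, x t = y t &
    forall s, t <= s -> `|f s - g s| <= S s].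
  apply: (Filippov HG t0 yg meps eps0 leps lS).
    by move=> s ts; rewrite addr_ge0 ?r0// mulr_ge0 ?g0 ?Z0.
  move=> s ts; apply: lerD; first exact: hr.
  by apply: ler_wpM2l; [exact: g0|exact: SZ].
have [xf _] := tx.
exists x, f; split => // s ts.
  by have [] := primitive_dist2 xf yg (lexx t) ts.
split; last exact: le_trans (primitive_dist_le xf yg xt lS fg ts) (SZ _ ts).
apply: le_trans (SZ s ts); apply: lint_le => //.
- by have [] := primitive_dist2 xf yg (lexx t) ts.
- exact: lS.
- by move=> q /=; rewrite in_itv/= => /andP[/fg].
Qed.

Lemma trajectory_velocity t x f s : 0 <= t -> trajectory Gamma t x f -> t <= s ->
  `|f s| <= gamma s * (1 + `|x s|).
Proof.
move=> t0 [_ xf] ts; apply: (Gamma_growth HG); first exact: le_trans ts.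
exact: xf.
Qed.

(** [Gronwall] for [1 + |x|]; this quantity satisfies a homogeneous inequality because the velocity
    is bounded by [gamma s] times it. *)
Lemma trajectory_growth t x f s : 0 <= t -> trajectory Gamma t x f -> t <= s ->
  1 + `|x s| <= (1 + `|x t|) * expR (lint `[t, s] gamma).
Proof.
move=> t0 tx ts; have [xf _] := tx.
have g0 q : t <= q -> 0 <= gamma q by move=> tq; apply: gamma_ge0; exact: le_trans tq.
have lg T : t <= T -> leb_integrable `[t, T] gamma.
  by move=> _; exact: (gamma_li HG).
apply: (Gronwall g0 lg (w := fun s => 1 + `|x s|) ts).
- by move=> q _; rewrite addr_ge0// ler01.
- exists (1 + (`|x t| + lint `[t, s] (fun r => `|f r|))) => q /andP[tq qs].
  by rewrite lerD2l; exact: (primitive_bounded xf tq qs).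
- exact: (gamma_primitive_li HG _ t0 xf).
- move=> q /andP[tq qs]; rewrite -addrA lerD2l -lerBlDl.
  apply: le_trans (ler_norm _) _; apply: le_trans (ler_dist_dist _ _) _.
  apply: le_trans (primitive_dist xf (lexx t) tq) _.
  apply: lint_le => //.
  + exact: (primitive_li xf q (lexx t)).
  + exact: (gamma_primitive_li HG _ t0 xf).
  + by move=> u /=; rewrite in_itv/= => /andP[tu _]; exact: trajectory_velocity t0 tx tu.
- by rewrite ts lexx.
Qed.

Lemma trajectory_admissible t x f : 0 <= t -> trajectory Gamma t x f ->
  admissible Gamma t (x t) x /\ ae_from t (fun s => derive1 x s = f s).
Proof.
move=> t0 [xf gf].
have A : ae_from t (fun s => derive1 x s = f s).
  have A := primitive_derivable (sepE := sepE) xf; rewrite /ae_from in A *.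
  by apply: filterS A => s h /h[].
split => //; split => //; first exact: primitive_W11loc xf.
rewrite /ae_from in A *; apply: filterS A => s h ts.
by rewrite h//; exact: gf.
Qed.

(** On the null set where [derive1 x] violates the inclusion, [f] takes an arbitrary element of the
    nonempty set [Gamma s (x s)]. *)
Lemma admissible_trajectory t a x : 0 <= t -> admissible Gamma t a x ->
  exists f, [/\ trajectory Gamma t x f, x t = a & ae_from t (fun s => derive1 x s = f s)].
Proof.
move=> t0 [xW xG xa].
pose f s := if `[< Gamma s (x s) (derive1 x s) >] then derive1 x s
  else xget 0 (Gamma s (x s)).
have A : ae_from t (fun s => derive1 x s = f s).
  rewrite /ae_from in xG *; apply: filterS xG => s h /h hG.
  by rewrite /f asboolT.
exists f; split => //; split.
  exact: primitive_ae A (W11loc_primitive xW).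
move=> s ts; rewrite /f; case: asboolP => // _.
have [v Gv] := inclusion_nonempty HG (x s) (le_trans t0 ts).
by case: xgetP => [y _ //|/(_ v)].
Qed.

Lemma trajectory_shift t t' x f : t <= t' -> trajectory Gamma t x f ->
  trajectory Gamma t' x f.
Proof.
move=> tt' [xf gf]; split; first exact: primitive_shift tt' xf.
by move=> s t's; apply: gf; exact: le_trans t's.
Qed.

Lemma trajectory_concat t t' x f z g : t <= t' -> trajectory Gamma t x f ->
  trajectory Gamma t' z g -> z t' = x t' ->
  trajectory Gamma t (fun s => if s < t' then x s else z s)
    (fun s => if s < t' then f s else g s).
Proof.
move=> tt' [xf gf] [zg gg] zx; split; first exact: primitive_concat zg zx.
by move=> s ts; case: ltP => st'; [exact: gf|exact: gg].
Qed.

End Trajectories.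

(** * The value function *)

Record regular_cost (R : realType) (E : completeNormedModType R)
    (L : R -> E -> E -> \bar R) (l1 l2 gamma : R -> R) : Prop := RegularCost {
  cost_measurable : forall x y, leb_measurable_fun `[0, +oo[ (fun t => L t x y) ;
  cost_l1_ge0 : forall t : R, 0 <= t -> 0 <= l1 t ;
  cost_l1_integrable : leb_integrable `[0, +oo[ l1 ;
  cost_l2_ge0 : forall t : R, 0 <= t -> 0 <= l2 t ;
  cost_l2_bounded : forall T : R, exists M, forall t : R, 0 <= t <= T -> l2 t <= M ;
  cost_l2_integrable : leb_integrable `[0, +oo[ l2 ;
  cost_bound0 : forall t : R, 0 <= t -> (`|L t 0%R 0%R| <= (l1 t)%:E)%E ;
  cost_lipschitz : forall (t : R) x y x' y', 0 <= t ->
    (`|L t x y - L t x' y'| <= (l1 t * `|x - x'| + l2 t * `|y - y'|)%:E)%E ;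
  cost_growth :
    let Gint s := fine (leb_integral `[0, s] (fun tau => (gamma tau)%:E)) in
    (leb_integral `[0%R, +oo[ (fun s =>
       (expR (Gint s) * (1 + Gint s) * (l1 s + l2 s * gamma s))%R%:E) < +oo)%E }.

Section Value.
Context {R : realType} {E : completeNormedModType R} {sepE : separable E}.
Variables (L : R -> E -> E -> \bar R) (Gamma : R -> E -> set E).
Variables (l1 l2 gamma : R -> R).
Hypothesis HG : regular_inclusion Gamma gamma.
Hypothesis HL : regular_cost L l1 l2 gamma.
Hypothesis Hadm : forall (t : R) xi, 0 <= t -> exists x, admissible Gamma t xi x.

Let mI (i : interval R) := leb_measurable_itv i.
Let gamma_ge0 := inclusion_bound_ge0 HG.
Let l1_ge0 := cost_l1_ge0 HL.
Let l2_ge0 := cost_l2_ge0 HL.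

Definition Lfin (s : R) (x v : E) : R := fine (L s x v).

Lemma LE s x v : 0 <= s -> L s x v = (Lfin s x v)%:E.
Proof.
move=> s0; rewrite fineK//.
have := cost_lipschitz HL x v 0 0 s0; have := cost_bound0 HL s0.
by case: (L s 0 0) => [r _| |]; case: (L s x v) => [r'| |].
Qed.

Lemma Lfin_lipschitz s x v x' v' : 0 <= s ->
  `|Lfin s x v - Lfin s x' v'| <= l1 s * `|x - x'| + l2 s * `|v - v'|.
Proof.
by move=> s0; have := cost_lipschitz HL x v x' v' s0; rewrite !LE// -EFinB lee_fin.
Qed.

Lemma Lfin_bound s x v : 0 <= s -> `|Lfin s x v| <= l1 s * (1 + `|x|) + l2 s * `|v|.
Proof.
move=> s0; have := Lfin_lipschitz x v 0 0 s0; rewrite !subr0 => h.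
have := cost_bound0 HL s0; rewrite LE// lee_fin => h0.
rewrite -[in leLHS](subrK (Lfin s 0 0) (Lfin s x v)).
apply: le_trans (ler_normD _ _) _; rewrite mulrDr mulr1.
by rewrite -addrA addrC; exact: lerD.
Qed.

Lemma Lfin_continuous_state s v : 0 <= s -> continuous (fun x => Lfin s x v).
Proof.
move=> s0 x; apply/cvgrPdist_lt => e e0.
have g1 : 0 < l1 s + 1 by rewrite ltr_wpDl// l1_ge0.
near=> y; have := Lfin_lipschitz x v y v s0.
rewrite subrr normr0 mulr0 addr0 => /le_lt_trans; apply.
apply: (@le_lt_trans _ _ ((l1 s + 1) * `|x - y|)); first by rewrite ler_wpM2r// lerDl.
rewrite mulrC -ltr_pdivlMr//.
by near: y; apply: cvgr_dist_lt; [exact: cvg_id|exact: divr_gt0].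
Unshelve. all: by end_near. Qed.

Lemma Lfin_continuous_velocity s x : 0 <= s -> continuous (Lfin s x).
Proof.
move=> s0 v; apply/cvgrPdist_lt => e e0.
have g1 : 0 < l2 s + 1 by rewrite ltr_wpDl// l2_ge0.
near=> w; have := Lfin_lipschitz x v x w s0.
rewrite subrr normr0 mulr0 add0r => /le_lt_trans; apply.
apply: (@le_lt_trans _ _ ((l2 s + 1) * `|v - w|)); first by rewrite ler_wpM2r// lerDl.
rewrite mulrC -ltr_pdivlMr//.
by near: w; apply: cvgr_dist_lt; [exact: cvg_id|exact: divr_gt0].
Unshelve. all: by end_near. Qed.

Lemma lmf_Lfin_cst (x v : E) : lmf `[0, +oo[ (fun s => Lfin s x v).
Proof.
apply/measurable_EFinP.
apply: eq_measurable_fun (cost_measurable HL x v) => s.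
by rewrite inE /= in_itv/= andbT => s0; rewrite LE.
Qed.

Lemma lmf_Lfin (t : R) (x f : R -> E) : 0 <= t ->
  smeas `[t, +oo[ x -> smeas `[t, +oo[ f ->
  lmf `[t, +oo[ (fun s => Lfin s (x s) (f s)).
Proof.
move=> t0 mx mf; have ge0 s : `[t, +oo[%classic s -> 0 <= s.
  by rewrite /= in_itv/= andbT; exact: le_trans.
apply: (@Caratheodory _ _ _ _ (fun s v => Lfin s (x s) v)) => //.
  move=> v; apply: (@Caratheodory _ _ _ _ (fun s x => Lfin s x v)) => //.
    move=> y; apply: lmfS (lmf_Lfin_cst y v) => //.
    by apply: subset_itvr; rewrite bnd_simp.
  by move=> s /ge0; exact: Lfin_continuous_state.
by move=> s /ge0; exact: Lfin_continuous_velocity.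
Qed.

Definition Gint s : R := lint `[0, s] gamma.
(** The integrand of (g). Up to the factor [1 + |x t|] it dominates the cost along every trajectory
    starting at time [t] ([lagrangian_bound]). *)
Definition Phi s : R := expR (Gint s) * (1 + Gint s) * (l1 s + l2 s * gamma s).

Lemma Gint_ge0 s : 0 <= Gint s. Proof. exact: (gamma_lint_ge0 HG). Qed.

Lemma Phi_ge0 s : 0 <= s -> 0 <= Phi s.
Proof.
move=> s0; rewrite mulr_ge0 ?mulr_ge0 ?expR_ge0 ?addr_ge0 ?Gint_ge0 ?l1_ge0//.
by rewrite mulr_ge0 ?l2_ge0 ?gamma_ge0.
Qed.

Lemma lmf_gamma : lmf `[0, +oo[ gamma.
Proof. by apply: lmf_ray => T T0; apply/li_lmf/(inclusion_bound_integrable HG). Qed.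

Lemma Gint_homo : {in `[0, +oo[ &, {homo Gint : x y / x <= y}}.
Proof. exact: (lint_homo gamma_ge0 (inclusion_bound_integrable HG)). Qed.

Lemma Phi_integrable : leb_integrable `[0, +oo[ Phi.
Proof.
have mG : lmf `[0, +oo[ Gint by apply: lmf_nondecreasing; exact: Gint_homo.
apply: li_intro.
  apply: lmfM.
    apply: lmfM; last by apply: lmfD mG; exact: lmf_cst.
    by apply: lmf_comp mG; exact: measurable_expR.
  apply: lmfD; first exact: li_lmf (cost_l1_integrable HL).
  by apply: lmfM lmf_gamma; exact: li_lmf (cost_l2_integrable HL).
have := cost_growth HL; congr (_ < _)%E; apply: eq_integral => s.
rewrite inE /= in_itv/= andbT => s0; congr EFin.
have -> : fine (leb_integral `[0, s] (fun tau => (gamma tau)%:E)) = Gint s.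
  by rewrite lintE//; exact: inclusion_bound_integrable HG _ s0.
by rewrite ger0_norm// Phi_ge0.
Qed.

Lemma ray_sub (t : R) : 0 <= t -> `[t, +oo[%classic `<=` `[0, +oo[%classic.
Proof. by move=> t0; apply: subset_itvr; rewrite bnd_simp. Qed.

Definition lagrangian (x f : R -> E) (s : R) : R := Lfin s (x s) (f s).

Definition J (t : R) (x f : R -> E) : R := lint `[t, +oo[ (lagrangian x f).

Lemma lagrangian_bound t x f s : 0 <= t -> trajectory Gamma t x f -> t <= s ->
  `|lagrangian x f s| <= (1 + `|x t|) * Phi s.
Proof.
move=> t0 tx ts; have s0 := le_trans t0 ts.
apply: le_trans (Lfin_bound _ _ s0) _.
have h1 := trajectory_velocity HG t0 tx ts.
have h2 := trajectory_growth (sepE := sepE) HG t0 tx ts.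
have h3 : expR (lint `[t, s] gamma) <= expR (Gint s).
  by rewrite ler_expR; exact: (gamma_lint_le HG).
apply: (@le_trans _ _ ((1 + `|x s|) * (l1 s + l2 s * gamma s))).
  rewrite [leRHS]mulrDr [l1 s * _]mulrC lerD2l (mulrC (1 + `|x s|)) -mulrA.
  by apply: ler_wpM2l; [exact: l2_ge0|exact: h1].
rewrite /Phi [leRHS]mulrA; apply: ler_wpM2r.
  by rewrite addr_ge0 ?l1_ge0// mulr_ge0 ?l2_ge0 ?gamma_ge0.
apply: le_trans h2 _; rewrite ler_wpM2l ?addr_ge0//.
apply: le_trans h3 _; rewrite ler_peMr ?expR_ge0//.
by rewrite lerDl Gint_ge0.
Qed.

Lemma lagrangian_lmf t x f : 0 <= t -> primitive t x f -> lmf `[t, +oo[ (lagrangian x f).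
Proof.
move=> t0 xf; apply: lmf_Lfin => //; first exact: primitive_smeas_self xf.
by case: xf.
Qed.

Lemma lagrangian_li t x f : 0 <= t -> trajectory Gamma t x f ->
  leb_integrable `[t, +oo[ (lagrangian x f).
Proof.
move=> t0 tx; apply: (li_le (g := fun s => (1 + `|x t|) * Phi s)) => //.
- by apply: lagrangian_lmf => //; case: tx.
- by move=> s /=; rewrite in_itv/= andbT; exact: lagrangian_bound.
- apply: liZ => //; apply: liS Phi_integrable => //; exact: ray_sub.
Qed.

Lemma lagrangian_li_itv t x f a b : 0 <= t -> trajectory Gamma t x f -> t <= a ->
  leb_integrable `[a, b] (lagrangian x f).
Proof.
move=> t0 tx ta; apply: liS (lagrangian_li t0 tx) => //.
by apply: subset_itv; rewrite bnd_simp.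
Qed.

(** The cost is absolutely integrable along a trajectory, so the improper integral exists and equals
    the Lebesgue integral over the ray. *)
Lemma is_costP t x f l : 0 <= t -> trajectory Gamma t x f ->
  ae_from t (fun s => derive1 x s = f s) ->
  is_cost L t x l <-> l = (J t x f)%:E.
Proof.
move=> t0 tx xf.
pose ell s := Lfin s (x s) (derive1 x s).
have Lell s : t <= s -> L s (x s) (derive1 x s) = (ell s)%:E.
  by move=> ts; rewrite LE//; exact: le_trans ts.
have aeD (T : R) : \forall s \ae leb, `[t, T]%classic s -> lagrangian x f s = ell s.
  rewrite /ae_from in xf; apply: filterS xf => s h /=; rewrite in_itv/= => /andP[ts _].
  by rewrite /ell h.
have lell T : leb_integrable `[t, T] ell.
  by apply: (li_ae (mI _) (aeD T)); exact: (lagrangian_li_itv _ t0 tx).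
have iL T : leb_integral `[t, T] (fun s => L s (x s) (derive1 x s)) =
    (lint `[t, T] (lagrangian x f))%:E.
  rewrite (lint_ae (mI _) (aeD T)); last exact: (lagrangian_li_itv _ t0 tx).
  rewrite -lintE//; apply: eq_integral => s; rewrite inE /= in_itv/= => /andP[ts _].
  exact: Lell.
have cJ : (fun T => leb_integral `[t, T] (fun s => L s (x s) (derive1 x s))) @ +oo%R
    --> (J t x f)%:E.
  apply: cvg_EFin; first by apply: nearW => T; rewrite iL.
  apply: cvg_trans (lint_ray_cvg (lagrangian_li t0 tx)).
  by apply: near_eq_cvg; apply: nearW => T; rewrite /= iL.
split=> [[_ cl]|->]; first exact: (cvg_unique _ cl cJ).
split => // T tT; have lT : leb.-integrable (`[t, T]%classic : set (Rleb R))
    (fun s => L s (x s) (derive1 x s)).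
  apply: eq_integrable (lell T) => //; first exact: mI.
  by move=> s; rewrite inE /= in_itv/= => /andP[ts _]; rewrite Lell.
split; first by have /integrableP[] := lT.
by left; have := integral_funepos_lt_pinfty (mI _) lT; exact.
Qed.

(** * Finiteness of the value function and dynamic programming *)

Definition V (t : R) (a : E) : R := fine (value L Gamma t a).

Let costs (t : R) (a : E) : set R :=
  [set r | exists x f, [/\ trajectory Gamma t x f, x t = a & r = J t x f]].

Lemma value_costs t a : 0 <= t -> value L Gamma t a = ereal_inf [set r%:E | r in costs t a].
Proof.
move=> t0; congr ereal_inf; apply/seteqP; split=> [l [x adx cx]|_ [r [x [f [tx xa ->]]] <-]].
  have [f [tx xa xf]] := admissible_trajectory (sepE := sepE) HG t0 adx.
  by exists (J t x f); [exists x, f|apply/esym/(is_costP _ t0 tx xf)].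
have [adx xf] := trajectory_admissible (sepE := sepE) t0 tx.
by exists x; [rewrite -xa|apply/(is_costP _ t0 tx xf)].
Qed.

Lemma J_ge t x f : 0 <= t -> trajectory Gamma t x f ->
  - ((1 + `|x t|) * lint `[0, +oo[ Phi) <= J t x f.
Proof.
move=> t0 tx; have lP := liS (mI _) (mI `[t, +oo[) (ray_sub t0) Phi_integrable.
have h : `|J t x f| <= (1 + `|x t|) * lint `[0, +oo[ Phi.
  apply: le_trans (lint_norm (mI _) (lagrangian_li t0 tx)) _.
  apply: (@le_trans _ _ (lint `[t, +oo[ (fun s => (1 + `|x t|) * Phi s))).
    apply: lint_le => //; [exact/li_norm/lagrangian_li|exact: liZ|].
    by move=> s /=; rewrite in_itv/= andbT; exact: lagrangian_bound.
  rewrite lintZ//; apply: ler_wpM2l; first by rewrite addr_ge0.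
  apply: lint_subset => //; [exact: ray_sub|move=> s /=|exact: Phi_integrable].
  by rewrite in_itv/= andbT; exact: Phi_ge0.
by move: h; rewrite ler_norml => /andP[].
Qed.

Let costs_has_inf t a : 0 <= t -> has_inf (costs t a).
Proof.
move=> t0; split.
  have [x adx] := Hadm a t0.
  have [f [tx xa xf]] := admissible_trajectory (sepE := sepE) HG t0 adx.
  by exists (J t x f), x, f.
exists (- ((1 + `|a|) * lint `[0, +oo[ Phi)) => _ [x [f [tx <- ->]]].
exact: J_ge.
Qed.

Lemma valueE t a : 0 <= t -> value L Gamma t a = (V t a)%:E.
Proof.
move=> t0; have [ne lb] := costs_has_inf a t0.
by rewrite /V value_costs// ereal_inf_EFin.
Qed.

Let V_inf t a : 0 <= t -> V t a = inf (costs t a).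
Proof.
move=> t0; have [ne lb] := costs_has_inf a t0.
by rewrite /V value_costs// ereal_inf_EFin.
Qed.

Lemma V_le t x f : 0 <= t -> trajectory Gamma t x f -> V t (x t) <= J t x f.
Proof.
move=> t0 tx; rewrite V_inf//; apply: ge_inf; first by have [] := costs_has_inf (x t) t0.
by exists x, f.
Qed.

Lemma V_near_optimal t a e : 0 <= t -> 0 < e ->
  exists x f, [/\ trajectory Gamma t x f, x t = a & J t x f < V t a + e].
Proof.
move=> t0 e0; have [_ [x [f [tx xa ->]]] h] := inf_adherent e0 (costs_has_inf a t0).
by exists x, f; rewrite V_inf.
Qed.

Lemma J_split t t' x f : 0 <= t -> t <= t' -> trajectory Gamma t x f ->
  J t x f = lint `[t, t'] (lagrangian x f) + J t' x f.
Proof. by move=> t0 tt' tx; apply: lint_ray => //; exact: lagrangian_li. Qed.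

(** The competitor follows [x] up to [t'] and then a near-optimal trajectory from [x t']. *)
Lemma dynamic_programming_le t t' x f : 0 <= t -> t <= t' -> trajectory Gamma t x f ->
  V t (x t) <= lint `[t, t'] (lagrangian x f) + V t' (x t').
Proof.
move=> t0 tt' tx; have t'0 := le_trans t0 tt'.
apply/ler_addgt0Pr => e e0.
have [z [g [tz zx hJ]]] := V_near_optimal (x t') t'0 e0.
have tX := trajectory_concat (sepE := sepE) tt' tx tz zx.
have := V_le t0 tX; rewrite /= (J_split t0 tt' tX).
have -> : (if t < t' then x t else z t) = x t.
  by move: tt'; rewrite le_eqVlt => /orP[/eqP tt'|->//]; rewrite tt' ltxx -zx.
move=> /le_trans; apply; rewrite -addrA; apply: lerD.
  rewrite le_eqVlt; apply/orP; left; apply/eqP/esym; apply: lint_ae => //.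
    have A := leb_ae_neq t'; apply: filterS A => s st' /=.
    rewrite in_itv/= => /andP[ts st]; rewrite /lagrangian.
    by rewrite lt_neqAle st' st.
  exact: (lagrangian_li_itv _ t0 tx).
rewrite (_ : J t' _ _ = J t' z g) ?ltW//.
by apply: lint_ext => s /=; rewrite in_itv/= andbT /lagrangian => t's; rewrite ltNge t's.
Qed.

Lemma dynamic_programming_ge t t' x f : 0 <= t -> t <= t' -> trajectory Gamma t x f ->
  V t' (x t') <= J t x f - lint `[t, t'] (lagrangian x f).
Proof.
move=> t0 tt' tx; rewrite (J_split t0 tt' tx) addrAC subrr add0r.
apply: V_le; first exact: le_trans tt'.
exact: trajectory_shift tx.
Qed.

(** A Lipschitz constant common to all [V t]. Per unit distance, [Phi] bounds the effect of the
    tracking error and [l2] absorbs the additive velocity error [e] of approximate tracking. *)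
Definition Vlip : R := lint `[0, +oo[ (fun s => Phi s + l2 s).

Lemma Phil2_integrable : leb_integrable `[0, +oo[ (fun s => Phi s + l2 s).
Proof. by apply: liD => //; [exact: Phi_integrable|exact: cost_l2_integrable HL]. Qed.

Lemma Vlip_ge0 : 0 <= Vlip.
Proof.
by apply: lint_ge0 => s /=; rewrite in_itv/= andbT => s0; rewrite addr_ge0 ?Phi_ge0 ?l2_ge0.
Qed.

(* Track the translate of a near-optimal trajectory. *)
Lemma V_lipschitz t a b : 0 <= t -> V t a <= V t b + Vlip * `|a - b|.
Proof.
move=> t0; have [w [lw w01 w1]] := @integrable_weight R.
pose d := `|a - b|.
suff key e : 0 < e -> V t a <= V t b + e + (d + e) * Vlip.
  apply/ler_addgt0Pr => e e0.
  have V1 : 0 < Vlip + 1 by rewrite ltr_wpDl// Vlip_ge0.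
  have e1 : 0 < e / (Vlip + 1) by rewrite divr_gt0.
  apply: le_trans (key _ e1) _; rewrite -/d le_eqVlt; apply/orP; left; apply/eqP.
  by field; rewrite gt_eqF.
move=> e0; have [z [g [tz zb hJ]]] := V_near_optimal b t0 e0.
have [zg gg] := tz.
pose y s := z s + (a - b).
have yg : primitive t y g by exact: primitive_translate.
have ge0 s : t <= s -> 0 <= s by exact: le_trans.
(* The translate [y] of the trajectory [z] has defect at most [d * gamma s]; the term [e * w s] is
   the positive slack that [tracking] demands, of integral at most [e] on the whole ray. *)
pose r s := d * gamma s + e * w s.
have lwt T : leb_integrable `[t, T] w.
  by apply: liS lw => //; apply: subset_itv; rewrite bnd_simp.
have lgt T : leb_integrable `[t, T] gamma by exact: (gamma_li HG).
have [||||s ts|x [f [tx xt fg _ dist_x]]] := @tracking _ _ _ _ _ HG t y g r (fun s => e * w s) t0 yg.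
- apply: lmfM; first exact: lmf_cst.
  by apply: lmfS (li_lmf lw) => //; exact: ray_sub.
- by move=> s /ge0 s0; rewrite mulr_gt0//; have /andP[] := w01 _ s0.
- by move=> T _; apply: liZ.
- by move=> T _; apply: liD => //; exact: liZ.
- rewrite lerD2r; apply: le_trans (Gamma_dist_lipschitz HG _ _ (z s) (ge0 _ ts)) _.
  rewrite dist_self; last exact: gg.
    by rewrite add0r /y addrAC subrr add0r mulrC.
  exact: inclusion_nonempty HG _ _ (ge0 _ ts).
have Zle s : t <= s -> expR (lint `[t, s] gamma) * lint `[t, s] r <=
    expR (Gint s) * (d * Gint s + e).
  move=> ts; apply: ler_pM.
  - exact: expR_ge0.
  - apply: lint_ge0 => q /=; rewrite in_itv/= => /andP[/ge0 q0 _].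
    have /andP[/ltW wq _] := w01 _ q0; apply: addr_ge0; apply: mulr_ge0.
    - exact: normr_ge0.
    - exact: gamma_ge0.
    - exact: ltW.
    - exact: wq.
  - by rewrite ler_expR; exact: (gamma_lint_le HG).
  rewrite (lintD (mI _) (liZ d (mI _) (lgt s)) (liZ e (mI _) (lwt s))).
  rewrite (lintZ _ (mI _) (lgt s)) (lintZ _ (mI _) (lwt s)); apply: lerD.
    by apply: ler_wpM2l; [exact: normr_ge0|exact: (gamma_lint_le HG)].
  by rewrite -[leRHS]mulr1; apply: ler_wpM2l; [exact: ltW|exact: w1].
(* [M] is the exponential factor of [Phi]. The initial displacement [d] and the tracking error
   together stay below [(d + e) * M s], which explains the shape of the weight in (g). *)
pose M s := expR (Gint s) * (1 + Gint s).
have d0 : 0 <= d by exact: normr_ge0.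
have dM s : d + expR (Gint s) * (d * Gint s + e) <= (d + e) * M s.
  rewrite /M; have v0 := Gint_ge0 s.
  have u1 : 1 <= expR (Gint s) by rewrite -[leLHS]expR0 ler_expR.
  set u := expR (Gint s) in u1 *; set v := Gint s in v0 *.
  have h1 : 0 <= d * (u - 1) by apply: mulr_ge0; rewrite ?subr_ge0.
  have h2 : 0 <= e * (u * v).
    apply: mulr_ge0; first exact: ltW.
    by apply: mulr_ge0; [exact: le_trans ler01 u1|].
  rewrite -subr_ge0 [X in 0 <= X](_ : _ = d * (u - 1) + e * (u * v)); last by ring.
  exact: addr_ge0.
have xz s : t <= s -> `|x s - z s| <= (d + e) * M s.
  move=> ts; apply: le_trans (dM s).
  have -> : x s - z s = (x s - y s) + (a - b) by rewrite /y opprD [X in _ = X + _]addrA subrK.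
  apply: le_trans (ler_normD _ _) _; rewrite addrC lerD2l.
  by have [_ h] := dist_x s ts; exact: le_trans h (Zle s ts).
have fgle s : t <= s -> `|f s - g s| <= e + gamma s * ((d + e) * M s).
  move=> ts; have s0 := ge0 _ ts; apply: le_trans (fg s ts) _.
  have /andP[_ ws] := w01 _ s0.
  have h1 := ler_wpM2l (ltW e0) ws; rewrite mulr1 in h1.
  have h2 := ler_wpM2l (gamma_ge0 s0) (Zle s ts).
  have h3 := ler_wpM2l (gamma_ge0 s0) (dM s); rewrite mulrDr in h3.
  rewrite /r (mulrC d) [leLHS]addrAC [leRHS]addrC; apply: lerD h1.
  by apply: le_trans h3; rewrite lerD2l.
have lxz s : t <= s -> `|lagrangian x f s - lagrangian z g s| <= (d + e) * (Phi s + l2 s).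
  move=> ts; have s0 := ge0 _ ts; apply: le_trans (Lfin_lipschitz _ _ _ _ s0) _.
  apply: le_trans (lerD (ler_wpM2l (l1_ge0 s0) (xz s ts)) (ler_wpM2l (l2_ge0 s0) (fgle s ts))) _.
  have h : 0 <= l2 s * d by rewrite mulr_ge0 ?l2_ge0.
  rewrite /Phi -/(M s) -subr_ge0 [X in 0 <= X](_ : _ = l2 s * d)//.
  ring.
have lx := lagrangian_li t0 tx; have lz := lagrangian_li t0 tz.
have lPt : leb_integrable `[t, +oo[ (fun s => Phi s + l2 s).
  by apply: liS Phil2_integrable => //; exact: ray_sub.
have xa : x t = a by rewrite xt /y zb addrC subrK.
rewrite -{1}xa; apply: le_trans (V_le t0 tx) _.
have -> : J t x f = J t z g + lint `[t, +oo[ (fun s => lagrangian x f s - lagrangian z g s).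
  by rewrite lintB// addrC subrK.
apply: lerD; first exact: ltW.
apply: (@le_trans _ _ (lint `[t, +oo[ (fun s => (d + e) * (Phi s + l2 s)))).
  apply: lint_le => //; [exact: liB|exact: liZ|move=> s /=].
  by rewrite in_itv/= andbT => /lxz; apply: le_trans; exact: ler_norm.
rewrite lintZ//; apply: ler_wpM2l; first by rewrite addr_ge0// ltW.
apply: lint_subset => //; [exact: ray_sub|move=> s /=|exact: Phil2_integrable].
by rewrite in_itv/= andbT => s0; rewrite addr_ge0 ?Phi_ge0 ?l2_ge0.
Qed.

Lemma V_continuous t : 0 <= t -> continuous (V t).
Proof.
move=> t0 a; apply/cvgrPdist_lt => e e0.
have V1 : 0 < Vlip + 1 by rewrite ltr_wpDl// Vlip_ge0.
near=> b.
apply: (@le_lt_trans _ _ (Vlip * `|a - b|)).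
  rewrite ler_norml; have := V_lipschitz a b t0; have := V_lipschitz b a t0.
  rewrite (distrC b); move: (Vlip * _) (V t a) (V t b) => u v w h1 h2.
  by apply/andP; split; lra.
apply: (@le_lt_trans _ _ ((Vlip + 1) * `|a - b|)); first by rewrite ler_wpM2r// lerDl.
rewrite mulrC -ltr_pdivlMr//.
by near: b; apply: cvgr_dist_lt; [exact: cvg_id|exact: divr_gt0].
Unshelve. all: by end_near. Qed.

End Value.

(** * Perturbation of the optimal trajectory *)

Section RightMean.
Context {R : realType}.

Let mI (i : interval R) := leb_measurable_itv i.

Definition right_mean_value (f : R -> R) (s : R) : Prop := forall e, 0 < e ->
  \forall h \near 0^'+, `|lint `[s, s + h] f - h * f s| <= e * h.

Lemma ae_right_mean_value (t : R) (f : R -> R) :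
  (forall T, t <= T -> leb_integrable `[t, T] f) -> ae_from t (right_mean_value f).
Proof.
move=> lf; have A := leb_lebesgue_pt lf; rewrite /ae_from in A *.
apply: filterS A => s A ts; have [{}ts H] := A ts; move=> e e0.
near=> h; have h0 : 0 < h by near: h; exact: nbhs_right_gt.
have [th hh] : t <= s - h /\ lint `[s - h, s + h] (fun r => `|f r - f s|) <= e * h.
  by near: h; exact: H.
have ssh : s <= s + h by rewrite lerDl ltW.
have lfs : leb_integrable `[s, s + h] f by apply: (loc_li_sub lf); exact: ltW.
have ldl a b : t <= a -> leb_integrable `[a, b] (fun r => `|f r - f s|).
  by move=> ta; apply/li_norm/liB; [|exact: (loc_li_sub lf)|exact: li_cst].
rewrite (_ : h * f s = lint `[s, s + h] (fun=> f s)); last first.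
  by rewrite lint_cst// addrAC subrr add0r mulrC.
rewrite -lintB//; last exact: li_cst.
apply: le_trans (lint_norm _ _) _ => //; first by apply: liB => //; exact: li_cst.
apply: le_trans hh; apply: lint_subset => //; last exact: ldl.
by apply: subset_itv; rewrite bnd_simp// gerBl ltW.
Unshelve. all: by end_near. Qed.

Lemma lint_right_small (t : R) (f : R -> R) (e : R) :
  (forall T, t <= T -> leb_integrable `[t, T] f) -> 0 < e ->
  \forall h \near 0^'+, lint `[t, t + h] (fun r => `|f r|) < e.
Proof.
move=> lf e0; have t1 : t <= t + 1 by rewrite lerDl.
have [d d0 hd] := lint_abs_continuous (lf _ t1) e0.
near=> h; have h0 : 0 < h by near: h; exact: nbhs_right_gt.
apply: hd => //; first by rewrite lerDl ltW.
  by rewrite lerD2l ltW//; near: h; exact: nbhs_right_lt.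
by rewrite addrAC subrr add0r; near: h; exact: nbhs_right_lt.
Unshelve. all: by end_near. Qed.

End RightMean.

Section Perturbation.
Context {R : realType} {E : completeNormedModType R} {sepE : separable E}.
Variables (L : R -> E -> E -> \bar R) (Gamma : R -> E -> set E).
Variables (l1 l2 gamma : R -> R).
Hypothesis HG : regular_inclusion Gamma gamma.
Hypothesis HL : regular_cost L l1 l2 gamma.
Hypothesis Hadm : forall (t : R) xi, 0 <= t -> exists x, admissible Gamma t xi x.

Let mI (i : interval R) := leb_measurable_itv i.
Let gamma_ge0 := inclusion_bound_ge0 HG.
Let l1_ge0 := cost_l1_ge0 HL.
Let l2_ge0 := cost_l2_ge0 HL.
Local Notation V := (V L Gamma).
Local Notation Lfin := (Lfin L).
Local Notation lagrangian := (lagrangian L).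

Let li_ray_loc (f : R -> R) : leb_integrable `[0, +oo[ f ->
  forall T, 0 <= T -> leb_integrable `[0, T] f.
Proof.
by move=> lf T _; apply: liS lf => //; apply: subset_itvl; rewrite bnd_simp.
Qed.

Lemma Lfin_li (x v : E) T : 0 <= T -> leb_integrable `[0, T] (fun s => Lfin s x v).
Proof.
move=> T0.
have l1T := li_ray_loc (cost_l1_integrable HL) T0.
have l2T := li_ray_loc (cost_l2_integrable HL) T0.
apply: (li_le (g := fun s => (1 + `|x|) * l1 s + `|v| * l2 s)) => //.
- by apply: lmfS (lmf_Lfin_cst HL x v) => //; apply: subset_itvl; rewrite bnd_simp.
- move=> s /=; rewrite in_itv/= => /andP[s0 _].
  by apply: le_trans (Lfin_bound HL _ _ s0) _; rewrite mulrC (mulrC `|v|).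
- by apply: liD => //; exact: liZ.
Qed.

(* Countably many Lebesgue points suffice, by Lipschitz continuity. *)
Lemma ae_Lfin_mean : ae_from 0 (fun t => forall x v e, 0 < e ->
  \forall h \near 0^'+, lint `[t, t + h] (fun s => Lfin s x v) <= h * (Lfin t x v + e)).
Proof.
have [e_ de] := separable_seq sepE.
have A1 := ae_right_mean_value (li_ray_loc (cost_l1_integrable HL)).
have A2 := ae_right_mean_value (li_ray_loc (cost_l2_integrable HL)).
have A3 := ae_foralln (fun i => ae_foralln (fun j =>
  ae_right_mean_value (Lfin_li (e_ i) (e_ j)))).
rewrite /ae_from in A1 A2 *; apply: filterS3 A1 A2 A3 => t H1 H2 H3 t0 x v e e0.
have {}H1 := H1 t0; have {}H2 := H2 t0.
(* The errors below add up to at most [d * h * (2 * (l1 t + l2 t) + 3)], using [d <= 1]; the choice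
   of [d] makes [2 * d * c], which is larger, at most [e]. *)
pose c := l1 t + l2 t + 3.
have c0 : 0 < c by rewrite ltr_wpDl// addr_ge0 ?l1_ge0 ?l2_ge0.
pose d := Num.min 1 (e / (2 * c)).
have d0 : 0 < d by rewrite lt_min ltr01 divr_gt0// mulr_gt0.
have d1 : d <= 1 by rewrite ge_min lexx.
have dc : 2 * d * c <= e.
  rewrite -mulrA mulrCA; apply: (@le_trans _ _ (e / (2 * c) * (2 * c))).
    by rewrite ler_wpM2r ?mulr_ge0 ?(ltW c0)// ge_min lexx orbT.
  by rewrite divfK// mulf_neq0 ?gt_eqF.
have [i hi] := de x _ d0; have [j hj] := de v _ d0.
have {}H3 := H3 i j t0.
near=> h; have h0 : 0 < h by near: h; exact: nbhs_right_gt.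
have th : t <= t + h by rewrite lerDl ltW.
have ge0 s : `[t, t + h]%classic s -> 0 <= s.
  by rewrite /= in_itv/= => /andP[ts _]; exact: le_trans ts.
have sub : `[t, t + h]%classic `<=` `[0, t + h]%classic.
  by apply: subset_itvr; rewrite bnd_simp.
have th0 := le_trans t0 th.
have i1 : leb_integrable `[t, t + h] l1.
  by apply: liS (li_ray_loc (cost_l1_integrable HL) th0).
have i2 : leb_integrable `[t, t + h] l2.
  by apply: liS (li_ray_loc (cost_l2_integrable HL) th0).
have i3 : leb_integrable `[t, t + h] (fun s => Lfin s (e_ i) (e_ j)).
  by apply: liS (Lfin_li _ _ th0).
have i4 : leb_integrable `[t, t + h] (fun s => Lfin s x v).
  by apply: liS (Lfin_li _ _ th0).
have /ler_normlP[_ h1] : `|lint `[t, t + h] l1 - h * l1 t| <= d * h.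
  by near: h; exact: H1.
have /ler_normlP[_ h2] : `|lint `[t, t + h] l2 - h * l2 t| <= d * h.
  by near: h; exact: H2.
have /ler_normlP[_ h3] : `|lint `[t, t + h] (fun s => Lfin s (e_ i) (e_ j)) -
    h * Lfin t (e_ i) (e_ j)| <= d * h by near: h; exact: H3.
have lip s : 0 <= s -> `|Lfin s x v - Lfin s (e_ i) (e_ j)| <= d * (l1 s + l2 s).
  move=> s0; apply: le_trans (Lfin_lipschitz HL _ _ _ _ s0) _.
  rewrite mulrDr mulrC (mulrC (l2 s)); apply: lerD.
    by apply: ler_wpM2r; [exact: l1_ge0|exact: ltW].
  by apply: ler_wpM2r; [exact: l2_ge0|exact: ltW].
have h4 : lint `[t, t + h] (fun s => Lfin s x v) <=
    lint `[t, t + h] (fun s => Lfin s (e_ i) (e_ j)) +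
    d * (lint `[t, t + h] l1 + lint `[t, t + h] l2).
  rewrite -lintD// -lintZ//; last exact: liD.
  rewrite -lintD//; last by apply: liZ => //; exact: liD.
  apply: lint_le => //.
    by apply: liD => //; apply: liZ => //; exact: liD.
  move=> s /ge0 s0; rewrite -lerBlDl; apply: le_trans (lip s s0); exact: ler_norm.
apply: le_trans h4 _.
have h5 : Lfin t (e_ i) (e_ j) <= Lfin t x v + d * (l1 t + l2 t).
  by rewrite -lerBlDl; apply: le_trans (lip t t0); rewrite distrC; exact: ler_norm.
have h6 : d * (lint `[t, t + h] l1 + lint `[t, t + h] l2) <=
    d * (h * l1 t + d * h + (h * l2 t + d * h)).
  by apply: ler_wpM2l; [exact: ltW|apply: lerD; rewrite -lerBlDl].
have h7 : h * Lfin t (e_ i) (e_ j) <= h * (Lfin t x v + d * (l1 t + l2 t)).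
  by apply: ler_wpM2l => //; exact: ltW.
have h8 : d * (d * h) <= d * h.
  by rewrite -[leRHS]mul1r; apply: ler_wpM2r d1; rewrite mulr_ge0// ltW.
have h9 : h * (2 * d * c) <= h * e by apply: ler_wpM2l => //; exact: ltW.
apply: (@le_trans _ _ (h * Lfin t x v + h * (2 * d * c))); last first.
  by rewrite [leRHS]mulrDr lerD2l.
rewrite lerBlDl in h3.
have h10 : 0 <= d * h by rewrite mulr_ge0 ?(ltW d0) ?(ltW h0).
apply: le_trans (lerD h3 h6) _; rewrite /c; lra.
Unshelve. all: by end_near. Qed.

Section optimal_trajectory.
Variables (x0 f0 : R -> E).
Hypothesis tx0 : trajectory Gamma 0 x0 f0.
Hypothesis x0_opt : J L 0 x0 f0 = V 0 (x0 0).

(** A cheaper continuation from [x0 t] would, after concatenation with [x0], contradict optimality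
    at time 0. *)
Lemma optimal_tail t : 0 <= t -> V t (x0 t) = J L t x0 f0.
Proof.
move=> t0; apply/eqP; rewrite eq_le; apply/andP; split.
  exact: (V_le HG HL Hadm t0 (trajectory_shift t0 tx0)).
have := dynamic_programming_le (sepE := sepE) HG HL Hadm (lexx 0) t0 tx0.
by rewrite -x0_opt (J_split HG HL (lexx 0) t0 tx0) lerD2l.
Qed.

Lemma optimal_step t h : 0 <= t -> 0 <= h ->
  V (t + h) (x0 (t + h)) <= V t (x0 t) - lint `[t, t + h] (lagrangian x0 f0).
Proof.
move=> t0 h0; rewrite (optimal_tail t0).
have th : t <= t + h by rewrite lerDl.
exact: (dynamic_programming_ge HG HL Hadm t0 th (trajectory_shift t0 tx0)).
Qed.

(** Lower semicontinuity with the state frozen at [x]: the ball of radius [e] at [v] still meets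
    [Gamma s x] for [s] near [t]. As this holds at every [t], no null set depending on [v]
    arises. *)
Lemma Gamma_right_lsc t x v e : 0 <= t -> Gamma t x v -> 0 < e ->
  \forall h \near 0^'+, forall s, t <= s <= t + h -> dist (Gamma s x) v <= e.
Proof.
move=> t0 Gv e0; have [U oU hU] := inclusion_lsc HG x (ball_open v e).
have Ut : U t.
  have : (U `&` `[0, +oo[%classic) t.
    by rewrite -hU; split => //; exists v; split => //; exact: ballxx.
  by case.
move: oU; rewrite openE => /(_ _ Ut)/nbhs_ballP[d /= d0 dU].
near=> h => s /andP[ts sh].
have s0 := le_trans t0 ts.
have hd : h < d by near: h; exact: nbhs_right_lt.
have : (U `&` `[0, +oo[%classic) s.
  split; last by rewrite /= in_itv/= s0.
  by apply: dU; rewrite -ball_normE/= distrC ger0_norm ?subr_ge0//; lra.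
rewrite -hU => -[_ [c [Gc vc]]].
apply: le_trans (dist_le (inclusion_nonempty HG _ s0) _ Gc) _.
by move: vc; rewrite -ball_normE => /ltW.
Unshelve. all: by end_near. Qed.

(** The segment [y] of slope [v] from [x0 t + h *: u] reaches [x0 t + h *: f0 t] at time [t + h],
    which is [x0 (t + h)] up to o(h). Its defect has integral o(h), so [tracking] finds a true
    trajectory at distance o(h) from it. *)
Lemma right_perturbation t v (u := f0 t - v) : 0 <= t -> Gamma t (x0 t) v ->
  (h^-1 *: (x0 (h + t) - x0 t) @[h --> 0^'] --> f0 t) ->
  forall eta, 0 < eta -> \forall h \near 0^'+, exists z g,
    [/\ trajectory Gamma t z g, z t = x0 t + h *: u,
        forall s, t <= s <= t + h -> `|z s - x0 t| <= (eta + `|u| + `|v|) * h,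
        leb_integrable `[t, t + h] (fun s => `|g s - v|) /\
        lint `[t, t + h] (fun s => `|g s - v|) <= eta * h &
        `|z (t + h) - x0 (t + h)| <= 2 * eta * h].
Proof.
move=> t0 Gv xd eta eta0.
pose M := `|u| + `|v|.
have M0 : 0 <= M by rewrite addr_ge0.
pose c : R := expR 1.
have c0 : 0 < c by exact: expR_gt0.
pose eta3 := eta / (3 * c).
have eta30 : 0 < eta3 by rewrite divr_gt0// mulr_gt0.
have lgt T : t <= T -> leb_integrable `[t, T] gamma.
  by move=> _; exact: (gamma_li HG).
have M1 : 0 < M + 1 by rewrite ltr_wpDl.
have N1 := Gamma_right_lsc t0 Gv eta30.
have N2 := lint_right_small lgt ltr01.
have N3 := lint_right_small lgt (divr_gt0 eta30 M1).
have N4 : \forall h \near 0^'+, `|x0 (t + h) - (x0 t + h *: f0 t)| <= eta * h.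
  have /cvgrPdist_le/(_ _ eta0) := xd.
  rewrite !near_withinE => H; near=> h => h0.
  have hn0 : h != 0 by rewrite gt_eqF.
  have hb : `|f0 t - h^-1 *: (x0 (h + t) - x0 t)| <= eta by move: hn0; near: h.
  have -> : x0 (t + h) - (x0 t + h *: f0 t) =
      - (h *: (f0 t - h^-1 *: (x0 (h + t) - x0 t))).
    by rewrite scalerBr scalerA divff// scale1r [h + t]addrC opprB opprD addrA.
  by rewrite normrN normrZ gtr0_norm// mulrC ler_pM2r.
near=> h; have h0 : 0 < h by near: h; exact: nbhs_right_gt.
have hh : t <= t + h by rewrite lerDl ltW.
have h1 : forall s, t <= s <= t + h -> dist (Gamma s (x0 t)) v <= eta3 by near: h.
have absg T : lint `[t, T] (fun r => `|gamma r|) = lint `[t, T] gamma.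
  apply: lint_ext => s /=; rewrite in_itv/= => /andP[ts _].
  by rewrite ger0_norm// gamma_ge0// (le_trans t0).
have h2 : lint `[t, t + h] gamma < 1 by rewrite -absg; near: h.
have h3 : lint `[t, t + h] gamma < eta3 / (M + 1) by rewrite -absg; near: h.
have h4 : `|x0 (t + h) - (x0 t + h *: f0 t)| <= eta * h by near: h.
have h5 : h < eta3 by near: h; exact: nbhs_right_lt.
pose y s := (x0 t + h *: u) + (s - t) *: v.
have yx s : y s - x0 t = h *: u + (s - t) *: v.
  by rewrite /y -(addrA (x0 t)) [x0 t + _]addrC addrK.
have yv : primitive t y (fun=> v) by exact: primitive_affine.
pose r s := dist (Gamma s (y s)) v + h.
have ge0 s : t <= s -> 0 <= s by exact: le_trans.
have r0 s : t <= s -> 0 <= r s.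
  move=> /ge0 s0; rewrite addr_ge0 ?(ltW h0)//.
  by apply: dist_ge0; exact: (inclusion_nonempty HG).
have lr T : t <= T -> leb_integrable `[t, T] r.
  move=> tT; apply: (li_le (g := fun s => `|v| + gamma s * (1 + `|y s|) + h)) => //.
  - apply: lmfD; last exact: lmf_cst.
    apply: lmfS (lmf_dist HG t0 (primitive_smeas_self yv) (@smeas_cst _ _ _ v)) => //.
    by apply: subset_itvl; rewrite bnd_simp.
  - move=> s /=; rewrite in_itv/= => /andP[ts _].
    rewrite ger0_norm ?r0// /r lerD2r.
    exact: (Gamma_dist_growth HG _ _ (ge0 _ ts)).
  - apply: liD => //; last exact: li_cst.
    by apply: liD => //; [exact: li_cst|exact: (gamma_primitive_li HG _ t0 yv)].
have [|||||x] := @tracking _ _ _ _ _ HG t y (fun=> v) r (fun=> h) t0 yv.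
- exact: lmf_cst.
- by [].
- by move=> T _; exact: li_cst.
- exact: lr.
- by [].
move=> [g [tz zt gv lgv hZ]].
have Zh : expR (lint `[t, t + h] gamma) * lint `[t, t + h] r <= eta * h.
  apply: (@le_trans _ _ (c * (3 * eta3 * h))); last first.
    rewrite mulrA ler_wpM2r ?(ltW h0)// /eta3 [leLHS](_ : _ = eta)//.
    by field; rewrite gt_eqF.
  apply: ler_pM.
  - exact: expR_ge0.
  - by apply: lint_ge0 => q /=; rewrite in_itv/= => /andP[/r0].
  - by rewrite /c ler_expR ltW.
  have hr s : t <= s <= t + h -> r s <= eta3 + h + (M * h) * gamma s.
    move=> sh; have /andP[ts sth] := sh; have s0 := ge0 _ ts.
    rewrite /r addrAC lerD2r.
    apply: le_trans (Gamma_dist_lipschitz HG _ _ (x0 t) s0) _.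
    apply: lerD; first exact: h1.
    rewrite mulrC; apply: ler_wpM2r; first exact: gamma_ge0.
    rewrite yx.
    apply: le_trans (ler_normD _ _) _; rewrite !normrZ mulrDl; apply: lerD.
      by rewrite gtr0_norm// mulrC.
    rewrite mulrC ler_wpM2l// ger0_norm ?subr_ge0//.
    by rewrite lerBlDl.
  apply: (@le_trans _ _ (lint `[t, t + h] (fun s => eta3 + h + (M * h) * gamma s))).
    apply: lint_le => //; first exact: lr.
      by apply: liD => //; [exact: li_cst|apply: liZ => //; exact: lgt].
  rewrite lintD//; [|exact: li_cst|by apply: liZ => //; exact: lgt].
  rewrite lintZ//; last exact: lgt.
  rewrite lint_cst// addrAC subrr add0r.
  have e1 : M * h * lint `[t, t + h] gamma <= eta3 * h.
    rewrite mulrAC; apply: ler_wpM2r; first exact: ltW.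
    apply: (@le_trans _ _ ((M + 1) * lint `[t, t + h] gamma)).
      rewrite ler_wpM2r ?lerDl//; exact: (gamma_lint_ge0 HG).
    by rewrite mulrC -ler_pdivlMr// ltW.
  have e2 : h * h <= eta3 * h by rewrite ler_wpM2r// ltW.
  by rewrite mulrDl; lra.
exists x, g; split => //.
- by rewrite zt /y subrr scale0r addr0.
- move=> s /andP[ts sth].
  have -> : x s - x0 t = (x s - y s) + (y s - x0 t) by rewrite addrA subrK.
  apply: le_trans (ler_normD _ _) _; rewrite -[in leRHS]addrA mulrDl; apply: lerD.
    have [_ hz] := hZ s ts; apply: le_trans hz _; apply: le_trans Zh.
    apply: ler_pM.
    + exact: expR_ge0.
    + by apply: lint_ge0 => q /=; rewrite in_itv/= => /andP[/r0].
    + rewrite ler_expR; apply: (@lint_ge0_le _ t) => // q /ge0; exact: gamma_ge0.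
    + by apply: (@lint_ge0_le _ t).
  rewrite yx.
  apply: le_trans (ler_normD _ _) _; rewrite !normrZ mulrDl; apply: lerD.
    by rewrite gtr0_norm// mulrC.
  by rewrite mulrC ler_wpM2l// ger0_norm ?subr_ge0// lerBlDl.
- by split; [exact: lgv|have [h' _] := hZ _ hh; exact: le_trans h' Zh].
- have -> : x (t + h) - x0 (t + h) =
    (x (t + h) - y (t + h)) + (y (t + h) - x0 (t + h)) by rewrite addrA subrK.
  apply: le_trans (ler_normD _ _) _; rewrite -mulrA mulr2n mulrDl mul1r; apply: lerD.
    by have [_ hz] := hZ _ hh; exact: le_trans hz Zh.
  rewrite distrC; apply: le_trans h4; rewrite le_eqVlt; apply/orP; left; apply/eqP.
  congr (`| _ - _ |); rewrite /y /u [t + h]addrC addrK scalerBr -!addrA.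
  by rewrite addNr addr0.
Unshelve. all: by end_near. Qed.

End optimal_trajectory.
End Perturbation.

(** * The directional estimate behind (i) *)

Section DirectionalBound.
Context {R : realType} {E : completeNormedModType R} {sepE : separable E}.
Variables (L : R -> E -> E -> \bar R) (Gamma : R -> E -> set E).
Variables (l1 l2 gamma : R -> R).
Hypothesis HG : regular_inclusion Gamma gamma.
Hypothesis HL : regular_cost L l1 l2 gamma.
Hypothesis Hadm : forall (t : R) xi, 0 <= t -> exists x, admissible Gamma t xi x.

Let mI (i : interval R) := leb_measurable_itv i.
Let l1_ge0 := cost_l1_ge0 HL.
Let l2_ge0 := cost_l2_ge0 HL.
Local Notation V := (V L Gamma).
Local Notation Lfin := (Lfin L).
Local Notation lagrangian := (lagrangian L).
Local Notation Vlip := (Vlip l1 l2 gamma).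

Variables (x0 f0 : R -> E).
Hypothesis tx0 : trajectory Gamma 0 x0 f0.
Hypothesis x0_opt : J L 0 x0 f0 = V 0 (x0 0).

Lemma V_directional_bound : ae_from 0 (fun t => forall v e, Gamma t (x0 t) v -> 0 < e ->
  \forall h \near 0^'+, V t (x0 t + h *: (f0 t - v)) - V t (x0 t) <=
    h * (Lfin t (x0 t) v - Lfin t (x0 t) (f0 t) + e)).
Proof.
have xf0 : primitive 0 x0 f0 by case: tx0.
have A1 := primitive_W11_derive (sepE := sepE) xf0.
have lag0 T : 0 <= T -> leb_integrable `[0, T] (lagrangian x0 f0).
  by move=> T0; exact: (lagrangian_li_itv (sepE := sepE) HG HL _ (lexx 0) tx0 (lexx 0)).
have A2 := ae_right_mean_value lag0.
have A3 := ae_Lfin_mean (sepE := sepE) HL.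
rewrite /ae_from in A1 A2 A3 *.
apply: filterS3 A1 A2 A3 => t H1 H2 H3 t0 v e Gv e0.
have {}H1 := H1 t0; have {}H2 := H2 t0; have {}H3 := H3 t0.
have [M2 hM2] := cost_l2_bounded HL (t + 1).
have tt1 : t <= t + 1 by rewrite lerDl.
have M20 : 0 <= M2 by apply: le_trans (l2_ge0 t0) _; apply: hM2; rewrite t0 tt1.
pose u := f0 t - v; pose M := `|u| + `|v|.
have M0 : 0 <= M by rewrite addr_ge0.
have K0 : 0 <= Vlip by exact: (Vlip_ge0 HG HL).
(* The sum of the coefficients of [eta * h] at the end: 1 from each of the two mean values, [1 + M]
   from the state error, [M2] from the velocity error, [2 * Vlip] from the distance at time
   [t + h]. *)
pose c := 3 + M + M2 + 2 * Vlip.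
have c0 : 0 < c.
  by rewrite ltr_wpDr ?mulr_ge0// ltr_wpDr// ltr_wpDr.
pose eta := Num.min 1 (e / c).
have eta0 : 0 < eta by rewrite lt_min ltr01 divr_gt0.
have eta1 : eta <= 1 by rewrite ge_min lexx.
have etac : eta * c <= e by rewrite -ler_pdivlMr// ge_min lexx orbT.
have N1 := right_perturbation (sepE := sepE) HG t0 Gv H1 eta0.
have N2 := H2 _ eta0.
have N3 := H3 (x0 t) v _ eta0.
have l1loc T : t <= T -> leb_integrable `[t, T] l1.
  move=> _; apply: liS (cost_l1_integrable HL) => //.
  by apply: subset_itv; rewrite bnd_simp.
have N4 := lint_right_small l1loc eta0.
near=> h; have h0 : 0 < h by near: h; exact: nbhs_right_gt.
have h1 : h <= 1 by near: h; apply: nbhs_right_le.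
have th : t <= t + h by rewrite lerDl ltW.
have ge0 s : `[t, t + h]%classic s -> 0 <= s.
  by rewrite /= in_itv/= => /andP[ts _]; exact: le_trans ts.
have [z [g [tz zt zx [lgv hgv] zh]]] : exists z g,
    [/\ trajectory Gamma t z g, z t = x0 t + h *: u,
        forall s, t <= s <= t + h -> `|z s - x0 t| <= (eta + `|u| + `|v|) * h,
        leb_integrable `[t, t + h] (fun s => `|g s - v|) /\
        lint `[t, t + h] (fun s => `|g s - v|) <= eta * h &
        `|z (t + h) - x0 (t + h)| <= 2 * eta * h] by near: h.
have n2 : `|lint `[t, t + h] (lagrangian x0 f0) - h * lagrangian x0 f0 t| <= eta * h.
  by near: h.
have n3 : lint `[t, t + h] (fun s => Lfin s (x0 t) v) <= h * (Lfin t (x0 t) v + eta).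
  by near: h.
have n4 : lint `[t, t + h] l1 <= eta.
  rewrite (@lint_ext _ _ _ (fun r => `|l1 r|)); first by apply: ltW; near: h.
  by move=> s /ge0 s0; rewrite ger0_norm ?l1_ge0.
have d1 := dynamic_programming_le (sepE := sepE) HG HL Hadm t0 th tz.
have d2 := V_lipschitz (sepE := sepE) HG HL Hadm (z (t + h)) (x0 (t + h))
  (le_trans t0 th).
have d3 := optimal_step (sepE := sepE) HG HL Hadm tx0 x0_opt t0 (ltW h0).
have d4 : lint `[t, t + h] (lagrangian z g) <=
    lint `[t, t + h] (fun s => Lfin s (x0 t) v) +
    ((eta + `|u| + `|v|) * h * lint `[t, t + h] l1 +
     M2 * lint `[t, t + h] (fun s => `|g s - v|)).
  have i1 : leb_integrable `[t, t + h] (fun s => (eta + `|u| + `|v|) * h * l1 s).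
    by apply: liZ => //; exact: l1loc.
  have i2 : leb_integrable `[t, t + h] (fun s => M2 * `|g s - v|) by exact: liZ.
  have i3 : leb_integrable `[t, t + h] (fun s => Lfin s (x0 t) v).
    apply: liS (Lfin_li HL (x0 t) v (le_trans t0 th)) => //.
    by apply: subset_itvr; rewrite bnd_simp.
  rewrite -!lintZ//; last exact: l1loc.
  rewrite -lintD// -lintD//; last exact: liD.
  apply: lint_le => //.
  - exact: (lagrangian_li_itv (sepE := sepE) HG HL _ t0 tz (lexx t)).
  - by apply: liD => //; exact: liD.
  move=> s sh; have s0 := ge0 _ sh; move: sh => /=; rewrite in_itv/= => sh.
  rewrite -lerBlDl; apply: le_trans (ler_norm _) _.
  apply: le_trans (Lfin_lipschitz HL _ _ _ _ s0) _.
  apply: lerD.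
    by rewrite mulrC; apply: ler_wpM2r; [exact: l1_ge0|exact: zx].
  apply: ler_wpM2r => //; apply: hM2; rewrite s0/=.
  by case/andP: sh => _ /le_trans; apply; rewrite lerD2l.
have d5 : (eta + `|u| + `|v|) * h * lint `[t, t + h] l1 <= (1 + M) * h * eta.
  apply: ler_pM => //.
  - by rewrite mulr_ge0 ?(ltW h0)// !addr_ge0 ?(ltW eta0).
  - by apply: lint_ge0 => s /ge0 /l1_ge0.
  - by apply: ler_wpM2r; [exact: ltW|rewrite -addrA lerD2r].
have d6 : M2 * lint `[t, t + h] (fun s => `|g s - v|) <= M2 * (eta * h).
  exact: ler_wpM2l.
have d7 : Vlip * `|z (t + h) - x0 (t + h)| <= Vlip * (2 * eta * h).
  exact: ler_wpM2l.
have d8 : h * (eta * c) <= h * e by apply: ler_wpM2l => //; exact: ltW.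
rewrite -zt.
have {n2} n2 : h * lagrangian x0 f0 t - eta * h <= lint `[t, t + h] (lagrangian x0 f0).
  by have /ler_normlP[n2' _] := n2; rewrite lerBlDr -lerBlDl -opprB.
set a := V t (z t) in d1 *; set b := V t (x0 t) in d3 *.
have d9 : a - b <= h * (Lfin t (x0 t) v + eta) + ((1 + M) * h * eta + M2 * (eta * h)) +
   Vlip * (2 * eta * h) - (h * lagrangian x0 f0 t - eta * h).
  rewrite lerBlDr; apply: le_trans d1 _.
  have d3' := le_trans d3 (lerB (lexx b) n2).
  apply: le_trans (lerD (le_trans d4 (lerD n3 (lerD d5 d6)))
    (le_trans d2 (lerD d3' d7))) _.
  by rewrite le_eqVlt; apply/orP; left; apply/eqP; ring.
apply: le_trans d9 _.
rewrite -/(lagrangian x0 f0 t) [leRHS]mulrDr.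
apply: (@le_trans _ _ (h * (Lfin t (x0 t) v - lagrangian x0 f0 t) + h * (eta * c))).
  by rewrite le_eqVlt; apply/orP; left; apply/eqP; rewrite /c; ring.
by rewrite lerD2l.
Unshelve. all: by end_near. Qed.

End DirectionalBound.

(** * Clarke and Dini-Hadamard subdifferentials *)

Section limits.
Context {R : realType} {I : choiceType} {T : filteredType I} (F : set_system T).
Implicit Types (g : T -> \bar R).

Lemma limf_esup_near g c : Filter F -> (limf_esup g F < c)%E -> \forall z \near F, (g z < c)%E.
Proof.
move=> FF; rewrite limf_esupE => /ereal_inf_lt[_ [A FA <-] h].
by apply: filterS FA => z Az; apply: le_lt_trans h; apply: ereal_sup_ubound; exists z.
Qed.

Lemma limf_esup_le g c : Filter F -> (forall e, 0 < e -> \forall z \near F, (g z <= (c + e)%:E)%E) ->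
  (limf_esup g F <= c%:E)%E.
Proof.
move=> FF h; apply/lee_addgt0Pr => e e0; rewrite limf_esupE -EFinD.
apply: le_trans (_ : ereal_sup (g @` [set z | (g z <= (c + e)%:E)%E]) <= _)%E; last first.
  by apply: ge_ereal_sup => _ [z /= hz <-].
by apply: ereal_inf_lbound; exists [set z | (g z <= (c + e)%:E)%E] => //; exact: h.
Qed.

Lemma limf_esup_ge g c : ProperFilter F -> (\forall z \near F, (c <= g z)%E) ->
  (c <= limf_esup g F)%E.
Proof.
move=> FF h; rewrite limf_esupE; apply: le_ereal_inf_tmp => _ [A FA <-].
have [z [Az cz]] := filter_ex (filterI FA h).
by apply: le_trans cz _; apply: ereal_sup_ubound; exists z.
Qed.

End limits.

(** * Clarke derivatives of Lipschitz functions and exact penalization *)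

Section Clarke.
Context {R : realType} {E : completeNormedModType R}.
Implicit Types (f : E -> R) (x v : E).

Local Notation nearx x := (filter_prod (nbhs (x : E)) ((0 : R)^'+)).

Definition clarke_real f x v : R := fine (clarke_dd (EFin \o f) x v).

Lemma dquot_EFin f x v theta :
  dquot (EFin \o f) x v theta = ((f (x + theta *: v) - f x) / theta)%:E.
Proof. by []. Qed.

Lemma cvg_prodr {I T U : Type} (F : set_system I) (G : set_system T) (H : set_system U)
    (g : I -> T) (h : I -> U) : Filter F -> g @ F --> G -> h @ F --> H ->
  (g i, h i) @[i --> F] --> filter_prod G H.
Proof.
move=> FF gG hH A [[P Q] /= [GP HQ] PQ].
have : F (g @^-1` P `&` h @^-1` Q) by apply: filterI; [exact: gG|exact: hH].
rewrite /nbhs/= /fmap/=; apply: filterS => i [Pi Qi]; exact: PQ.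
Qed.

Lemma near_snd_gt0 x : \forall z \near nearx x, 0 < z.2.
Proof. by exact: (filter_prod2 (F := nbhs x) (nbhs_right_gt 0)). Qed.

Definition lipschitz_const f k : Prop := forall y z, `|f y - f z| <= k * `|y - z|.

Section lipschitz.
Variables (f : E -> R) (k : R).
Hypothesis fk : lipschitz_const f k.

Lemma quotient_bound x v h : 0 < h -> `|(f (x + h *: v) - f x) / h| <= k * `|v|.
Proof.
move=> h0; rewrite normrM normfV (gtr0_norm h0) ler_pdivrMr//.
apply: le_trans (fk _ _) _; rewrite [x + _]addrC addrK normrZ gtr0_norm//.
by rewrite mulrCA mulrC.
Qed.

Lemma clarke_ddE x v : clarke_dd (EFin \o f) x v = (clarke_real f x v)%:E.
Proof.
rewrite fineK// fin_numElt; apply/andP; split.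
  apply: (@lt_le_trans _ _ (- (k * `|v|))%:E); first exact: ltNyr.
  apply: limf_esup_ge; have := near_snd_gt0 x; apply: filterS => z z0.
  by rewrite dquot_EFin lee_fin; have := quotient_bound z.1 v z0; rewrite ler_norml => /andP[].
apply: (@le_lt_trans _ _ (k * `|v|)%:E); last exact: ltry.
apply: limf_esup_le => e e0; have := near_snd_gt0 x; apply: filterS => z z0.
rewrite dquot_EFin lee_fin ler_wpDr ?(ltW e0)//.
by have := quotient_bound z.1 v z0; rewrite ler_norml => /andP[].
Qed.

Lemma clarke_real_le x v c :
  (forall e, 0 < e -> \forall z \near nearx x, f (z.1 + z.2 *: v) - f z.1 <= z.2 * (c + e)) ->
  clarke_real f x v <= c.
Proof.
move=> h; rewrite -lee_fin -clarke_ddE; apply: limf_esup_le => e e0.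
have := h e e0; have := near_snd_gt0 x; apply: filterS2 => z z0 hz.
by rewrite dquot_EFin lee_fin ler_pdivrMr// mulrC.
Qed.

Lemma clarke_real_near x v e : 0 < e ->
  \forall z \near nearx x, f (z.1 + z.2 *: v) - f z.1 <= z.2 * (clarke_real f x v + e).
Proof.
move=> e0; have : (clarke_dd (EFin \o f) x v < (clarke_real f x v + e)%:E)%E.
  by rewrite clarke_ddE lte_fin ltrDl.
move=> /limf_esup_near h; have := near_snd_gt0 x.
have {}h : \forall z \near nearx x, (dquot (EFin \o f) z.1 v z.2 < (clarke_real f x v + e)%:E)%E.
  exact: h.
move: h; apply: filterS2 => z.
rewrite dquot_EFin lte_fin => hz z0; move: hz.
by rewrite ltr_pdivrMr// mulrC => /ltW.
Qed.

Lemma clarke_real_bound x v : clarke_real f x v <= k * `|v|.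
Proof.
apply: clarke_real_le => e e0; have := near_snd_gt0 x; apply: filterS => z z0.
have := quotient_bound z.1 v z0; rewrite ler_norml => /andP[_].
rewrite ler_pdivrMr// => /le_trans; apply.
by rewrite mulrC ler_wpM2l ?(ltW z0)// lerDl ltW.
Qed.

(** Subadditivity uses the moving base point: [z.1 + z.2 *: w] tends to [x] as well. Homogeneity
    follows by rescaling the step [z.2]. *)
Lemma sublinear_clarke_real x : sublinear (clarke_real f x).
Proof.
split=> [v w|a v a0].
  apply: clarke_real_le => e e0; have e20 : 0 < e / 2 by rewrite divr_gt0.
  have N2 := clarke_real_near x w e20.
  have N1 : \forall z \near nearx x, f (z.1 + z.2 *: w + z.2 *: v) - f (z.1 + z.2 *: w) <=
      z.2 * (clarke_real f x v + e / 2).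
    have C : (z.1 + z.2 *: w, z.2) @[z --> nearx x] --> nearx x.
      apply: cvg_prodr; last exact: cvg_snd.
      rewrite -[X in _ --> nbhs X]addr0 -(scale0r w); apply: cvgD; first exact: cvg_fst.
      have S : z.2 @[z --> nearx x] --> (0 : R).
        move=> A A0; have A1 : \forall h \near (0 : R)^'+, A h.
          by rewrite near_withinE; move: A0; apply: (@filterS _ (nbhs (0 : R))) => h.
        exact: (filter_prod2 (F := nbhs x) (P := A) A1).
      exact: (cvgZ S (cvg_cst w)).
    exact: C (clarke_real_near x v e20).
  apply: filterS2 N1 N2 => z h1 h2.
  have := lerD h1 h2; rewrite addrA subrK scalerDr [_ *: v + _]addrC addrA => /le_trans; apply.
  by rewrite -mulrDr addrACA -splitr.
have hZ b w : 0 < b -> clarke_real f x (b *: w) <= b * clarke_real f x w.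
  move=> b0; apply: clarke_real_le => e e0.
  have C : (z.1, z.2 * b) @[z --> nearx x] --> nearx x.
    apply: cvg_prodr; first exact: cvg_fst.
    move=> A [r /= r0 hA].
    have rb : 0 < r / b by rewrite divr_gt0.
    have N : \forall h \near (0 : R)^'+, 0 < h < r / b.
      near=> h; apply/andP; split; near: h; first exact: nbhs_right_gt.
      exact: nbhs_right_lt.
    suff : \forall z \near nearx x, A (z.2 * b) by [].
    have : \forall z \near nearx x, 0 < z.2 < r / b.
      exact: (filter_prod2 (F := nbhs x) N).
    apply: filterS => z /andP[z0 zr]; apply: hA => /=.
      rewrite sub0r normrN gtr0_norm ?mulr_gt0//.
      by rewrite -ltr_pdivlMr.
    by rewrite mulr_gt0.
  have eb : 0 < e / b by rewrite divr_gt0.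
  have : \forall z \near nearx x, f (z.1 + (z.2 * b) *: w) - f z.1 <=
      z.2 * b * (clarke_real f x w + e / b) by exact: (C _ (clarke_real_near x w eb)).
  apply: filterS => z.
  by rewrite scalerA -mulrA mulrDr [b * (_ / _)]mulrC divfK// gt_eqF.
move: a0; rewrite le_eqVlt => /orP[/eqP<-|a0].
  rewrite scale0r mul0r; apply/eqP; rewrite eq_le; apply/andP; split.
    by have := clarke_real_bound x 0; rewrite normr0 mulr0.
  rewrite -lee_fin -clarke_ddE; apply: limf_esup_ge.
  by apply: filterE => z; rewrite dquot_EFin scaler0 addr0 subrr mul0r.
apply/eqP; rewrite eq_le hZ//=.
have ai : 0 < a^-1 by rewrite invr_gt0.
have := hZ a^-1 (a *: v) ai; rewrite scalerA mulVf ?gt_eqF// scale1r.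
by rewrite mulrC ler_pdivlMr// mulrC.
Unshelve. all: by end_near. Qed.

Lemma clarke_subdiffP x (p : dual E) :
  clarke_subdiff (EFin \o f) x p <-> forall v, p v <= clarke_real f x v.
Proof. by split=> h v; have := h v; rewrite clarke_ddE lee_fin. Qed.

End lipschitz.

Lemma dual_le_eq (p q : dual E) : (forall v, p v <= q v :> R) -> p = q.
Proof.
move=> h; apply: dual_eq => v; apply/eqP; rewrite eq_le h/=.
by have := h (- v); rewrite !dualN lerN2.
Qed.

(** Strict differentiability on the compact set [[set v]] bounds the Clarke derivative by [g v], and
    a functional below another one equals it. *)
Lemma strict_clarke_subdiff f k x (g p : dual E) : lipschitz_const f k ->
  is_strict_derivative (EFin \o f) x g -> clarke_subdiff (EFin \o f) x p -> p = g.
Proof.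
move=> fk hg /(clarke_subdiffP fk) hp; apply: dual_le_eq => v.
apply: le_trans (hp v) _; rewrite -lee_fin -(clarke_ddE fk).
apply: limf_esup_le => e e0.
have [[A B] /= [A1 B1] AB] := hg [set v] (@compact_set1 E v) e e0.
have B2 : \forall h \near (0 : R)^'+, B h.
  have : \forall h \near (0 : R)^', B h by exact: B1.
  rewrite !near_withinE; apply: filterS => h hB h0; apply: hB.
  by rewrite gt_eqF.
exists (A, B); first by split.
move=> z /AB/(_ v erefl); rewrite !dquot_EFin !lee_fin ler_norml => /andP[_].
by rewrite lerBlDl.
Qed.

Section penalization.
Variables (f : E -> R) (k : R) (C : set E) (x : E) (p : dual E).
Hypotheses (fk : lipschitz_const f k) (Cx : C x).
Hypothesis fmin : forall v, C v -> p (x - v) <= f v - f x.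

Let C0 : C !=set0. Proof. by exists x. Qed.

Lemma dist_lipschitz1 : lipschitz_const (dist C) 1.
Proof.
move=> y z; rewrite mul1r ler_norml; apply/andP; split.
  by rewrite lerNl opprB lerBlDr distrC; exact: dist_lipschitz.
by rewrite lerBlDr; exact: dist_lipschitz.
Qed.

(* Exact penalization: x minimizes f + p + K dist C, for K large, over the whole space. *)
Lemma penalized_subdiff : setplus (clarke_subdiff (EFin \o f) x) (clarke_normal_cone C x) (- p).
Proof.
have [c c0 hc] := dual_bounded p.
have k0 : 0 <= `|k| by [].
(* A Lipschitz constant of [f + p]: moving [v] to a nearly closest point of [C] lowers the penalty
   by as much as [f + p] can grow. *)
pose K := `|k| + c.
have K0 : 0 <= K by rewrite addr_ge0// ltW.
have pen v : f x + p x <= f v + p v + K * dist C v.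
  apply/ler_addgt0Pr => e e0.
  have K1 : 0 < K + 1 by rewrite ltr_wpDl.
  have : dist C v < dist C v + e / (K + 1) by rewrite ltrDl divr_gt0.
  move=> /(dist_lt C0)[w Cw hw].
  have h1 := fmin Cw; rewrite dualB in h1.
  have h2 : f w <= f v + `|k| * `|v - w|.
    rewrite -lerBlDl; apply: le_trans (ler_norm _) _; apply: le_trans (fk _ _) _.
    by rewrite distrC ler_wpM2r// ler_norm.
  have h3 : p w <= p v + c * `|v - w|.
    by rewrite -lerBlDl -dualB; apply: le_trans (ler_norm _) _; rewrite (distrC v).
  have h4 : K * `|v - w| <= K * dist C v + e.
    apply: (@le_trans _ _ (K * (dist C v + e / (K + 1)))); first by rewrite ler_wpM2l// ltW.
    rewrite mulrDr lerD2l mulrA ler_pdivrMr// mulrC ler_wpM2l ?(ltW e0)//.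
    by rewrite lerDl.
  rewrite /K in h4 *; rewrite mulrDl in h4.
  have h5 : f x + p x <= f w + p w by rewrite lerBlDr in h1; rewrite -lerBlDr; lra.
  lra.
have dk := dist_lipschitz1.
(* By [pen] the increments of [f + p + K * dist C] from the base point [x] are nonnegative, and the
   Clarke derivatives dominate the quotients taken at that base point. *)
have key v : - p v <= clarke_real f x v + K * clarke_real (dist C) x v.
  apply/ler_addgt0Pr => e e0.
  pose d := e / (K + 1).
  have K1 : 0 < K + 1 by rewrite ltr_wpDl.
  have d0 : 0 < d by rewrite divr_gt0.
  have N1 := clarke_real_near fk x v d0.
  have N2 := clarke_real_near dk x v d0.
  have [[y h] /= [h0 [h1 h2]]] : exists z : E * R, 0 < z.2 /\
      (f (x + z.2 *: v) - f x <= z.2 * (clarke_real f x v + d) /\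
      dist C (x + z.2 *: v) - dist C x <= z.2 * (clarke_real (dist C) x v + d)).
    have C1 : (x, z.2) @[z --> nearx x] --> nearx x.
      by apply: cvg_prodr; [exact: cvg_cst|exact: cvg_snd].
    have {}N1 : \forall z \near nearx x,
        f (x + z.2 *: v) - f x <= z.2 * (clarke_real f x v + d) by exact: (C1 _ N1).
    have {}N2 : \forall z \near nearx x, dist C (x + z.2 *: v) - dist C x <=
        z.2 * (clarke_real (dist C) x v + d) by exact: (C1 _ N2).
    have [z [z0 [z1 z2]]] := filter_ex (filterI (near_snd_gt0 x) (filterI N1 N2)).
    by exists z.
  have := pen (x + h *: v); rewrite dualD dualZ => h3.
  rewrite (dist_self C0 Cx) subr0 in h2.
  have h4 := ler_wpM2l K0 h2.
  rewrite -(ler_pM2l h0).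
  have de : d * (K + 1) = e by rewrite divfK// gt_eqF.
  have h5 : h * (d * (K + 1)) = h * e by rewrite de.
  lra.
have sD : sublinear (fun v => K * clarke_real (dist C) x v).
  have [s1 s2] := sublinear_clarke_real dk x; split=> [u w|a u a0].
    by rewrite -mulrDr ler_wpM2l.
  by rewrite s2// mulrCA.
have lp : linear (fun v => - p v : R^o).
  by move=> a u w; rewrite dualD dualZ opprD scalerN.
have [q [n [lq ln hq hn pqn]]] := Hahn_Banach_split (sublinear_clarke_real fk x) sD lp key.
have [q' qE] := linear_dual lq (fun v => le_trans (hq v) (clarke_real_bound fk x v)).
have hn' v : n v <= K * `|v|.
  apply: le_trans (hn v) _; rewrite ler_wpM2l//.
  by apply: le_trans (clarke_real_bound dk x v) _; rewrite mul1r.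
have [n' nE] := linear_dual ln hn'.
exists q'; first by apply/(clarke_subdiffP fk) => v; rewrite qE.
(* On the tangent cone the Clarke derivative of the distance vanishes, hence [n], which lies below
   [K] times it, is nonpositive there. *)
exists n'.
  move=> v; rewrite /clarke_tangent_cone/= => Tv; rewrite nE.
  apply: le_trans (hn v) _; rewrite /clarke_real.
  have -> : EFin \o dist C = dist_to C by apply/funext => y; rewrite dist_toE.
  by rewrite Tv/= mulr0.
by apply: dual_eq => v; rewrite [LHS](_ : _ = q' v + n' v)// qE nE -pqn.
Qed.

End penalization.

End Clarke.

(** * Dini-Hadamard derivatives and regularity *)

Section DiniHadamard.
Context {R : realType} {E : completeNormedModType R}.
Implicit Types (f : E -> R) (x v : E).

(** Freezing the direction at [v] can only raise the lower limit. *)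
Lemma lower_dd_le f x v c :
  (forall e, 0 < e -> \forall h \near (0 : R)^'+, f (x + h *: v) - f x <= h * (c + e)) ->
  (lower_dd (EFin \o f) x v <= c%:E)%E.
Proof.
move=> H; rewrite /lower_dd limf_einfE; apply: ge_ereal_sup => _ [A [[P Q] /= [P1 Q1] PQ] <-].
apply/lee_addgt0Pr => e e0.
have [h [[h0 hh] Qh]] := filter_ex (filterI (filterI (nbhs_right_gt 0) (H e e0)) Q1).
have vP : P v by exact: nbhs_singleton.
apply: (@le_trans _ _ (dquot (EFin \o f) x v h)).
  by apply: ereal_inf_lbound; exists (v, h) => //; apply: PQ.
by rewrite dquot_EFin -EFinD lee_fin ler_pdivrMr// mulrC.
Qed.

(** By Lipschitz continuity the quotients along [u] and [v] differ by at most a multiple of the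
    distance from [u] to [v], so varying the direction does not lower the limit, which regularity
    identifies with the Clarke derivative. *)
Lemma regular_dini_subdiff f k x (p : dual E) : lipschitz_const f k ->
  regular_at (EFin \o f) x -> (forall v, p v <= clarke_real f x v) ->
  dini_hadamard_subdiff (EFin \o f) x p.
Proof.
move=> fk [_ reg] hp v; apply: (@le_trans _ _ (clarke_real f x v)%:E).
  by rewrite lee_fin.
rewrite /lower_dd /limf_einf leeNr; apply: limf_esup_le => e e0.
have := reg v; rewrite (clarke_ddE fk) => /fine_cvgP[_ /cvgrPdist_lt hv].
have e20 : 0 < e / 2 by rewrite divr_gt0.
have {}hv := hv _ e20.
have N1 : \forall z \near filter_prod (nbhs v) (0 : R)^'+,
    `|clarke_real f x v - (fine \o dquot (EFin \o f) x v) z.2| < e / 2.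
  exact: (filter_prod2 (F := nbhs v) hv).
have k1 : 0 < `|k| + 1 by rewrite ltr_wpDl.
have N0 : \forall u \near v, `|v - u| < e / 2 / (`|k| + 1).
  apply/nbhs_ballP; exists (e / 2 / (`|k| + 1)); first by rewrite /= divr_gt0.
  by move=> u; rewrite -ball_normE.
have N2 : \forall z \near filter_prod (nbhs v) (0 : R)^'+, `|v - z.1| < e / 2 / (`|k| + 1).
  exact: (filter_prod1 (G := (0 : R)^'+) N0).
have N3 := near_snd_gt0 v.
apply: filterS3 N1 N2 N3 => -[u h] /= h1 h2 h0.
rewrite lee_fin lerNl opprD opprK.
have h3 : `|f (x + h *: u) - f (x + h *: v)| <= h * (e / 2).
  apply: le_trans (fk _ _) _.
  rewrite opprD addrACA subrr add0r -scalerBr normrZ gtr0_norm// mulrCA ler_wpM2l ?(ltW h0)//.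
  apply: (@le_trans _ _ ((`|k| + 1) * `|u - v|)).
    by rewrite ler_wpM2r// (le_trans (ler_norm k))// lerDl.
  by rewrite mulrC -ler_pdivlMr// distrC ltW.
have h4 : (f (x + h *: v) - f x) / h - e / 2 <= (f (x + h *: u) - f x) / h.
  rewrite lerBlDr ler_pdivrMr// mulrDl divfK ?gt_eqF// lerBlDr addrAC subrK.
  by rewrite -lerBlDl mulrC; move: h3; rewrite distrC; apply: le_trans; exact: ler_norm.
move: h1; rewrite ltr_norml => /andP[_ h1]; lra.
Qed.

(** For each [v] the Hahn-Banach theorem gives a functional below the Clarke derivative that attains
    it at [v]. It belongs to the Dini-Hadamard subdifferential, hence is [p]. So the right
    derivative is the linear [p], and applying this to [- v] gives the left one. *)
Lemma regular_gateaux f k x (p : dual E) : lipschitz_const f k ->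
  regular_at (EFin \o f) x -> dini_hadamard_subdiff (EFin \o f) x = [set p] ->
  is_gateaux_derivative (EFin \o f) x p.
Proof.
move=> fk reg dp.
have pE v : clarke_real f x v = p v.
  have [q [lq hq qv]] := Hahn_Banach_support v (sublinear_clarke_real fk x).
  have [q' q'E] := linear_dual lq (fun v => le_trans (hq v) (clarke_real_bound fk x v)).
  have : dini_hadamard_subdiff (EFin \o f) x q'.
    by apply: regular_dini_subdiff fk reg _ => w; rewrite q'E.
  by rewrite dp => /= <-; rewrite q'E.
have key v : (f (x + h *: v) - f x) / h @[h --> (0 : R)^'+] --> (p v : R).
  have [_ reg'] := reg; have := reg' v.
  by rewrite (clarke_ddE fk) pE => /fine_cvgP[_].
move=> v; apply/fine_cvgP; split; first by apply: filterE => h.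
apply: (@cvg_at_right_left_dnbhs _ R^o); first exact: key.
have := key (- v); rewrite dualN => /cvgN; rewrite opprK.
move=> h1; apply/cvg_at_leftNP; rewrite oppr0.
apply: cvg_trans h1; apply: near_eq_cvg; near=> h.
transitivity (- ((f (x + h *: - v) - f x) / h)); first by [].
by rewrite /= scalerN scaleNr invrN mulrN.
Unshelve. all: by end_near. Qed.

End DiniHadamard.

(** * Weak* measurability *)

Section WeakStar.
Context {R : realType} {E : completeNormedModType R} {sepE : separable E}.

Let mI (i : interval R) := leb_measurable_itv i.

(* On bounded sets the weak* topology is generated by evaluations along a dense sequence. *)
Lemma weak_star_nbhs (e_ : nat -> E) (n : nat) (p : dual E) (U : set (dual E)) :
  (forall v d, 0 < d -> exists i, `|v - e_ i| < d) ->
  weak_star_open U -> U p -> (forall v, `|p v : R| <= n%:R * `|v|) ->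
  exists m k : nat, forall p' : dual E,
    (forall i, `|p' (e_ i) : R| <= n%:R * `|e_ i|) ->
    (forall i, (i < m)%N -> `|p' (e_ i) - p (e_ i) : R| < k.+1%:R^-1) -> U p'.
Proof.
move=> de [W oW <-] Wp pn.
(* The filter generated by the sets in the conclusion. It suffices that it converge pointwise to
   [p], since [W] is open for pointwise convergence. *)
pose F := [set A : set (dual E) | exists m k : nat, forall p' : dual E,
    (forall i, `|p' (e_ i) : R| <= n%:R * `|e_ i|) ->
    (forall i, (i < m)%N -> `|p' (e_ i) - p (e_ i) : R| < k.+1%:R^-1) -> A p'].
have FF : Filter F.
  split; first by exists 0, 0.
  - move=> A B [m [k hA]] [m' [k' hB]]; exists (maxn m m'), (maxn k k') => p' np' hp'.
    split; [apply: hA => // i im|apply: hB => // i im].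
      apply: lt_le_trans (hp' i _) _; first by rewrite leq_max im.
      by rewrite lef_pV2 ?posrE// ler_nat ltnS leq_maxl.
    apply: lt_le_trans (hp' i _) _; first by rewrite leq_max im orbT.
    by rewrite lef_pV2 ?posrE// ler_nat ltnS leq_maxr.
  - by move=> A B AB [m [k hA]]; exists m, k => p' np' hp'; apply: AB; exact: hA.
suff : {ptws, (fmap (@dual_fun R E : dual E -> E -> R^o) F) --> (p : E -> R^o)}.
  by move=> /(_ W); apply; exact: open_nbhs_nbhs.
apply/pointwise_cvgP => v; apply/cvgrPdist_lt => e e0.
(* Replacing [v] by [e_ i] costs at most [n%:R * d] for each of [p] and [p'], and their difference
   at [e_ i] is below [d]. *)
pose d := e / (2 * n%:R + 2).
have n0 : 0 < 2 * n%:R + 2 :> R by rewrite ltr_wpDl// mulr_ge0.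
have d0 : 0 < d by rewrite divr_gt0.
have [i hi] := de v _ d0.
have [k hk] : exists k : nat, k.+1%:R^-1 < d.
  exists (Num.bound d^-1); rewrite invf_plt ?posrE//.
  apply: lt_trans (archi_boundP (ltW _)) _; rewrite ?invr_gt0// ltr_nat//.
suff : F [set p' : dual E | `|p v - p' v : R| < e] by [].
exists i.+1, k => p' np' hp' /=.
have h1 := hp' i (ltnSn i).
have h2 : `|p (v - e_ i) : R| <= n%:R * d.
  by apply: le_trans (pn _) _; rewrite ler_wpM2l// ltW.
have h3 : `|p' (v - e_ i) : R| <= n%:R * d.
  have c3 : continuous (fun u => n%:R * `|u| - `|p' u : R|).
    move=> u; apply: cvgB; last by apply: cvg_norm; exact: dual_continuous.
    by apply: cvgM; [exact: cvg_cst|apply: cvg_norm; exact: cvg_id].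
  have h4 u : `|p' u : R| <= n%:R * `|u|.
    rewrite -subr_ge0 leNgt; apply/negP => neg.
    have /cvgrPdist_lt := c3 u; move=> /(_ _ (_ : 0 < - (n%:R * `|u| - `|p' u : R|))).
    rewrite oppr_gt0 => /(_ neg)/nbhs_ballP[r /= r0 hr].
    have [j hj] := de u _ r0.
    have /hr : ball u r (e_ j) by rewrite -ball_normE.
    rewrite ltr_norml => /andP[+ _].
    rewrite opprK ltrBrDr -ltrBrDl subrr; apply/negP; rewrite -leNgt.
    by rewrite subr_ge0; exact: np'.
  by apply: le_trans (h4 _) _; rewrite ler_wpM2l// ltW.
have -> : p v - p' v = p (v - e_ i) - p' (v - e_ i) - (p' (e_ i) - p (e_ i)) :> R.
  by rewrite !dualB; ring.
apply: le_lt_trans (ler_normB _ _) _.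
have h5 := le_trans (ler_normB _ _) (lerD h2 h3).
apply: lt_le_trans (ler_ltD h5 (lt_trans h1 hk)) _.
have -> : e = d * (2 * n%:R + 2) by rewrite divfK// gt_eqF.
by rewrite mulrDr; lra.
Qed.

(** Functionals of norm at most [n] whose values at the first [size a] points are known up to
    [k.+1%:R^-1]. Rounding to integers leaves only countably many such sets, each defined by
    countably many evaluations. *)
Let floor_set (e_ : nat -> E) (n k : nat) (a : seq int) : set (dual E) :=
  [set p | (forall i, `|p (e_ i) : R| <= n%:R * `|e_ i|) /\
    forall i, (i < size a)%N -> Num.floor (k.+1%:R * (p (e_ i) : R)) = nth 0 a i].

Lemma floor_near (c x y : R) : 0 < c -> Num.floor (c * x) = Num.floor (c * y) ->
  `|x - y| < c^-1.
Proof.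
move=> c0 xy; rewrite -(ltr_pM2l c0) divff ?gt_eqF// -[X in X * _](gtr0_norm c0) -normrM.
have /andP[h1 h2] := mem_rg1_floor (c * x); have /andP[h3 h4] := mem_rg1_floor (c * y).
rewrite xy in h1 h2; rewrite mulrBr ltr_norml; apply/andP; split; lra.
Qed.

Lemma weak_star_open_cover (e_ : nat -> E) (U : set (dual E)) (p : dual E) :
  (forall v d, 0 < d -> exists i, `|v - e_ i| < d) ->
  weak_star_open U -> U p ->
  exists n k a, floor_set e_ n k a p /\ floor_set e_ n k a `<=` U.
Proof.
move=> de oU Up; have [C C0 hC] := dual_bounded p.
have hn v : `|p v : R| <= (Num.bound C)%:R * `|v|.
  apply: le_trans (hC v) _; rewrite ler_wpM2r//; apply: ltW; apply: archi_boundP; exact: ltW.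
have [m [k h]] := weak_star_nbhs de oU Up hn.
exists (Num.bound C), k, (mkseq (fun i => Num.floor (k.+1%:R * (p (e_ i) : R))) m).
split; first by split=> // i; rewrite size_mkseq => im; rewrite nth_mkseq.
move=> p' [np' hp']; apply: h => // i im; apply: floor_near => //.
by rewrite hp' ?size_mkseq// nth_mkseq.
Qed.

Lemma weak_star_measurable_eval (q : R -> dual E) :
  (forall v, lmf `[0, +oo[ (fun t => q t v : R)) -> weak_star_measurable q.
Proof.
move=> mq.
have [e_ de] := separable_seq sepE.
pose D := `[(0 : R), +oo[%classic : set R.
have mD : leb_measurable D := mI _.
have mpre (f : R -> R) (B : set R) : lmf D f -> measurable B -> leb_measurable (D `&` f @^-1` B).
  by move=> mf mB; exact: mf.
have mF n k a : leb_measurable (D `&` q @^-1` floor_set e_ n k a).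
  rewrite (_ : _ `&` _ = \bigcap_i ((D `&` (fun t => `|q t (e_ i) : R|) @^-1` `]-oo, n%:R * `|e_ i|]) `&`
      (if (i < size a)%N then
        D `&` (fun t => k.+1%:R * (q t (e_ i) : R)) @^-1` `[(nth 0 a i)%:~R, (nth 0 a i + 1)%:~R[
       else D))); last first.
    apply/seteqP; split=> [t [Dt [h1 h2]] i _|t h].
      split; first by split=> //=; rewrite in_itv/=.
      case: ifPn => // ia; split => //=; rewrite in_itv/= -(h2 _ ia).
      exact: floor_itv.
    split; first by have [[]] := h 0%N I.
    split=> i; first by have [[_ /=]] := h i I; rewrite in_itv.
    move=> ia; have [_] := h i I; rewrite ia => -[_ /=]; rewrite in_itv/= => ha.
    exact: floor_def.
  apply: bigcapT_measurable => i; apply: measurableI.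
    by apply: mpre => //; exact: lmf_norm.
  case: ifP => // _; apply: mpre => //.
  by apply: lmfM => //; exact: lmf_cst.
have mO U : weak_star_open U -> leb_measurable (D `&` q @^-1` U).
  move=> oU.
  pose S (j : nat) : set (dual E) :=
    if @unpickle (nat * nat * seq int)%type j is Some (n, k, a) then
      if `[< floor_set e_ n k a `<=` U >] then floor_set e_ n k a else set0
    else set0.
  rewrite (_ : _ `&` _ = \bigcup_j (D `&` q @^-1` S j)); last first.
    apply/seteqP; split=> [t [Dt Ut]|t [j _ [Dt St]]].
      have [n [k [a [h1 h2]]]] := weak_star_open_cover de oU Ut.
      exists (pickle (n, k, a)) => //; split=> //; rewrite /S/= pickleK.
      by rewrite asboolT.
    split=> //; move: St; rewrite /S/=; case: unpickle => [[[n k] a]|//].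
    by case: ifPn => // /asboolP h /h.
  apply: bigcupT_measurable => j; rewrite /S; case: unpickle => [[[n k] a]|].
    by case: ifPn => _; [exact: mF|rewrite preimage_set0 setI0; exact: measurable0].
  by rewrite preimage_set0 setI0; exact: measurable0.
move=> U; apply: (@smallest_sub _ _ _ [set U | leb_measurable (D `&` q @^-1` U)]); last exact: mO.
split=> /=.
- by rewrite preimage_set0 setI0; exact: measurable0.
- move=> A mA; rewrite (_ : _ `&` _ = D `\` (D `&` q @^-1` A)); first exact: measurableD.
  apply/seteqP; split=> [t [Dt [_ nA]]|t [Dt nA]]; first by split=> // -[].
  by split=> //; split=> // At; apply: nA.
- move=> A mA; rewrite preimage_bigcup setI_bigcupr; exact: bigcupT_measurable.
Qed.

End WeakStar.

(** * Measurability in time of the value function *)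

Section ValueMeasurability.
Context {R : realType} {E : completeNormedModType R} {sepE : separable E}.
Variables (L : R -> E -> E -> \bar R) (Gamma : R -> E -> set E).
Variables (l1 l2 gamma : R -> R).
Hypothesis HG : regular_inclusion Gamma gamma.
Hypothesis HL : regular_cost L l1 l2 gamma.
Hypothesis Hadm : forall (t : R) xi, 0 <= t -> exists x, admissible Gamma t xi x.

Let mI (i : interval R) := leb_measurable_itv i.
Let gamma_ge0 := inclusion_bound_ge0 HG.
Local Notation V := (V L Gamma).
Local Notation Vlip := (Vlip l1 l2 gamma).
Local Notation Phi := (Phi l1 l2 gamma).
Local Notation Gint := (Gint gamma).

(** Up to the factor [1 + |b|], a density for the increase of [V ^~ b] in time: [Phi] accounts for
    the running cost, and [Vlip] times a velocity bound for the displacement of the state. *)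
Definition Vvar s := Phi s + Vlip * (gamma s * expR (Gint s)).

Lemma Vvar_ge0 s : 0 <= s -> 0 <= Vvar s.
Proof.
move=> s0; rewrite addr_ge0 ?(Phi_ge0 HG HL s0)//.
by rewrite mulr_ge0 ?(Vlip_ge0 HG HL)// mulr_ge0 ?expR_ge0// gamma_ge0.
Qed.

Let gexp_li T : 0 <= T -> leb_integrable `[0, T] (fun s => gamma s * expR (Gint s)).
Proof.
have lg := inclusion_bound_integrable HG.
move=> T0; exact: (li_gamma_homo gamma_ge0 lg (expR_lint_homo gamma_ge0 lg)
  (fun s _ => expR_ge0 _) T0).
Qed.

Lemma Vvar_integrable T : 0 <= T -> leb_integrable `[0, T] Vvar.
Proof.
move=> T0; apply: liD => //; last by apply: liZ => //; exact: gexp_li.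
apply: liS (Phi_integrable HG HL) => //.
by apply: subset_itvl; rewrite bnd_simp.
Qed.

(** A near-optimal trajectory [y] from [b] at time [t] bounds [V t' (y t')], and Lipschitz
    continuity moves [y t'] back to [b]. This one-sided estimate is what makes [K * H s - V s b]
    nondecreasing in [lmf_V]. *)
Lemma V_variation t t' b : 0 <= t -> t <= t' ->
  V t' b - V t b <= (1 + `|b|) * lint `[t, t'] Vvar.
Proof.
move=> t0 tt'; have t'0 := le_trans t0 tt'.
rewrite lerBlDl; apply/ler_addgt0Pr => e e0.
have [y [f [ty yt hJ]]] := V_near_optimal (sepE := sepE) HG HL Hadm b t0 e0.
have d1 := dynamic_programming_ge (sepE := sepE) HG HL Hadm t0 tt' ty.
have d2 := V_lipschitz (sepE := sepE) HG HL Hadm b (y t') t'0.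
have sub : `[t, t']%classic `<=` `[0, t']%classic by apply: subset_itvr; rewrite bnd_simp.
have iP : leb_integrable `[t, t'] Phi.
  by apply: liS (Phi_integrable HG HL) => //; apply: subset_itv; rewrite bnd_simp.
have ig : leb_integrable `[t, t'] (fun s => gamma s * expR (Gint s)).
  by apply: liS (gexp_li t'0).
have b0 : 0 <= 1 + `|b| by rewrite addr_ge0.
have d3 : - lint `[t, t'] (lagrangian L y f) <= (1 + `|b|) * lint `[t, t'] Phi.
  have il := lagrangian_li_itv (sepE := sepE) HG HL t' t0 ty (lexx t).
  rewrite -lintZ//; apply: le_trans (_ : lint `[t, t'] (fun s => `|lagrangian L y f s|) <= _).
    by apply: le_trans (lint_norm (mI _) il); rewrite -normrN ler_norm.
  apply: lint_le => //; [exact: li_norm|exact: liZ|].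
  move=> s /=; rewrite in_itv/= => /andP[ts _]; rewrite -yt.
  exact: (lagrangian_bound (sepE := sepE) HG HL t0 ty ts).
have d4 : `|b - y t'| <= (1 + `|b|) * lint `[t, t'] (fun s => gamma s * expR (Gint s)).
  have yf : primitive t y f by case: ty.
  rewrite -yt distrC; apply: le_trans (primitive_dist (sepE := sepE) yf (lexx t) tt') _.
  rewrite -lintZ//; apply: lint_le => //.
  - exact: (primitive_li yf t' (lexx t)).
  - exact: liZ.
  move=> s /=; rewrite in_itv/= => /andP[ts _].
  apply: le_trans (trajectory_velocity HG t0 ty ts) _.
  rewrite mulrCA ler_wpM2l ?gamma_ge0 ?(le_trans t0)//.
  apply: le_trans (trajectory_growth (sepE := sepE) HG t0 ty ts) _.
  rewrite yt; apply: (ler_wpM2l b0); rewrite ler_expR; exact: (gamma_lint_le HG).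
rewrite /Vvar lintD//; last exact: liZ.
rewrite lintZ// mulrDr mulrCA.
have d5 := ler_wpM2l (Vlip_ge0 HG HL) d4.
apply: le_trans d2 _; apply: le_trans (lerD (le_trans d1 (lerD (ltW hJ) d3)) d5) _.
by rewrite -addrA addrAC.
Qed.

(* By [V_variation], V(., b) is the difference of two nondecreasing functions. *)
Lemma lmf_V b : lmf `[0, +oo[ (V ^~ b).
Proof.
pose K := 1 + `|b|; pose H s := lint `[0, s] Vvar.
have hH : {in `[0, +oo[ &, {homo H : x y / x <= y}}.
  by apply: lint_homo; [exact: Vvar_ge0|exact: Vvar_integrable].
have h : {in `[0, +oo[ &, {homo (fun s => K * H s - V s b) : x y / x <= y}}.
  move=> x y; rewrite !in_itv/= !andbT => x0 y0 xy.
  have := V_variation b x0 xy.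
  have -> : lint `[x, y] Vvar = H y - H x.
    rewrite /H (lint_Chasles x0 xy); last exact: Vvar_integrable.
    by rewrite addrAC subrr add0r.
  have swap (p q r s : R) : s - q <= r - p -> p - q <= r - s by lra.
  by rewrite mulrBr; exact: swap.
have mH : lmf `[0, +oo[ H by exact: lmf_nondecreasing.
have mK : lmf `[0, +oo[ (fun s => K * H s - V s b) by exact: lmf_nondecreasing.
apply: (lmf_ext (f := fun s => K * H s - (K * H s - V s b))).
  by move=> s _; rewrite opprB addrC subrK.
apply: lmfB => //; apply: lmfM => //; exact: lmf_cst.
Qed.

Lemma lmf_V_along x : smeas `[0, +oo[ x -> lmf `[0, +oo[ (fun s => V s (x s)).
Proof.
apply: (@Caratheodory _ _ sepE _ V) => //; first exact: lmf_V.
by move=> s /=; rewrite in_itv/= andbT => s0; exact: (V_continuous (sepE := sepE) HG HL Hadm).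
Qed.

End ValueMeasurability.

(** * The maximum principle *)

Section DifferenceQuotients.
Context {R : realType} {E : completeNormedModType R}.

Lemma cvg_harmonic_dnbhs : (n.+1%:R^-1 : R) @[n --> \oo] --> (0 : R)^'.
Proof.
move=> A [r /= r0 hA].
suff : \forall n \near \oo, A (n.+1%:R^-1) by [].
near=> n; apply: hA; last by rewrite /= invr_eq0 pnatr_eq0.
rewrite /= sub0r normrN ger0_norm ?invr_ge0//.
by near: n; exact: near_infty_natSinv_lt (PosNum r0).
Unshelve. all: by end_near. Qed.

Lemma gateaux_seq (f : E -> R) x (g : dual E) v : is_gateaux_derivative (EFin \o f) x g ->
  (f (x + n.+1%:R^-1 *: v) - f x) / n.+1%:R^-1 @[n --> \oo] --> (g v : R).
Proof.
move=> /(_ v)/fine_cvgP[_ h].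
exact: (cvg_comp _ _ cvg_harmonic_dnbhs h).
Qed.

Lemma strict_gateaux (f : E -> R) x (g : dual E) : is_strict_derivative (EFin \o f) x g ->
  is_gateaux_derivative (EFin \o f) x g.
Proof.
move=> hg v; apply/fine_cvgP; split; first by apply: filterE => h.
apply/cvgrPdist_le => e e0.
have [[A B] /= [A1 B1] AB] := hg [set v] (@compact_set1 E v) e e0.
suff : \forall h \near (0 : R)^', `|(g v : R) - (f (x + h *: v) - f x) / h| <= e by [].
have : \forall h \near (0 : R)^', B h by exact: B1.
apply: filterS => h Bh.
have := AB (x, h) (conj (nbhs_singleton A1) Bh) v erefl.
by rewrite lee_fin distrC.
Qed.

Lemma lmf_cvg_ae (D : set R) (F : nat -> R -> R) (f : R -> R) : leb_measurable D ->
  (forall n, lmf D (F n)) -> (\forall s \ae leb, D s -> F n s @[n --> \oo] --> f s) ->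
  lmf D f.
Proof.
move=> mD mF Ff; pose P s := D s -> F n s @[n --> \oo] --> f s.
apply: (lmf_ae (f := fun s => if `[< P s >] then f s else 0)) => //.
  by apply: filterS Ff => s Ps _; rewrite asboolT.
apply: (lmf_cvg (F := fun n s => if `[< P s >] then F n s else 0)) => [n|s Ds].
  apply: lmf_ae (mF n) => //; first by apply: filterS Ff => s Ps _; rewrite asboolT.
by case: asboolP => [|_]; [exact|exact: cvg_cst].
Qed.

End DifferenceQuotients.

Section MaximumPrinciple.
Context {R : realType} {E : completeNormedModType R} {sepE : separable E}.
Variables (L : R -> E -> E -> \bar R) (Gamma : R -> E -> set E).
Variables (l1 l2 gamma : R -> R).
Hypothesis HG : regular_inclusion Gamma gamma.
Hypothesis HL : regular_cost L l1 l2 gamma.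
Hypothesis Hadm : forall (t : R) xi, 0 <= t -> exists x, admissible Gamma t xi x.

Let mI (i : interval R) := leb_measurable_itv i.
Local Notation V := (V L Gamma).
Local Notation Lfin := (Lfin L).
Local Notation Vlip := (Vlip l1 l2 gamma).

Lemma V_lipschitz_const t : 0 <= t -> lipschitz_const (V t) Vlip.
Proof.
move=> t0 a b; have h1 := V_lipschitz (sepE := sepE) HG HL Hadm a b t0.
have h2 := V_lipschitz (sepE := sepE) HG HL Hadm b a t0; rewrite distrC in h2.
rewrite ler_norml; apply/andP; split; last by rewrite lerBlDl.
by rewrite lerNl opprB lerBlDl.
Qed.

Lemma Lfin_lipschitz_const t x : 0 <= t -> lipschitz_const (Lfin t x) (l2 t).
Proof.
by move=> t0 v w; have := Lfin_lipschitz HL x v x w t0; rewrite subrr normr0 mulr0 add0r.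
Qed.

Lemma value_EFin t : 0 <= t -> value L Gamma t = EFin \o V t.
Proof. by move=> t0; apply/funext => a; rewrite /= (valueE (sepE := sepE) HG HL Hadm). Qed.

Lemma L_EFin t x : 0 <= t -> L t x = EFin \o Lfin t x.
Proof. by move=> t0; apply/funext => v; rewrite /= (LE HL). Qed.

Section optimal_trajectory.
Variables (x0 f0 : R -> E).
Hypothesis tx0 : trajectory Gamma 0 x0 f0.
Hypothesis x0_opt : J L 0 x0 f0 = V 0 (x0 0).
Hypothesis dx0_f0 : ae_from 0 (fun t => derive1 x0 t = f0 t).

Local Notation dx0 := (derive1 x0).

(** Inequality (i) at one time [t] with the inclusion of the derivative; (ii) and its refinements
    follow at that same [t]. *)
Definition value_dissipation t : Prop :=
  Gamma t (x0 t) (dx0 t) /\ forall v, Gamma t (x0 t) v ->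
    (lower_dd (value L Gamma t) (x0 t) (dx0 t - v)%R <=
       L t (x0 t) v - L t (x0 t) (dx0 t))%E.

Lemma ae_value_dissipation : ae_from 0 value_dissipation.
Proof.
have A := V_directional_bound (sepE := sepE) HG HL Hadm tx0 x0_opt.
have B := dx0_f0; rewrite /ae_from in A B *.
apply: filterS2 A B => t + + t0 => /(_ t0) h /(_ t0) dE.
split; first by rewrite dE; have [_] := tx0; apply.
move=> v Gv; rewrite dE value_EFin// L_EFin//= -EFinB.
by apply: lower_dd_le => e e0; exact: h.
Qed.

Lemma dini_subdiff_normal_cone t : 0 <= t -> value_dissipation t ->
  setopp (dini_hadamard_subdiff (value L Gamma t) (x0 t)) `<=`
    setplus (clarke_subdiff (L t (x0 t)) (dx0 t))
      (clarke_normal_cone (Gamma t (x0 t)) (dx0 t)).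
Proof.
move=> t0 [Gdx h] _ [p pV <-]; rewrite (L_EFin _ t0) in h *.
apply: (penalized_subdiff (Lfin_lipschitz_const (x0 t) t0) Gdx) => v Gv.
by have := le_trans (pV (dx0 t - v)) (h v Gv); rewrite -EFinB lee_fin.
Qed.

Lemma dini_subdiff_strict t gL : 0 <= t -> value_dissipation t ->
  is_strict_derivative (L t (x0 t)) (dx0 t) gL ->
  setopp (dini_hadamard_subdiff (value L Gamma t) (x0 t)) `<=`
    setplus [set gL] (clarke_normal_cone (Gamma t (x0 t)) (dx0 t)).
Proof.
move=> t0 ht hL p /(dini_subdiff_normal_cone t0 ht)[g gL' [n nN <-]].
rewrite (L_EFin _ t0) in hL gL'.
exists g; last by exists n.
exact: (strict_clarke_subdiff (Lfin_lipschitz_const (x0 t) t0) hL gL').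
Qed.

Definition adjoint_at t (q : dual E) : Prop :=
  clarke_normal_cone (Gamma t (x0 t)) (dx0 t) q /\
  exists gV gL, [/\ is_gateaux_derivative (value L Gamma t) (x0 t) gV,
    is_strict_derivative (L t (x0 t)) (dx0 t) gL & - gV = gL + q].

Lemma adjoint_exists t gL : 0 <= t -> value_dissipation t ->
  is_strict_derivative (L t (x0 t)) (dx0 t) gL ->
  regular_at (value L Gamma t) (x0 t) ->
  (exists p, dini_hadamard_subdiff (value L Gamma t) (x0 t) = [set p]) ->
  exists q, adjoint_at t q.
Proof.
move=> t0 ht hL reg [p dp].
have : setopp (dini_hadamard_subdiff (value L Gamma t) (x0 t)) (- p).
  by exists p => //; rewrite dp.
move=> /(dini_subdiff_strict t0 ht hL)[_ -> [q qN pq]].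
exists q; split => //; exists p, gL; split => //.
rewrite (value_EFin t0) in reg dp *.
exact: (regular_gateaux (V_lipschitz_const t0) reg dp).
Qed.

Lemma adjoint_measurable (q : R -> dual E) :
  ae_from 0 (fun t => adjoint_at t (q t)) -> weak_star_measurable q.
Proof.
move=> A; apply: (weak_star_measurable_eval (sepE := sepE)) => v.
have xf0 : primitive 0 x0 f0 by case: tx0.
have mx0 := primitive_smeas_self (sepE := sepE) xf0.
have mf0 : smeas `[0, +oo[ f0 by case: xf0.
pose h (n : nat) : R := n.+1%:R^-1.
(* The quotients of [L] are taken at [f0], whose measurability is part of [primitive]; it agrees
   with [dx0] off a null set. *)
pose F n t := - ((V t (x0 t + h n *: v) - V t (x0 t)) / h n) -
  (Lfin t (x0 t) (f0 t + h n *: v) - Lfin t (x0 t) (f0 t)) / h n.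
apply: (lmf_cvg_ae (F := F)) => //.
  move=> n.
  have m1 : smeas `[0, +oo[ (fun t => x0 t + h n *: v).
    by apply: (smeasD (sepE := sepE)) => //; exact: smeas_cst.
  have m2 : smeas `[0, +oo[ (fun t => f0 t + h n *: v).
    by apply: (smeasD (sepE := sepE)) => //; exact: smeas_cst.
  have mV x := lmf_V_along (sepE := sepE) HG HL Hadm (x := x).
  have mL f := @lmf_Lfin _ _ sepE _ _ _ _ HL 0 x0 f (lexx 0) mx0.
  rewrite /F; apply: lmfB => //.
    rewrite (_ : (fun t => _) = fun t => (V t (x0 t) - V t (x0 t + h n *: v)) * (h n)^-1).
      by apply: lmfM; [apply: lmfB => //; exact: mV|exact: lmf_cst].
    by apply/funext => t; rewrite -mulNr opprB.
  by apply: lmfM; [apply: lmfB => //; exact: mL|exact: lmf_cst].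
have B := dx0_f0; rewrite /ae_from in A B.
apply: filterS2 A B => t + + Dt; have t0 : 0 <= t by move: Dt; rewrite /= in_itv/= andbT.
move=> /(_ t0)[_ [gV [gL [hV hL qE]]]] /(_ t0) dE.
rewrite (L_EFin _ t0) dE in hL; rewrite (value_EFin t0) in hV.
have -> : q t v = - (gV v : R) - (gL v : R) :> R.
  have -> : q t = - gV - gL by rewrite qE addrC addKr.
  by [].
apply: cvgB; first by apply: cvgN; exact: gateaux_seq.
by apply: gateaux_seq; exact: strict_gateaux.
Qed.

End optimal_trajectory.
End MaximumPrinciple.

Theorem theorem3p2 (R : realType) (E : completeNormedModType R)
  (L : R -> E -> E -> \bar R) (Gamma : R -> E -> set E)
  (l1 l2 gamma : R -> R)
  (sepE : separable E)
  (L_ninfty : forall (t : R) x y, 0 <= t -> L t x y <> -oo%E)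
  (* (a) *)
  (adm_nonempty : forall (t : R) xi, 0 <= t -> exists x, admissible Gamma t xi x)
  (* (b) *)
  (L_measurable : forall x y, leb_measurable_fun `[0, +oo[ (fun t => L t x y))
  (* (c) *)
  (l1_ge0 : forall t : R, 0 <= t -> 0 <= l1 t)
  (l1_integrable : leb_integrable `[0, +oo[ l1)
  (l2_ge0 : forall t : R, 0 <= t -> 0 <= l2 t)
  (l2_locally_bounded :
    forall T : R, exists M, forall t : R, 0 <= t <= T -> l2 t <= M)
  (l2_integrable : leb_integrable `[0, +oo[ l2)
  (L_bound0 : forall t : R, 0 <= t -> (`|L t 0%R 0%R| <= (l1 t)%:E)%E)
  (L_lipschitz : forall (t : R) x y x' y', 0 <= t ->
    (`|L t x y - L t x' y'| <=
       (l1 t * `|x - x'| + l2 t * `|y - y'|)%:E)%E)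
  (* (d) *)
  (Gamma_nonempty : forall (t : R) x, 0 <= t -> Gamma t x !=set0)
  (Gamma_closed : forall (t : R) x, 0 <= t -> closed (Gamma t x))
  (* (e) *)
  (Gamma_lsc : forall x, lsc_multifunction (fun t => Gamma t x))
  (* (f) *)
  (gamma_ge0 : forall t : R, 0 <= t -> 0 <= gamma t)
  (gamma_locally_integrable :
    forall T : R, 0 <= T -> leb_integrable `[0, T] gamma)
  (Gamma_bound0 : forall t : R, 0 <= t -> Gamma t 0 `<=` scaled_ball (gamma t))
  (Gamma_lipschitz : forall (t : R) x x', 0 <= t ->
    Gamma t x `<=`
      setplus (Gamma t x') (scaled_ball (gamma t * `|x - x'|)))
  (* (g) *)
  (growth :
    let Gint s := fine (leb_integral `[0, s] (fun tau => (gamma tau)%:E)) in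
    (leb_integral `[0%R, +oo[ (fun s =>
       (expR (Gint s) * (1 + Gint s) * (l1 s + l2 s * gamma s))%R%:E)
     < +oo)%E)
  (xi : E) (x0 : R -> E)
  (x0_optimal : optimal L Gamma xi x0) :
  let V := value L Gamma in
  let dx0 : R -> E := derive1 x0 in
  let N t := clarke_normal_cone (Gamma t (x0 t)) (dx0 t) in
  (* (i) *)
  ae_from 0 (fun t => forall v, Gamma t (x0 t) v ->
    (lower_dd (V t) (x0 t) (dx0 t - v)%R <=
       L t (x0 t) v - L t (x0 t) (dx0 t))%E) /\
  (* (ii) *)
  ae_from 0 (fun t =>
    setopp (dini_hadamard_subdiff (V t) (x0 t)) `<=`
      setplus (clarke_subdiff (L t (x0 t)) (dx0 t)) (N t)) /\
  (ae_from 0 (fun t => strictly_differentiable (L t (x0 t)) (dx0 t)) ->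
   ae_from 0 (fun t =>
     exists2 gL, is_strict_derivative (L t (x0 t)) (dx0 t) gL &
       setopp (dini_hadamard_subdiff (V t) (x0 t)) `<=`
         setplus [set gL] (N t)) /\
   (ae_from 0 (fun t => regular_at (V t) (x0 t) /\
      exists p, dini_hadamard_subdiff (V t) (x0 t) = [set p]) ->
    exists q : R -> dual E,
      [/\ weak_star_measurable q,
          ae_from 0 (fun t => N t (q t)) &
          ae_from 0 (fun t => exists gV gL,
            [/\ is_gateaux_derivative (V t) (x0 t) gV,
                is_strict_derivative (L t (x0 t)) (dx0 t) gL &
                - gV = gL + q t])])).
Proof.
pose HG := RegularInclusion Gamma_nonempty Gamma_closed Gamma_lsc gamma_ge0
  gamma_locally_integrable Gamma_bound0 Gamma_lipschitz.
pose HL := RegularCost L_measurable l1_ge0 l1_integrable l2_ge0 l2_locally_bounded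
  l2_integrable L_bound0 L_lipschitz growth.
move=> V dx0 N; have [adx cx _] := x0_optimal.
have x0xi : x0 0 = xi by case: adx.
have [f0 [tx0 _ dx0_f0]] := admissible_trajectory (sepE := sepE) HG (lexx 0) adx.
have x0_opt : J L 0 x0 f0 = fine (value L Gamma 0 (x0 0)).
  by rewrite x0xi (iffLR (is_costP (sepE := sepE) HG HL _ (lexx 0) tx0 dx0_f0) cx).
have dissip := ae_value_dissipation (sepE := sepE) HG HL adm_nonempty tx0 x0_opt dx0_f0.
rewrite /ae_from in dissip *; split; [|split; [|move=> strict; split; [|move=> reg]]].
- by apply: filterS dissip => t h t0; have [] := h t0.
- apply: filterS dissip => t h t0.
  exact: (dini_subdiff_normal_cone HL t0 (h t0)).
- apply: filterS2 dissip strict => t h hs t0; have [gL hL] := hs t0.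
  exists gL => //.
  exact: (dini_subdiff_strict HL t0 (h t0) hL).
(* The choice does no harm to measurability: at almost every [t] the relation forces [q t] to be
   [- gV - gL], with both derivatives unique. *)
pose q t := xget 0 (adjoint_at L Gamma x0 t).
have hq : ae_from 0 (fun t => adjoint_at L Gamma x0 t (q t)).
  rewrite /ae_from in strict reg *; apply: filterS3 dissip strict reg => t h hs hr t0.
  have [gL hL] := hs t0; have [rV pV] := hr t0.
  have [p hp] := adjoint_exists (sepE := sepE) HG HL adm_nonempty t0 (h t0) hL rV pV.
  by rewrite /q; case: xgetP => [_ -> //|/(_ p)].
exists q; split.
- exact: (adjoint_measurable (sepE := sepE) HG HL adm_nonempty tx0 dx0_f0 hq).
- by rewrite /ae_from in hq; apply: filterS hq => t h t0; have [] := h t0.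
- by rewrite /ae_from in hq; apply: filterS hq => t h t0; have [] := h t0.
Qed.
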